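(* Let $\mathcal{T}_{st}$ be the standard hexagonal triangulation of the plane $S=\mathbb{C}$ with vertex set $V=L$ a lattice and edge set $E$. Let $I$ be a regular weight on $E$ with all values in $(-\frac12,1]$ or all values in $[0,+\infty)$, satisfying $I(e)=I(e+\delta)$ for all $e\in E$, $\delta\in V$, and satisfying the structure condition $I(e_i)+I(e_j)I(e_k)\ge0$, $\{i,j,k\}=\{1,2,3\}$, for every triangle of $\mathcal{T}_{st}$ with edges $e_1,e_2,e_3$. Let $l_0$ be a weighted Delaunay inversive distance circle packing metric on $(S,\mathcal{T}_{st},I)$ generated by a constant label $w_0:V\to\mathbb{R}$. Suppose $w:V\to\mathbb{R}$ is such that $w*l_0$ is a flat generalized weighted Delaunay inversive distance circle packing metric on $(S,\mathcal{T}_{st},I)$ and $(S,\mathcal{T}_{st},I,w*l_0)$ is embeddable into $\mathbb{C}$. Then $w$ is a constant function.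
   Context: Hexagonal triangulation: $V=L=\{m\vec v_1+n\vec v_2:m,n\in\mathbb{Z}\}$ for a basis $\vec v_1,\vec v_2$ (e.g. $\vec v_1=1,\vec v_2=e^{i\pi/3}$), with edges joining $v$ to $v\pm\vec v_1$, $v\pm\vec v_2$, $v\pm(\vec v_1-\vec v_2)$. For an edge $e$ and $\delta\in L$, $e+\delta$ is the translated edge. A weight $I:E\to(-1,+\infty)$ is regular if there are no adjacent triangles $t_1$ (edges $a,b,e$) and $t_2$ (edges $c,d,e$) with $I(e)=1$, $I(a)=-I(b)$, $I(c)=-I(d)$. Write $I_{ij}$ for the weight of $v_iv_j$. A function $l:E\to(0,+\infty)$ is a PL metric (resp. generalized PL metric) if it satisfies the strict (resp. non-strict) triangle inequality on every face. In a generalized PL metric, a face with $l_{ij}=l_{ik}+l_{jk}$ is degenerate with flat vertex $v_k$, its inner angles being $\pi$ at $v_k$ and $0$ at the other vertices. A (generalized) PL metric is flat if the inner angles at each interior vertex sum to $2\pi$. For a label $u:V\to\mathbb{R}$ put $r=e^u$ and $l_{ij}=\sqrt{r_i^2+r_j^2+2r_ir_jI_{ij}}$. If this is a PL metric (resp. generalized PL metric), it is called an inversive distance circle packing metric (resp. generalized inversive distance circle packing metric) generated by $u$. If $l_0$ is generated by $w_0$, then $w*l_0$ is the length function generated by the label $w_0+w$. For a face $\triangle v_iv_jv_k$ put $d_{ij}=\frac{r_i^2+r_ir_jI_{ij}}{l_{ij}}$. If the face is non-degenerate, its geometric center is the unique point $p$ in the plane with $|p-v_s|^2-r_s^2$ equal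 for $s=i,j,k$, and $h_{ij,k}$ is its signed distance to the line $v_iv_j$ (positive on the side of the triangle, negative on the other side); $\theta_{ij,k}=\pi+\arctan\frac{h_{ij,k}}{d_{ij}}$ if $d_{ij}<0$, $\frac{\pi}{2}$ if $d_{ij}=0$, $\arctan\frac{h_{ij,k}}{d_{ij}}$ if $d_{ij}>0$. If the face is degenerate, $\theta_{ij,k}=\frac{\pi}{2}$ if $v_i$ or $v_j$ is the flat vertex and $\theta_{ij,k}=-\frac{\pi}{2}$ if $v_k$ is. The generalized metric is weighted Delaunay if $\theta_{ij,k}+\theta_{ij,m}\ge0$ for every interior edge $v_iv_j$ shared by faces $\triangle v_iv_jv_k,\triangle v_iv_jv_m$. A (non-degenerate) inversive distance circle packing metric is weighted Delaunay if $h_{ij,k}+h_{ij,m}\ge0$ for every such edge. Developing map: for a flat generalized PL metric $l$ on a simply connected triangulated surface $(S,\mathcal{T})$, the developing map $\phi:S\to\mathbb{C}$ is the continuous map, affine on each face and unique up to isometries of the plane, obtained by laying out the faces one after another: $|\phi(v)-\phi(v')|=l(vv')$ for each edge, and non-degenerate faces are mapped in an orientation-consistent way (adjacent non-degenerate faces are placed on opposite sides of their common edge; in general, going around a vertex the successive edge directions are rotated by the successive inner angles). $(S,\mathcal{T},l,\phi)$ is embeddable into $\mathbb{C}$ if for every simply connected finite subcomplex $P$ of $\mathcal{T}$ there is a sequence of flat PL metrics on $P$ whose developing maps $\phi_n:P\to\mathbb{C}$ are topological embeddings and converge uniformly to $\phi|_P$. *)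

(* Defs.v *)
(* The real numbers are an arbitrary R : realType, and the complex plane is
   R * R, with its product topology and uniformity; dist is the Euclidean
   distance. *)
From HB Require Import structures.
From mathcomp Require Import all_boot all_order all_algebra finmap.
From mathcomp Require Import all_classical all_reals all_analysis.
From mathcomp Require Import ring lra.

Set Implicit Arguments.
Unset Strict Implicit.
Unset Printing Implicit Defensive.

Import Order.TTheory GRing.Theory Num.Theory numFieldNormedType.Exports.

Local Open Scope classical_set_scope.
Local Open Scope ring_scope.

Section Hexagonal.

(* The pair (m, n) stands for the lattice point m v1 + n v2. *)
Definition vertex := (int * int)%type.

(* Listed in cyclic order around a vertex, so that v, v + hex_dir t and
   v + hex_dir t.+1 are the vertices of a face for each t. *)
Definition hex_dirs : seq vertex :=
  [:: (1, 0); (0, 1); (-1, 1); (-1, 0); (0, -1); (1, -1)].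

Definition hex_dir (t : nat) : vertex := nth 0 hex_dirs (t %% 6).

Definition adj (u v : vertex) : bool := v - u \in hex_dirs.

(* A complex is its set of simplices, given by their vertex sets.  The
   hexagonal triangulation is the clique complex of its edge graph: any three
   pairwise adjacent lattice points bound a face, and no four are pairwise
   adjacent. *)
Definition hexT : set {fset vertex} :=
  [set s | s != fset0 /\
     forall u v : vertex, u \in s -> v \in s -> u != v -> adj u v].

Definition subcomplex (K : set {fset vertex}) : Prop :=
  K `<=` hexT /\
  forall s t : {fset vertex}, K s -> t != fset0 -> fsubset t s -> K t.

Definition edge (K : set {fset vertex}) (i j : vertex) : Prop :=
  i != j /\ K [fset i; j]%fset.

Definition face (K : set {fset vertex}) (i j k : vertex) : Prop :=
  [/\ i != j, i != k, j != k & K [fset i; j; k]%fset].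

Definition interior_vertex (K : set {fset vertex}) (v : vertex) : Prop :=
  forall s : {fset vertex}, hexT s -> v \in s -> K s.

End Hexagonal.

Section Weights.
Variable R : realType.
Implicit Types (K : set {fset vertex}) (I : vertex -> vertex -> R).

(* Functions on edges are represented by functions of two vertices that are
   symmetric on edges; values off the edges are irrelevant. *)
Definition weight K I : Prop :=
  forall i j, edge K i j -> I i j = I j i /\ -1 < I i j.

Definition regular K I : Prop :=
  ~ exists i j k m, [/\ face K i j k, face K i j m & k != m] /\
      [/\ I i j = 1, I i k = - I j k & I i m = - I j m].

Definition structure_condition K I : Prop :=
  forall i j k, face K i j k -> 0 <= I i j + I i k * I j k.

Definition translation_invariant K I : Prop :=
  forall i j delta : vertex, edge K i j -> I (i + delta) (j + delta) = I i j.

End Weights.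

Section PLMetrics.
Variable R : realType.
Implicit Types (K : set {fset vertex}) (l : vertex -> vertex -> R).

Definition edge_length K l : Prop :=
  forall i j, edge K i j -> l i j = l j i /\ 0 < l i j.

Definition PL_metric K l : Prop :=
  edge_length K l /\ forall i j k, face K i j k -> l i j < l i k + l j k.

Definition gen_PL_metric K l : Prop :=
  edge_length K l /\ forall i j k, face K i j k -> l i j <= l i k + l j k.

(* The angle at i in the triangle i j k, by the law of cosines.  On degenerate
   triangles this yields pi at the flat vertex and 0 at the two others; see
   inner_angle_flat and inner_angle_nonflat. *)
Definition inner_angle l (i j k : vertex) : R :=
  acos ((l i j ^+ 2 + l i k ^+ 2 - l j k ^+ 2) / (2 * l i j * l i k)).

Definition cone_angle l (v : vertex) : R :=
  \sum_(t < 6) inner_angle l v (v + hex_dir t) (v + hex_dir t.+1).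

Definition flat K l : Prop :=
  forall v, interior_vertex K v -> cone_angle l v = 2 * pi.

Lemma inner_angle_flat l i j k :
  0 < l i j -> 0 < l i k -> l j k = l i j + l i k -> inner_angle l i j k = pi.
Proof.
move=> ij ik e; rewrite /inner_angle e -acosN1; congr acos.
by field; rewrite !gt_eqF.
Qed.

Lemma inner_angle_nonflat l i j k :
  0 < l i j -> 0 < l i k -> 0 < l j k ->
  l i j = l i k + l j k \/ l i k = l i j + l j k -> inner_angle l i j k = 0.
Proof.
move=> ij ik jk e; rewrite /inner_angle -acos1; congr acos.
have nz : 2 * l i j * l i k != 0 by rewrite !mulf_neq0 ?gt_eqF ?ltr0n.
apply: (mulIf nz); rewrite divfK // mul1r.
by case: e => ->; ring.
Qed.

End PLMetrics.

Section Plane.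
Variable R : realType.
Local Notation plane := (R * R)%type.
Implicit Types (K : set {fset vertex}) (l : vertex -> vertex -> R).

Definition dist (p q : plane) : R :=
  Num.sqrt ((p.1 - q.1) ^+ 2 + (p.2 - q.2) ^+ 2).

Definition rot (a : R) (z : plane) : plane :=
  (cos a * z.1 - sin a * z.2, sin a * z.1 + cos a * z.2).

Definition is_basis (v1 v2 : plane) : Prop := v1.1 * v2.2 - v1.2 * v2.1 != 0.

Definition pos (v1 v2 : plane) (v : vertex) : plane :=
  v.1%:~R *: v1 + v.2%:~R *: v2.

Definition barycentric (s : {fset vertex}) (a : vertex -> R) : Prop :=
  (forall v, v \in s -> 0 <= a v) /\ \sum_(v <- s) a v = 1.

Definition carrier (v1 v2 : plane) K : set plane :=
  [set p | exists s a, [/\ K s, barycentric s a &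
                         p = \sum_(v <- s) a v *: pos v1 v2 v]].

Definition affine_on_simplices (v1 v2 : plane) K (phi : plane -> plane) : Prop :=
  forall s a, K s -> barycentric s a ->
    phi (\sum_(v <- s) a v *: pos v1 v2 v) =
    \sum_(v <- s) a v *: phi (pos v1 v2 v).

(* In each face, the direction of the side i k is that of the side i j turned
   by the inner angle at i, always counterclockwise (eps = 1) or always
   clockwise (eps = -1); both occur since developing maps are only determined
   up to isometries, including orientation-reversing ones. *)
Definition developing_map (v1 v2 : plane) K l (phi : plane -> plane) : Prop :=
  [/\ {within carrier v1 v2 K, continuous phi},
      affine_on_simplices v1 v2 K phi,
      forall i j, edge K i j -> dist (phi (pos v1 v2 i)) (phi (pos v1 v2 j)) = l i j &
      exists2 eps : R, eps = 1 \/ eps = -1 &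
        forall (i : vertex) (t : nat),
          let j := i + hex_dir t in let k := i + hex_dir t.+1 in
          face K i j k ->
          phi (pos v1 v2 k) - phi (pos v1 v2 i) =
          (l i k / l i j) *:
            rot (eps * inner_angle l i j k) (phi (pos v1 v2 j) - phi (pos v1 v2 i))].

Definition topological_embedding (A : set plane) (f : plane -> plane) : Prop :=
  [/\ {within A, continuous f},
      set_inj A f &
      forall U : set plane, open U ->
        exists2 W : set plane, open W & f @` (A `&` U) = f @` A `&` W].

Definition path_connected (A : set plane) : Prop :=
  A !=set0 /\
  forall x y, A x -> A y -> exists gamma : R -> plane,
    [/\ {within `[0, 1], continuous gamma},
        forall t, t \in `[0, 1] -> A (gamma t),
        gamma 0 = x & gamma 1 = y].

(* Every loop in A is homotopic in A, rel base point, to a constant loop. *)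
Definition simply_connected (A : set plane) : Prop :=
  path_connected A /\
  forall gamma : R -> plane,
    {within `[0, 1], continuous gamma} ->
    (forall t, t \in `[0, 1] -> A (gamma t)) ->
    gamma 0 = gamma 1 ->
    exists H : R * R -> plane,
      [/\ {within `[0, 1] `*` `[0, 1], continuous H},
          forall s t, s \in `[0, 1] -> t \in `[0, 1] -> A (H (s, t)),
          forall t, t \in `[0, 1] -> H (0, t) = gamma t,
          forall t, t \in `[0, 1] -> H (1, t) = gamma 0 &
          forall s, s \in `[0, 1] -> H (s, 0) = gamma 0 /\ H (s, 1) = gamma 0].

Definition embeddable (v1 v2 : plane) (phi : plane -> plane) : Prop :=
  forall P : set {fset vertex},
    subcomplex P -> finite_set P -> simply_connected (carrier v1 v2 P) ->
    exists (l_ : nat -> vertex -> vertex -> R) (phi_ : nat -> plane -> plane),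
      (forall n, [/\ PL_metric P (l_ n), flat P (l_ n),
                     developing_map v1 v2 P (l_ n) (phi_ n) &
                     topological_embedding (carrier v1 v2 P) (phi_ n)]) /\
      {uniform carrier v1 v2 P, phi_ @ \oo --> phi}.

End Plane.

Section CirclePacking.
Variable R : realType.
Local Notation plane := (R * R)%type.
Implicit Types (K : set {fset vertex}) (I l : vertex -> vertex -> R).
Implicit Types (u : vertex -> R).

Definition cp_length I u (i j : vertex) : R :=
  let r v := expR (u v) in
  Num.sqrt (r i ^+ 2 + r j ^+ 2 + 2 * r i * r j * I i j).

Definition cp_metric K I u : Prop := PL_metric K (cp_length I u).

Definition gen_cp_metric K I u : Prop := gen_PL_metric K (cp_length I u).

Definition d_ I u (i j : vertex) : R :=
  (expR (u i) ^+ 2 + expR (u i) * expR (u j) * I i j) / cp_length I u i j.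

Definition power (p z : plane) (r : R) : R := dist p z ^+ 2 - r ^+ 2.

Definition geometric_center (zi zj zk : plane) (ri rj rk : R) (p : plane) : Prop :=
  power p zi ri = power p zj rj /\ power p zi ri = power p zk rk.

Lemma geometric_center_unique (a ri rj rk : R) (c : plane) :
  a != 0 -> c.2 != 0 ->
  exists! p, geometric_center (0, 0) (a, 0) c ri rj rk p.
Proof.
have powE (p z : plane) r :
    power p z r = (p.1 - z.1) ^+ 2 + (p.2 - z.2) ^+ 2 - r ^+ 2.
  by rewrite /power /dist sqr_sqrtr // addr_ge0 ?sqr_ge0.
case: c => c1 c2 /= a0 c0.
pose x := (a ^+ 2 + ri ^+ 2 - rj ^+ 2) / (2 * a).
pose y := (c1 ^+ 2 + c2 ^+ 2 + ri ^+ 2 - rk ^+ 2 - 2 * x * c1) / (2 * c2).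
have ex : 2 * a * x = a ^+ 2 + ri ^+ 2 - rj ^+ 2 by rewrite /x; field.
have ey : 2 * c2 * y = c1 ^+ 2 + c2 ^+ 2 + ri ^+ 2 - rk ^+ 2 - 2 * x * c1.
  by rewrite /y; field.
exists (x, y); split; first by rewrite /geometric_center !powE /=; split; lra.
case=> x' y'; rewrite /geometric_center !powE /= => -[e1 e2].
have a20 : 2 * a != 0 by rewrite mulf_neq0.
have c20 : 2 * c2 != 0 by rewrite mulf_neq0.
have exx : x = x' by apply: (mulfI a20); lra.
by congr pair => //; apply: (mulfI c20); rewrite ey exx; lra.
Qed.

(* Position of k in the plane once i is put at the origin, j on the positive
   real axis and k above it. *)
Definition apex l (i j k : vertex) : plane :=
  let a := inner_angle l i j k in (l i k * cos a, l i k * sin a).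

(* The line through i and j is the real axis and the triangle lies above it, so
   the signed distance of the geometric center to that line is its ordinate.
   On non-degenerate faces the center exists and is unique
   (geometric_center_unique); h_ is not used on degenerate ones. *)
Definition h_ I u (i j k : vertex) : R :=
  let l := cp_length I u in
  (xget 0 [set p | geometric_center (0, 0) (l i j, 0) (apex l i j k)
                     (expR (u i)) (expR (u j)) (expR (u k)) p]).2.

Definition theta_ I u (i j k : vertex) : R :=
  let l := cp_length I u in
  if l i j == l i k + l j k then - (pi / 2)
  else if (l j k == l i j + l i k) || (l i k == l i j + l j k) then pi / 2
  else if d_ I u i j < 0 then pi + atan (h_ I u i j k / d_ I u i j)
  else if d_ I u i j == 0 then pi / 2
  else atan (h_ I u i j k / d_ I u i j).

Definition weighted_Delaunay K I u : Prop :=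
  forall i j k m, face K i j k -> face K i j m -> k != m ->
    0 <= h_ I u i j k + h_ I u i j m.

(* theta_ depends on the order of i and j; the condition is imposed for both
   orders of the end points of every edge. *)
Definition gen_weighted_Delaunay K I u : Prop :=
  forall i j k m, face K i j k -> face K i j m -> k != m ->
    0 <= theta_ I u i j k + theta_ I u i j m.

End CirclePacking.

(* Main.v *)
(* The angles at a vertex only depend on the ratios of its radius to the radii
   of its neighbours, and they obey a maximum principle: if two labels with
   total angle 2 pi agree at a vertex and the second is nowhere larger at its
   neighbours, they agree there too; when some weight exceeds 1 this rests on
   the Delaunay condition, which calibrates the angles around each spoke.

   Embeddability bounds the increments u (v + d) - u v: otherwise, by the
   maximum principle, tiny circles form chains reaching far among large ones,
   and of the many faces with one tiny and two large vertices two would be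
   nearly parallel and overlap.  Translating a nearly maximal increment to the
   origin and taking limits, the maximum principle for u and u (. + d) makes the
   increment constant; doing so for two directions d yields a linear label.

   On a layout of a nonconstant linear label the lattice acts by similarities
   with a common center.  If a face is non-degenerate, congruent faces along a
   level line of the label accumulate and overlap.  Otherwise the vertices lie
   on a line and the similarities are real factors: if these are positive, some
   spoke violates the Delaunay condition, and if not, strips of faces spread
   over the center and cross.  Hence the linear label is constant, that
   is, the suprema of the increments of u vanish. *)
Require Import Defs.
From HB Require Import structures.
From mathcomp Require Import all_boot all_order all_algebra finmap.
From mathcomp Require Import all_classical all_reals all_analysis.
From mathcomp Require Import complex.
From mathcomp Require Import ring lra zify.

Set Implicit Arguments.
Unset Strict Implicit.
Unset Printing Implicit Defensive.

Import Order.TTheory GRing.Theory Num.Theory numFieldNormedType.Exports.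

Local Open Scope classical_set_scope.
Local Open Scope ring_scope.

(** * Inverse trigonometric functions *)

(** The obstacle is the sign of [hnum], the numerator both of the signed distance from the geometric
    center to a side and of the derivative of the cosine of an angle in a radius ratio. If all
    weights are at most 1, the structure condition and regularity make it positive: angles are
    monotone and no face degenerates. If the weights are nonnegative and one exceeds 1, both may
    fail, but then [GG < 0]. The center splits the angle at a vertex into two parts whose sines are
    [mm] over a side length, and the denominator of [mm] is the root of [QQ = DD - GG], which stays
    positive when the area [DD] vanishes. Degenerate faces thus obey the same formulas as the
    others, and the Delaunay condition, read as a sign of a sum of two [mm], survives limits. The
    Delaunay condition on the constant label yields [p t <= 1 + p t.+1 + p t.+2], which makes
    constants admissible as comparison labels: this drives the growth of tiny and large
    components. *)

Section Trigonometry.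
Variable R : realType.
Implicit Types x y z k : R.

Lemma sqr_le1 x : x ^+ 2 <= 1 -> -1 <= x <= 1.
Proof. by move=> h; nra. Qed.

Lemma acos_lt x y : -1 <= x <= 1 -> -1 <= y <= 1 -> x < y -> acos y < acos x.
Proof.
move=> hx hy xy.
have dx : acos x \in `[0, pi] by rewrite in_itv /= acos_ge0 // acos_lepi.
have dy : acos y \in `[0, pi] by rewrite in_itv /= acos_ge0 // acos_lepi.
by rewrite -(ltr_cos dy dx) !acosK ?in_itv.
Qed.

Lemma acos_le x y : -1 <= x <= 1 -> -1 <= y <= 1 -> x <= y -> acos y <= acos x.
Proof.
move=> hx hy; rewrite le_eqVlt => /predU1P[->//|xy].
exact/ltW/acos_lt.
Qed.

Lemma asin_lt x y : -1 <= x <= 1 -> -1 <= y <= 1 -> x < y -> asin x < asin y.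
Proof.
move=> hx hy xy.
have dx : asin x \in `[- (pi/2), pi/2].
  by rewrite in_itv /= asin_geNpi2 // asin_lepi2.
have dy : asin y \in `[- (pi/2), pi/2].
  by rewrite in_itv /= asin_geNpi2 // asin_lepi2.
by rewrite -(ltr_sin dx dy) !asinK ?in_itv.
Qed.

Lemma asin_le x y : -1 <= x <= 1 -> -1 <= y <= 1 -> x <= y -> asin x <= asin y.
Proof.
move=> hx hy; rewrite le_eqVlt => /predU1P[->//|xy].
exact/ltW/asin_lt.
Qed.

Lemma asin0 : asin (0 : R) = 0.
Proof.
have h : (0 : R) \in `[- (pi/2), pi/2].
  by rewrite in_itv /=; have := pi_gt0 R; lra.
by rewrite -{1}(@sin0 R) (sinK h).
Qed.

Lemma asinN x : -1 <= x <= 1 -> asin (- x) = - asin x.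
Proof.
move=> hx.
have h : - asin x \in `[- (pi/2), pi/2].
  rewrite in_itv /= lerN2 asin_lepi2 //=.
  by have := asin_geNpi2 hx; lra.
by rewrite -[in LHS](asinK (_ : x \in `[-1, 1])) ?in_itv // -sinN (sinK h).
Qed.

Lemma cos_asinD x y : -1 <= x <= 1 -> -1 <= y <= 1 ->
  cos (asin x + asin y) =
    Num.sqrt (1 - x ^+ 2) * Num.sqrt (1 - y ^+ 2) - x * y.
Proof.
by move=> hx hy; rewrite cosD !cos_asin // !asinK ?in_itv.
Qed.

Lemma asinD_ge0 x y : -1 <= x <= 1 -> -1 <= y <= 1 ->
  (0 <= asin x + asin y) = (0 <= x + y).
Proof.
move=> hx hy; apply/idP/idP => h.
  rewrite leNgt; apply/negP => h1.
  have : asin x < asin (- y) by apply: asin_lt; lra.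
  by rewrite asinN //; lra.
have : asin (- y) <= asin x by apply: asin_le; lra.
by rewrite asinN //; lra.
Qed.

Lemma acos_asinD x y z : -1 <= x <= 1 -> -1 <= y <= 1 -> 0 <= x + y ->
  z = Num.sqrt (1 - x ^+ 2) * Num.sqrt (1 - y ^+ 2) - x * y ->
  acos z = asin x + asin y.
Proof.
move=> hx hy xy ->; rewrite -cos_asinD // cosK // in_itv /=.
rewrite asinD_ge0 // xy /=.
by have := asin_lepi2 hx; have := asin_lepi2 hy; lra.
Qed.

(** The equation is the identity between the cosines of the angles of a triangle. All three angles
    are at most [pi / 2], so comparing the cosines of [acos x + acos y] and [pi - acos z] loses
    nothing. *)
Lemma acos_sum x y z : 0 <= x <= 1 -> 0 <= y <= 1 -> 0 <= z <= 1 ->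
  1 - x ^+ 2 - y ^+ 2 - z ^+ 2 - 2 * x * y * z = 0 ->
  acos x + acos y + acos z = pi.
Proof.
move=> hx hy hz e.
have half (a : R) : 0 <= a <= 1 -> acos a <= pi / 2.
  move=> ha; have h : acos a <= acos 0. by apply: acos_le; lra.
  by rewrite acos0 in h.
have ge (a : R) : 0 <= a <= 1 -> 0 <= acos a by move=> ha; apply: acos_ge0; lra.
have d1 : acos x + acos y \in `[0, pi].
  rewrite in_itv /= addr_ge0 ?ge //=.
  by have := half _ hx; have := half _ hy; lra.
have d2 : pi - acos z \in `[0, pi].
  by rewrite in_itv /=; have := half _ hz; have := ge _ hz; lra.
suff: acos x + acos y = pi - acos z by lra.
apply: (can_in_inj (@cosK R)) => //.
have -> : cos (pi - acos z) = - z.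
  rewrite cosB cospi sinpi acosK ?in_itv /=; lra.
rewrite cosD !acosK ?in_itv /=; try lra.
rewrite !sin_acos; try lra.
rewrite -sqrtrM; last by nra.
have -> : (1 - x ^+ 2) * (1 - y ^+ 2) = (z + x * y) ^+ 2 by lra.
by rewrite sqrtr_sqr ger0_norm; nra.
Qed.

(* Rationalizing, x sqrt (1 - k^2 y^2) - y sqrt (1 - k^2 x^2) is x^2 - y^2 over a
   quantity that decreases with k. *)
Lemma asin_diff_scale x y k : 0 <= y -> y < x -> x <= 1 -> 0 < k -> k < 1 ->
  asin (k * x) - asin (k * y) < asin x - asin y.
Proof.
move=> y0 yx x1 k0 k1.
have hx : -1 <= x <= 1 by lra.
have hy : -1 <= y <= 1 by lra.
have hkx : -1 <= k * x <= 1 by nra.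
have hky : -1 <= k * y <= 1 by nra.
have le1 (a b : R) : -1 <= a <= 1 -> -1 <= b <= 1 -> 0 <= b -> b <= a ->
    asin a - asin b \in `[- (pi/2), pi/2].
  move=> ha hb b0 ab; rewrite in_itv /=.
  have := asin_lepi2 ha; have := asin_le hb ha ab.
  have : asin 0 <= asin b by apply: asin_le; lra.
  by rewrite asin0; have := pi_gt0 R; lra.
rewrite -ltr_sin ?le1 //; try nra.
rewrite !sinB !asinK ?in_itv // !cos_asin //.
set A := Num.sqrt (1 - y ^+ 2); set B := Num.sqrt (1 - x ^+ 2).
set A' := Num.sqrt (1 - (k * y) ^+ 2); set B' := Num.sqrt (1 - (k * x) ^+ 2).
have [A0 B0 A'0 B'0] : [/\ 0 <= A, 0 <= B, 0 <= A' & 0 <= B'].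
  by split; apply: sqrtr_ge0.
have A2 : A ^+ 2 = 1 - y ^+ 2 by rewrite sqr_sqrtr //; nra.
have B2 : B ^+ 2 = 1 - x ^+ 2 by rewrite sqr_sqrtr //; nra.
have sk (a : R) : (k * a) ^+ 2 <= a ^+ 2.
  by rewrite exprMn ler_piMl ?sqr_ge0 // expr_le1 // ltW.
have A'2 : A' ^+ 2 = 1 - (k * y) ^+ 2.
  by rewrite sqr_sqrtr // subr_ge0 (le_trans (sk _)) //; nra.
have B'2 : B' ^+ 2 = 1 - (k * x) ^+ 2.
  by rewrite sqr_sqrtr // subr_ge0 (le_trans (sk _)) //; nra.
have AA : A <= A' by apply: ler_wsqrtr; rewrite lerD2l lerN2 sk.
have BB : B <= B' by apply: ler_wsqrtr; rewrite lerD2l lerN2 sk.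
have A1 : 0 < A by rewrite sqrtr_gt0; nra.
have s : (x * A - B * y) * (x * A + B * y) = x ^+ 2 - y ^+ 2.
  have -> : (x * A - B * y) * (x * A + B * y) =
     x ^+ 2 * A ^+ 2 - y ^+ 2 * B ^+ 2 by ring.
  by rewrite A2 B2; ring.
have s' : (x * A' - B' * y) * (x * A' + B' * y) = x ^+ 2 - y ^+ 2.
  have -> : (x * A' - B' * y) * (x * A' + B' * y) =
     x ^+ 2 * A' ^+ 2 - y ^+ 2 * B' ^+ 2 by ring.
  by rewrite A'2 B'2; ring.
have p1 : 0 < x * A + B * y by rewrite ltr_pwDl // ?mulr_gt0 ?mulr_ge0 //; lra.
have p2 : x * A + B * y <= x * A' + B' * y by nra.
have p3 : 0 < x ^+ 2 - y ^+ 2 by nra.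
have p4 : 0 < x * A' - B' * y.
  have : 0 < (x * A' - B' * y) * (x * A' + B' * y) by rewrite s'.
  by rewrite pmulr_lgt0 //; lra.
have p5 : x * A' - B' * y <= x * A - B * y.
  rewrite -(ler_pM2r p1) s -s'; apply: ler_wpM2l => //; exact: ltW.
have -> : k * x * A' - B' * (k * y) = k * (x * A' - B' * y) by ring.
nra.
Qed.

(** For two nonnegative terms this is monotonicity, for opposite signs it is [asin_diff_scale].
    Later [k] is the factor by which both sines at a spoke shrink. *)
Lemma asin_sum_scale x y k : -1 <= x <= 1 -> -1 <= y <= 1 -> 0 <= x + y ->
  0 < k -> k <= 1 ->
  asin (k * x) + asin (k * y) <= asin x + asin y /\
  (asin (k * x) + asin (k * y) = asin x + asin y -> k = 1 \/ x + y = 0).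
Proof.
wlog xy : x y / y <= x => [th|].
  have [yx|xy] := leP y x; first exact: th.
  move=> hx hy s k0 k1; rewrite addrC [asin x + _]addrC [x + y]addrC.
  by apply: th => //; lra.
move=> hx hy s k0; rewrite le_eqVlt => /predU1P[->|k1].
  by rewrite !mul1r; split => // _; left.
have [y0|y0] := ltP y 0; last first.
  have le1 (a : R) : 0 <= a <= 1 -> asin (k * a) <= asin a /\
      (asin (k * a) = asin a -> a = 0).
    move=> ha; have [a0|a0] := ltP 0 a; last first.
      have -> : a = 0 by lra.
      by rewrite mulr0.
    have h : asin (k * a) < asin a by apply: asin_lt; nra.
    by split; lra.
  have /le1[h1 h1'] : 0 <= x <= 1 by lra.
  have /le1[h2 h2'] : 0 <= y <= 1 by lra.
  split; first lra.
  move=> e; right; rewrite h1'; last by lra.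
  by rewrite h2'; lra.
have [e|ne] := eqVneq (x + y) 0.
  have -> : y = - x by lra.
  by rewrite mulrN !asinN ?subrr; [split => // _; right; lra|nra..].
have h : asin (k * x) - asin (k * - y) < asin x - asin (- y).
  by apply: asin_diff_scale; lra.
by move: h; rewrite mulrN !asinN; [split; lra|nra..].
Qed.

End Trigonometry.

(** * Triangles of a circle packing *)

Section InversiveTriangle.
Variable R : realType.
Implicit Types p q c s t : R.

(* A face with a vertex of radius 1, two others of radii 1/s and 1/t, weights p
   and q at the first vertex and c opposite to it. In units of their radii the
   two other vertices are at distance sqrt (zz p s) and sqrt (zz q t) from the
   first one, and NN is the inner product of the position vectors. *)
Definition zz p s : R := 1 + s ^+ 2 + 2 * s * p.
Definition NN p q c s t : R := s * t + t * p + s * q - c.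
(** Gram determinant of the two position vectors: four times the squared area, up to the radii. It
    vanishes exactly on degenerate faces (see [heron]). *)
Definition DD p q c s t : R := zz p s * zz q t - NN p q c s t ^+ 2.
(** Determinant of the matrix with diagonal entries 1 and off-diagonal entries [- p], [- q], [- c].
    On a non-degenerate face the power of the geometric center is [- GG / DD] in units of the first
    radius squared, so [GG < 0] means that a circle orthogonal to all three exists. *)
Definition GG p q c : R := 1 - p ^+ 2 - q ^+ 2 - c ^+ 2 - 2 * p * q * c.
(** On a non-degenerate face, [QQ / DD] is the squared distance from the first vertex to the
    geometric center, in units of the radius there. *)
Definition QQ p q c s t : R :=
  (1 - q ^+ 2) * (s + p) ^+ 2 + 2 * (c + p * q) * (s + p) * (t + q)
  + (1 - p ^+ 2) * (t + q) ^+ 2.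
(** Numerator of the signed distance from the center to the side of weight [p] ([h_E]), and also of
    the derivative in [s] of the cosine of the angle ([hnumE]). *)
Definition hnum p q c s t : R :=
  (1 - p ^+ 2) * (t + q) + (c + p * q) * (s + p).
(** Over [Num.sqrt (zz p s)] this is the sine of [theta_] (see [theta_sin]): height of the center
    over its distance to the vertex. [DD] has cancelled, so degenerate faces are covered as long as
    [QQ > 0]. *)
Definition mm p q c s t : R := hnum p q c s t / Num.sqrt (QQ p q c s t).
Definition ang p q c s t : R :=
  acos (NN p q c s t / (Num.sqrt (zz p s) * Num.sqrt (zz q t))).

Lemma DD_QQ p q c s t : DD p q c s t = QQ p q c s t + GG p q c.
Proof. by rewrite /DD /QQ /GG /zz /NN; ring. Qed.

Lemma QQC p q c s t : QQ q p c t s = QQ p q c s t.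
Proof. by rewrite /QQ; ring. Qed.

Lemma zz_gt0 p s : -1 < p -> 0 < s -> 0 < zz p s.
Proof.
rewrite /zz => hp hs.
have h : 0 < s * (p + 1) by rewrite mulr_gt0 //; lra.
by have := sqr_ge0 (s - 1); lra.
Qed.

Lemma zzE p s : zz p s = (s + p) ^+ 2 + (1 - p ^+ 2).
Proof. by rewrite /zz; ring. Qed.

Lemma zz_le p s s' : -1 < p -> 0 < s + p -> s <= s' -> zz p s <= zz p s'.
Proof. by rewrite !zzE => hp hs ss; nra. Qed.

Lemma DD_cos_bound p q c s t : 0 < zz p s -> 0 < zz q t -> 0 <= DD p q c s t ->
  -1 <= NN p q c s t / (Num.sqrt (zz p s) * Num.sqrt (zz q t)) <= 1.
Proof.
move=> z1 z2 d; apply: sqr_le1.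
rewrite expr_div_n ler_pdivrMr; last by rewrite exprn_gt0 ?mulr_gt0 ?sqrtr_gt0.
rewrite mul1r exprMn (sqr_sqrtr (ltW z1)) (sqr_sqrtr (ltW z2)).
by move: d; rewrite /DD; lra.
Qed.

Lemma one_sub_sqr_ge0 p : -1 < p <= 1 -> 0 <= 1 - p ^+ 2.
Proof. by move=> h; nra. Qed.

Definition small_weights p q c : Prop :=
  [/\ -1 < p <= 1, -1 < q <= 1, -1 < c <= 1 &
      [/\ 0 <= p + q * c, 0 <= q + p * c & 0 <= c + p * q]].

(** Every coefficient of the expansion is nonnegative: for weights at most 1 the triangle
    inequalities are automatic. *)
Lemma DD_ge0_mono p q c s t : small_weights p q c -> 0 < s -> 0 < t -> 0 <= DD p q c s t.
Proof.
case=> hp hq hc [gp gq gc] s0 t0.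
have -> : DD p q c s t = (1 - q ^+ 2) * s ^+ 2 + (1 - p ^+ 2) * t ^+ 2
  + (1 - c ^+ 2) + 2 * (c + p * q) * (s * t) + 2 * (p + q * c) * s
  + 2 * (q + p * c) * t by rewrite /DD /zz /NN; ring.
have h := one_sub_sqr_ge0.
have h1 := mulr_ge0 (h _ hq) (sqr_ge0 s).
have h2 := mulr_ge0 (h _ hp) (sqr_ge0 t).
have h3 := mulr_ge0 gc (ltW (mulr_gt0 s0 t0)).
have h4 := mulr_ge0 gp (ltW s0); have h5 := mulr_ge0 gq (ltW t0).
by have := h _ hc; lra.
Qed.

Lemma hnum_gt0 p q c s t : small_weights p q c -> ~ (p = 1 /\ q = - c) -> 0 < s -> 0 < t ->
  0 < hnum p q c s t.
Proof.
case=> hp hq hc [gp gq gc] nreg s0 t0.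
have -> : hnum p q c s t = (1 - p ^+ 2) * t + (c + p * q) * s + (q + p * c).
  by rewrite /hnum; ring.
have h : 0 <= (1 - p ^+ 2) * t by rewrite mulr_ge0 ?one_sub_sqr_ge0 // ltW.
have h' : 0 <= (c + p * q) * s by rewrite mulr_ge0 // ltW.
have [p1|p1] := eqVneq p 1.
  have qc : 0 < c + p * q.
    rewrite lt_neqAle gc andbT; apply/eqP => e; apply: nreg.
    by split=> //; move: e; rewrite p1 mul1r => e; lra.
  have : 0 < (c + p * q) * s by rewrite mulr_gt0.
  by lra.
have : 0 < (1 - p ^+ 2) * t.
  rewrite mulr_gt0 //; have : p < 1 by rewrite lt_neqAle p1; lra.
  by nra.
by lra.
Qed.

(** Monotonicity without derivatives: [e1] and [e2] express the differences through the values of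
    [hnum] at both ends, which are positive. *)
Lemma ang_lt p q c s s' t : small_weights p q c -> ~ (p = 1 /\ q = - c) -> 0 < s -> 0 < t -> s < s' ->
  ang p q c s' t < ang p q c s t.
Proof.
move=> sw nreg s0 t0 ss; have [hp hq hc [gp gq gc]] := sw.
have s'0 : 0 < s' by lra.
have z1 : 0 < zz p s by apply: zz_gt0; lra.
have z1' : 0 < zz p s' by apply: zz_gt0; lra.
have z2 : 0 < zz q t by apply: zz_gt0; lra.
apply: acos_lt; [exact/DD_cos_bound/DD_ge0_mono|exact/DD_cos_bound/DD_ge0_mono|].
rewrite !invfM !mulrA ltr_pM2r ?invr_gt0 ?sqrtr_gt0 //.
rewrite ltr_pdivrMr ?sqrtr_gt0 // mulrAC ltr_pdivlMr ?sqrtr_gt0 //.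
set r := Num.sqrt (zz p s); set r' := Num.sqrt (zz p s').
have r0 : 0 < r by rewrite sqrtr_gt0.
have r'0 : 0 < r' by rewrite sqrtr_gt0.
have r2 : r ^+ 2 = zz p s by rewrite sqr_sqrtr // ltW.
have r'2 : r' ^+ 2 = zz p s' by rewrite sqr_sqrtr // ltW.
have T := hnum_gt0 sw nreg s0 t0; have T' := hnum_gt0 sw nreg s'0 t0.
set N := NN p q c s t; set N' := NN p q c s' t.
have e1 : N' ^+ 2 * r ^+ 2 - N ^+ 2 * r' ^+ 2 =
    (s' - s) * (hnum p q c s t * N' + hnum p q c s' t * N).
  by rewrite r2 r'2 /N /N' /NN /hnum /zz; ring.
have e2 : hnum p q c s t * N' - hnum p q c s' t * N =
    (s' - s) * ((1 - p ^+ 2) * (t + q) ^+ 2 + (c + p * q) ^+ 2).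
  by rewrite /N /N' /NN /hnum; ring.
have e3 : 0 <= hnum p q c s t * N' - hnum p q c s' t * N.
  rewrite e2; apply: mulr_ge0; first by rewrite subr_ge0 ltW.
  by rewrite addr_ge0 ?sqr_ge0 // mulr_ge0 ?sqr_ge0 // one_sub_sqr_ge0.
(* Cosines of equal sign are compared through their squares; by [e3], [N'] cannot be negative when
   [N] is not. *)
have [N0|N0] := leP 0 N.
  have N'0 : 0 <= N'.
    have : 0 <= hnum p q c s t * N' by have := mulr_ge0 (ltW T') N0; lra.
    by rewrite pmulr_rge0.
  have pos : 0 < hnum p q c s t * N' + hnum p q c s' t * N.
    have a1 := mulr_ge0 (ltW T) N'0; have a2 := mulr_ge0 (ltW T') N0.
    rewrite ltNge; apply/negP => e.
    have N0' : N = 0.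
      by apply/eqP; rewrite -(mulrI_eq0 N (mulfI (lt0r_neq0 T'))); apply/eqP; lra.
    have N'0' : N' = 0.
      by apply/eqP; rewrite -(mulrI_eq0 N' (mulfI (lt0r_neq0 T))); apply/eqP; lra.
    move: e2; rewrite N0' N'0' !mulr0 subrr => /esym/eqP.
    rewrite mulf_eq0 subr_eq0 (gt_eqF ss) /= paddr_eq0 ?sqr_ge0 //; last first.
      by rewrite mulr_ge0 ?sqr_ge0 // one_sub_sqr_ge0.
    rewrite mulf_eq0 !expf_eq0 /= => /andP[h /eqP h2].
    have : hnum p q c s t = 0.
      rewrite /hnum h2 mul0r addr0; apply/eqP; rewrite mulf_eq0.
      by case/orP: h => ->; rewrite ?orbT.
    by lra.
  have : (N * r') ^+ 2 < (N' * r) ^+ 2.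
    rewrite -subr_gt0 !exprMn e1 mulr_gt0 ?subr_gt0 //.
  by rewrite ltr_pXn2r // nnegrE mulr_ge0 // ltW.
have [N'0|N'0] := leP 0 N'.
  by apply: lt_le_trans (_ : 0 <= _); [rewrite nmulr_rlt0|rewrite mulr_ge0 // ltW].
have : (N' * r) ^+ 2 < (N * r') ^+ 2.
  rewrite -subr_lt0 !exprMn e1 pmulr_rlt0 ?subr_gt0 //.
  by rewrite -oppr_gt0 opprD -!mulrN addr_gt0 // mulr_gt0 // oppr_gt0.
rewrite -[(N' * r) ^+ 2]sqrrN -[(N * r') ^+ 2]sqrrN -!mulNr.
by rewrite ltr_pXn2r ?nnegrE ?mulr_ge0 ?oppr_ge0 ?ltW // !mulNr ltrN2.
Qed.

Lemma angC p q c s t : ang q p c t s = ang p q c s t.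
Proof.
rewrite /ang; congr acos; rewrite [X in _ / X]mulrC; congr (_ / _).
by rewrite /NN; ring.
Qed.

End InversiveTriangle.

(** * Comparison of angles when some weight exceeds 1 *)

Section Calibration.
Variable R : realType.
Implicit Types p q c s t : R.

(** Here [fj = s + p] and [fk = t + q] come from the old face, [x] and [y] from the new one, and
    [aj = 1 - p ^+ 2], [ak = 1 - q ^+ 2], [b = c + p * q]; the inequality with [cc * Q ^+ 2] says
    [0 <= DD] on the new face. If one old sine is negative, the other one outweighs it also over the
    new side lengths. *)
Lemma calib_sign (aj ak b fj fk x y mj mk cc Q : R) :
  0 < fj -> 0 < fk -> fj <= x -> fk <= y -> 0 < Q -> 0 < cc <= 1 ->
  mj ^+ 2 = aj + cc * fj ^+ 2 -> mk ^+ 2 = ak + cc * fk ^+ 2 ->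
  mj * mk = b - cc * fj * fk -> mj * fk + mk * fj = Q ->
  cc * Q ^+ 2 <= ak * x ^+ 2 + 2 * b * x * y + aj * y ^+ 2 ->
  mj < 0 -> aj < 0 ->
  0 < mk /\ (- mj) ^+ 2 * (y ^+ 2 + ak) <= mk ^+ 2 * (x ^+ 2 + aj).
Proof.
move=> fj0 fk0 fx fy Q0 /andP[c0 c1] ej ek ejk eQ D mj0 aj0.
have x0 : 0 < x by lra.
have y0 : 0 < y by lra.
have -> : aj = mj ^+ 2 - cc * fj ^+ 2 by lra.
have -> : ak = mk ^+ 2 - cc * fk ^+ 2 by lra.
have M2 : mj ^+ 2 < cc * fj ^+ 2 by lra.
set M := - mj; have M0 : 0 < M by rewrite oppr_gt0.
have Mmj : mj = - M by rewrite opprK.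
rewrite {}Mmj sqrrN in ej ejk eQ M2 *; clearbody M.
have mk0 : 0 < mk.
  by rewrite -(pmulr_lgt0 _ fj0); have := mulr_gt0 M0 fk0; lra.
split=> //.
(* On the old face [P] equals [Q]. On the new one it is shown to be positive and then at least
   [cc * Q]. *)
set P := mk * x - M * y.
have P2 : cc * (Q ^+ 2 + (fj * y - fk * x) ^+ 2) <= P ^+ 2.
  suff -> : P ^+ 2 = ak * x ^+ 2 + 2 * b * x * y + aj * y ^+ 2
     + cc * (fj * y - fk * x) ^+ 2 by lra.
  have -> : ak = mk ^+ 2 - cc * fk ^+ 2 by lra.
  have -> : aj = M ^+ 2 - cc * fj ^+ 2 by lra.
  have -> : b = - M * mk + cc * fj * fk by lra.
  by rewrite /P; ring.
have P0 : 0 < P.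
  rewrite ltNge; apply/negP => Pn.
  have e : M * (fj * y - fk * x) = Q * x + fj * (- P) by rewrite /P -eQ; ring.
  have h1 : cc * (fj * P) ^+ 2 + cc * (Q * M) ^+ 2 <= (M * P) ^+ 2.
    have h5 : (fj * P) ^+ 2 <= (M * (fj * y - fk * x)) ^+ 2.
      have h3 : 0 <= Q * x by rewrite mulr_ge0 ?ltW.
      have h4 : 0 <= fj * (- P) by rewrite mulr_ge0 ?oppr_ge0 // ltW.
      have -> : (fj * P) ^+ 2 = (fj * - P) ^+ 2 by ring.
      by rewrite e ler_pXn2r ?nnegrE ?addr_ge0 // lerDr.
    have := ler_wpM2l (ltW c0) h5; have := ler_wpM2l (sqr_ge0 M) P2.
    by lra.
  have h2 : (M * P) ^+ 2 <= cc * (fj * P) ^+ 2.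
    by have := ler_wpM2r (sqr_ge0 P) (ltW M2); lra.
  have : 0 < cc * (Q * M) ^+ 2 by rewrite mulr_gt0 // exprn_gt0 // mulr_gt0.
  by lra.
have P3 : cc * Q ^+ 2 <= P ^+ 2.
  apply: le_trans P2; rewrite ler_pM2l // lerDl; exact: sqr_ge0.
have P4 : cc * Q <= P.
  have h : (cc * Q) ^+ 2 <= P ^+ 2.
    apply: le_trans P3; rewrite exprMn ler_pM2r ?exprn_gt0 //.
    by rewrite expr2 ger_pMl.
  by rewrite -(ler_pXn2r (ltn0Sn 1)) ?nnegrE // ?ltW // mulr_gt0.
have e : mk ^+ 2 * (x ^+ 2 + (M ^+ 2 - cc * fj ^+ 2))
   - M ^+ 2 * (y ^+ 2 + (mk ^+ 2 - cc * fk ^+ 2))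
   = (P ^+ 2 - cc * Q ^+ 2) + 2 * M * (P * y - cc * Q * fk).
  by rewrite /P -eQ; ring.
rewrite -subr_ge0 e; apply: addr_ge0; first by rewrite subr_ge0.
apply: mulr_ge0; first by rewrite mulr_ge0 // ltW.
rewrite subr_ge0 [cc * Q * fk]mulrC [P * y]mulrC.
by apply: ler_pM => //; apply/ltW => //; apply: mulr_gt0.
Qed.

(** Reversed Cauchy-Schwarz inequality for the indefinite form [x ^+ 2 - cc * f ^+ 2]; the defect is
    [cc * (x * fk - y * fj) ^+ 2], which settles the case of equality. *)
Lemma calib_cauchy (fj fk x y cc : R) :
  0 < fj -> 0 < fk -> fj <= x -> fk <= y -> 0 < cc <= 1 ->
  Num.sqrt (x ^+ 2 - cc * fj ^+ 2) * Num.sqrt (y ^+ 2 - cc * fk ^+ 2)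
    <= x * y - cc * fj * fk /\
  (Num.sqrt (x ^+ 2 - cc * fj ^+ 2) * Num.sqrt (y ^+ 2 - cc * fk ^+ 2)
    = x * y - cc * fj * fk -> x = fj -> y = fk).
Proof.
move=> fj0 fk0 fx fy /andP[c0 c1].
have sq (f z : R) : 0 < f -> f <= z -> 0 <= z ^+ 2 - cc * f ^+ 2.
  move=> f0 fz; rewrite subr_ge0.
  apply: le_trans (_ : f ^+ 2 <= _); first by rewrite ger_pMl ?exprn_gt0.
  by rewrite ler_pXn2r ?nnegrE //; lra.
have xy0 : 0 <= x * y - cc * fj * fk.
  rewrite subr_ge0 -mulrA; apply: le_trans (_ : fj * fk <= _).
    by rewrite ger_pMl // mulr_gt0.
  by apply: ler_pM => //; exact: ltW.
have e : (x * y - cc * fj * fk) ^+ 2 =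
   (x ^+ 2 - cc * fj ^+ 2) * (y ^+ 2 - cc * fk ^+ 2) + cc * (x * fk - y * fj) ^+ 2.
  by ring.
rewrite -sqrtrM ?sq //; split.
  rewrite -(ler_pXn2r (ltn0Sn 1)) ?nnegrE ?sqrtr_ge0 // sqr_sqrtr ?mulr_ge0 ?sq //.
  by rewrite e lerDl mulr_ge0 ?sqr_ge0 // ltW.
move=> e1 xf; move: e; rewrite -e1 sqr_sqrtr ?mulr_ge0 ?sq // => e.
have : cc * (x * fk - y * fj) ^+ 2 = 0 by lra.
move/eqP; rewrite mulf_eq0 (gt_eqF c0) /= sqrf_eq0 subr_eq0 xf => /eqP h.
by apply: (mulIf (lt0r_neq0 fj0)); rewrite -h mulrC.
Qed.

Section Triangle.
Variables p q c s t : R.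
Hypotheses (p0 : 0 <= p) (q0 : 0 <= q) (c0 : 0 <= c).
Hypotheses (G0 : GG p q c < 0) (s0 : 0 < s) (t0 : 0 < t).
Hypothesis D0 : 0 <= DD p q c s t.

Let Q := Num.sqrt (QQ p q c s t).
(** On a non-degenerate face, the squared ratio between the radius of the orthogonal circle and the
    distance of its center from the vertex. That it is at most 1 amounts to [0 <= DD]. *)
Let cc := - GG p q c / QQ p q c s t.

Lemma QQ_gt0 : 0 < QQ p q c s t.
Proof. by move: D0 G0; rewrite DD_QQ; lra. Qed.

Lemma calib_facts :
  [/\ 0 < Q, 0 < cc <= 1,
      mm p q c s t ^+ 2 = 1 - p ^+ 2 + cc * (s + p) ^+ 2,
      mm p q c s t * mm q p c t s = c + p * q - cc * (s + p) * (t + q) &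
      mm p q c s t * (t + q) + mm q p c t s * (s + p) = Q].
Proof.
have QQ0 := QQ_gt0.
have Qn : QQ p q c s t != 0 by exact: lt0r_neq0.
have Q0 : 0 < Q by rewrite sqrtr_gt0.
have Qn' : Q != 0 by exact: lt0r_neq0.
have Q2 : Q ^+ 2 = QQ p q c s t by rewrite sqr_sqrtr // ltW.
split=> //.
- rewrite /cc divr_gt0 ?oppr_gt0 //= ler_pdivrMr // mul1r.
  by move: D0; rewrite DD_QQ; lra.
- have e : hnum p q c s t ^+ 2 =
      (1 - p ^+ 2) * QQ p q c s t - GG p q c * (s + p) ^+ 2.
    by rewrite /hnum /QQ /GG; ring.
  by rewrite /mm -/Q expr_div_n Q2 /cc e; field.
- have e : hnum p q c s t * hnum q p c t s =
      (c + p * q) * QQ p q c s t + GG p q c * (s + p) * (t + q).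
    by rewrite /hnum /QQ /GG; ring.
  by rewrite /mm (QQC p q c s t) -/Q mulf_div -expr2 Q2 /cc e; field.
- have e : hnum p q c s t * (t + q) + hnum q p c t s * (s + p) = QQ p q c s t.
    by rewrite /hnum /QQ; ring.
  rewrite /mm (QQC p q c s t) -/Q.
  have -> : hnum p q c s t / Q * (t + q) + hnum q p c t s / Q * (s + p) =
     (hnum p q c s t * (t + q) + hnum q p c t s * (s + p)) / Q by field.
  by rewrite e -Q2 expr2 mulfK.
Qed.

Lemma mm_neg : mm p q c s t < 0 -> 1 - p ^+ 2 < 0.
Proof.
move=> m0; have Q0 : 0 < Q by rewrite sqrtr_gt0 QQ_gt0.
have : hnum p q c s t < 0 by move: m0; rewrite /mm pmulr_llt0 // invr_gt0.
rewrite /hnum => h; rewrite ltNge; apply/negP => a0.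
have h1 : 0 <= (1 - p ^+ 2) * (t + q).
  by rewrite mulr_ge0 // addr_ge0 // ltW.
have h2 : 0 <= (c + p * q) * (s + p).
  by rewrite mulr_ge0 ?addr_ge0 ?mulr_ge0 // ltW.
by lra.
Qed.

End Triangle.

End Calibration.

Section FaceCalibration.
Variable R : realType.
Implicit Types p q c s t : R.

Lemma GGC p q c : GG q p c = GG p q c.
Proof. by rewrite /GG; ring. Qed.

Lemma DDC p q c s t : DD q p c t s = DD p q c s t.
Proof. by rewrite !DD_QQ QQC GGC. Qed.

(* Both angles are computed in the plane spanned by the direction of the common
   perpendicular and the side jk; the comparison vector of k has the length it
   has in the new face and the abscissa mm it has in the old one. *)
Lemma ang_calib p q c s t s' t' : 0 <= p -> 0 <= q -> 0 <= c -> GG p q c < 0 ->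
  0 < s -> 0 < t -> s <= s' -> t <= t' ->
  0 <= DD p q c s t -> 0 <= DD p q c s' t' ->
  let X := mm p q c s t / Num.sqrt (zz p s') in
  let Y := mm q p c t s / Num.sqrt (zz q t') in
  [/\ -1 <= X <= 1, -1 <= Y <= 1, 0 <= X + Y,
     ang p q c s' t' <= asin X + asin Y &
     ang p q c s' t' = asin X + asin Y -> s' = s -> t' = t].
Proof.
move=> p0 q0 c0 G0 s0 t0 ss tt D D' X Y.
have [Q0 hcc ej ejk eQ] := calib_facts G0 D.
have D2 : 0 <= DD q p c t s by rewrite DDC.
have G2 : GG q p c < 0 by rewrite GGC.
have [_ _ ek _ _] := calib_facts G2 D2.
rewrite GGC QQC in ek.
have nj := @mm_neg _ _ _ _ _ _ p0 q0 c0 G0 s0 t0 D.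
have nk := @mm_neg _ _ _ _ _ _ q0 p0 c0 G2 t0 s0 D2.
set Q := Num.sqrt _ in Q0 eQ; set cc := - GG p q c / _ in hcc ej ejk ek.
set mj := mm p q c s t in ej ejk eQ nj X *.
set mk := mm q p c t s in ek ejk eQ nk Y *.
have ccQ : cc * Q ^+ 2 = - GG p q c.
  have QQ0 := QQ_gt0 G0 D.
  by rewrite /Q sqr_sqrtr ?ltW // /cc divfK // lt0r_neq0.
have D'2 : cc * Q ^+ 2 <= (1 - q ^+ 2) * (s' + p) ^+ 2
    + 2 * (c + p * q) * (s' + p) * (t' + q) + (1 - p ^+ 2) * (t' + q) ^+ 2.
  by move: D'; rewrite ccQ DD_QQ /QQ; lra.
clearbody Q cc mj mk.
have fj0 : 0 < s + p by lra.
have fk0 : 0 < t + q by lra.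
have fx : s + p <= s' + p by lra.
have fy : t + q <= t' + q by lra.
have zj0 : 0 < zz p s' by apply: zz_gt0; lra.
have zk0 : 0 < zz q t' by apply: zz_gt0; lra.
have rj0 : 0 < Num.sqrt (zz p s') by rewrite sqrtr_gt0.
have rk0 : 0 < Num.sqrt (zz q t') by rewrite sqrtr_gt0.
have rj2 : Num.sqrt (zz p s') ^+ 2 = zz p s' by rewrite sqr_sqrtr // ltW.
have rk2 : Num.sqrt (zz q t') ^+ 2 = zz q t' by rewrite sqr_sqrtr // ltW.
have bound (f z a m : R) : 0 < f -> f <= z -> m ^+ 2 = a + cc * f ^+ 2 ->
    m ^+ 2 <= z ^+ 2 + a.
  move=> f0 fz ->; rewrite addrC lerD2r.
  have h1 : f ^+ 2 <= z ^+ 2 by rewrite ler_pXn2r ?nnegrE //; lra.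
  have h2 : cc * f ^+ 2 <= f ^+ 2 by rewrite ger_pMl ?exprn_gt0 //; lra.
  by lra.
have bj : mj ^+ 2 <= zz p s' by rewrite zzE; apply: bound ej.
have bk : mk ^+ 2 <= zz q t' by rewrite zzE; apply: bound ek.
have hX : -1 <= X <= 1.
  by apply: sqr_le1; rewrite expr_div_n rj2 ler_pdivrMr // mul1r.
have hY : -1 <= Y <= 1.
  by apply: sqr_le1; rewrite expr_div_n rk2 ler_pdivrMr // mul1r.
(* Either both sines are nonnegative, or one is negative and [calib_sign] applies, with the two
   sides exchanged if necessary. *)
have XY : 0 <= X + Y.
  have key (m m' r r' : R) : 0 < r -> 0 < r' -> 0 < m' ->
      (- m) ^+ 2 * r' ^+ 2 <= m' ^+ 2 * r ^+ 2 -> 0 <= m / r + m' / r'.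
    move=> r0 r'0 m'0 h.
    have h1 : - m * r' <= m' * r.
      have [m0|m0] := leP 0 m.
        apply: le_trans (_ : 0 <= _); last by rewrite mulr_ge0 // ltW.
        by rewrite mulNr oppr_le0 mulr_ge0 // ltW.
      rewrite -(ler_pXn2r (ltn0Sn 1)) ?nnegrE ?exprMn //.
        by rewrite mulr_ge0 ?oppr_ge0 // ltW.
      by rewrite mulr_ge0 // ltW.
    rewrite addf_div ?lt0r_neq0 //; apply: divr_ge0; first by lra.
    by rewrite mulr_ge0 // ltW.
  have [mj0|mj0] := ltP mj 0.
    have [mk0 h] := @calib_sign _ _ _ _ _ _ _ _ _ _ _ _ fj0 fk0 fx fy Q0 hcc
      ej ek ejk eQ D'2 mj0 (nj mj0).
    by apply: key => //; rewrite rj2 rk2 !zzE.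
  have [mk0|mk0] := ltP mk 0.
    have [|||mj0' h] := @calib_sign _ _ _ (c + p * q) _ _ _ _ mk mj cc Q fk0 fj0
        fy fx Q0 hcc ek ej _ _ _ mk0 (nk mk0).
    - by rewrite mulrC ejk; ring.
    - by rewrite addrC.
    - by apply: le_trans D'2 _; lra.
    by rewrite addrC; apply: key => //; rewrite rj2 rk2 !zzE.
  by rewrite addr_ge0 // divr_ge0 // ltW.
have [cauchy cauchyE] := calib_cauchy fj0 fk0 fx fy hcc.
set Hj := Num.sqrt _ in cauchy cauchyE; set Hk := Num.sqrt _ in cauchy cauchyE.
have sX : Num.sqrt (1 - X ^+ 2) = Hj / Num.sqrt (zz p s').
  rewrite /Hj -sqrtrV ?ltW // -sqrtrM; last first.
    by move: bj; rewrite ej zzE; lra.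
  congr Num.sqrt; rewrite expr_div_n rj2 ej zzE; field.
  by move: (lt0r_neq0 zj0); rewrite zzE.
have sY : Num.sqrt (1 - Y ^+ 2) = Hk / Num.sqrt (zz q t').
  rewrite /Hk -sqrtrV ?ltW // -sqrtrM; last first.
    by move: bk; rewrite ek zzE; lra.
  congr Num.sqrt; rewrite expr_div_n rk2 ek zzE; field.
  by move: (lt0r_neq0 zk0); rewrite zzE.
have e1 := cos_asinD hX hY.
have e2 : Num.sqrt (1 - X ^+ 2) * Num.sqrt (1 - Y ^+ 2) - X * Y =
    (Hj * Hk - mj * mk) / (Num.sqrt (zz p s') * Num.sqrt (zz q t')).
  by rewrite sX sY /X /Y !mulf_div -mulrBl.
(* By [ejk], the cosine numerator [NN] exceeds that of the bound by [(s' + p) * (t' + q) - cc * (s +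
   p) * (t + q) - Hj * Hk], so the comparison is exactly [calib_cauchy]. *)
have e3 : NN p q c s' t' = (s' + p) * (t' + q) - (c + p * q).
  by rewrite /NN; ring.
have rr0 : 0 < Num.sqrt (zz p s') * Num.sqrt (zz q t') by rewrite mulr_gt0.
have b1 := DD_cos_bound zj0 zk0 D'.
have e4 := acos_asinD hX hY XY (erefl _).
rewrite e2 in e4.
have b2 : -1 <= (Hj * Hk - mj * mk) /
    (Num.sqrt (zz p s') * Num.sqrt (zz q t')) <= 1.
  by rewrite -e2 -e1 cos_geN1 cos_le1.
split=> //.
  rewrite -e4; apply: acos_le => //.
  by rewrite ler_pM2r ?invr_gt0 // e3 ejk; lra.
rewrite -e4 => e ss'.
have : NN p q c s' t' / (Num.sqrt (zz p s') * Num.sqrt (zz q t')) =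
    (Hj * Hk - mj * mk) / (Num.sqrt (zz p s') * Num.sqrt (zz q t')).
  by move: e => /(congr1 cos); rewrite !acosK ?in_itv.
move/(mulIf (lt0r_neq0 (_ : 0 < _^-1))); rewrite invr_gt0 e3 ejk => /(_ rr0) e'.
have : t' + q = t + q by apply: cauchyE; [lra|rewrite ss'].
by lra.
Qed.

End FaceCalibration.

(** * Rigidity of stars *)

Section Star.
Variable R : realType.
Implicit Types p s : nat -> R.

Lemma sum_le_eq n (F G : 'I_n -> R) : (forall i, F i <= G i) ->
  \sum_i F i = \sum_i G i -> forall i, F i = G i.
Proof.
move=> FG e i; have : \sum_i (G i - F i) = 0 by rewrite sumrB e subrr.
move/psumr_eq0P => h; apply/esym/eqP; rewrite -subr_eq0; apply/eqP/h => // j _.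
by rewrite subr_ge0.
Qed.

Lemma sum6_shift (F : nat -> R) : F 6 = F 0 ->
  \sum_(t < 6) F t.+1 = \sum_(t < 6) F t.
Proof.
by move=> e; rewrite big_ord_recr [RHS]big_ord_recl /= e addrC; congr (_ + _).
Qed.

Definition weights_small p := forall t,
  small_weights (p t) (p t.+1) (p t.+2) /\ ~ (p t = 1 /\ p t.+1 = - p t.+2).
Definition weights_large p := forall t,
  0 <= p t /\ GG (p t) (p t.+1) (p t.+2) < 0.
(** The rim of the face between the spokes [t] and [t + 1] is parallel to direction [t + 2], whence
    the weight [p t.+2]. *)
Definition star_angle p s t := ang (p t) (p t.+1) (p t.+2) (s t) (s t.+1).
Definition star_nonneg p s := forall t,
  0 <= DD (p t) (p t.+1) (p t.+2) (s t) (s t.+1).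
(** The second face at spoke [t] contains spoke [t + 5], that is [t - 1] modulo 6, of weight
    [p t.+2]; its rim has weight [p t.+1]. *)
Definition star_delaunay p s := forall t,
  0 <= mm (p t) (p t.+1) (p t.+2) (s t) (s t.+1)
       + mm (p t) (p t.+2) (p t.+1) (s t) (s (t + 5)%N).

Section Rigidity.
Variables p s s' : nat -> R.
Hypotheses (p3 : forall t, p t.+3 = p t) (s6 : forall t, s (t + 6)%N = s t)
  (s'6 : forall t, s' (t + 6)%N = s' t).
Hypotheses (s0 : forall t, 0 < s t) (ss : forall t, s t <= s' t).

Lemma star_rigid_small : weights_small p ->
  \sum_(t < 6) star_angle p s t = \sum_(t < 6) star_angle p s' t ->
  forall t, (t < 6)%N -> s t = s' t.
Proof.
move=> wp e.
have s'0 t : 0 < s' t by apply: lt_le_trans (s0 t) (ss t).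
have le1 t : star_angle p s' t <= star_angle p s t /\
    (star_angle p s' t = star_angle p s t -> s' t = s t).
  have [sw reg] := wp t; have [sw1 reg1] := wp t.+1.
  rewrite /star_angle; have [-> | ne] := eqVneq (s' t) (s t); last first.
    have lt : s t < s' t by rewrite lt_neqAle eq_sym ne ss.
    have h := ang_lt sw reg (s0 t) (s0 t.+1) lt.
    have h2 : ang (p t) (p t.+1) (p t.+2) (s' t) (s' t.+1) <=
        ang (p t) (p t.+1) (p t.+2) (s' t) (s t.+1).
      have [->|ne1] := eqVneq (s' t.+1) (s t.+1); first exact: lexx.
      have lt1 : s t.+1 < s' t.+1 by rewrite lt_neqAle eq_sym ne1 ss.
      rewrite ltW // -(angC (p t)) -[ltRHS](angC (p t)).
      apply: ang_lt => //; last first.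
        by case=> a b; apply: reg1; rewrite p3; split=> //; lra.
      have [h1 h2' h3 [h4 h5 h6]] := sw; split=> //.
      by split=> //; move: h6; rewrite [p t.+1 * p t]mulrC.
    by split=> [|h3]; lra.
  split=> //.
  have [->|ne1] := eqVneq (s' t.+1) (s t.+1); first exact: lexx.
  have lt1 : s t.+1 < s' t.+1 by rewrite lt_neqAle eq_sym ne1 ss.
  rewrite ltW // -(angC (p t)) -[ltRHS](angC (p t)).
  apply: ang_lt => //; last first.
    by case=> a b; apply: reg1; rewrite p3; split=> //; lra.
  have [h1 h2' h3 [h4 h5 h6]] := sw; split=> //.
  by split=> //; move: h6; rewrite [p t.+1 * p t]mulrC.
move=> t t6; apply/esym; apply: (le1 t).2.
apply: (sum_le_eq (F := fun i : 'I_6 => star_angle p s' i)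
  (G := fun i : 'I_6 => star_angle p s i) _ _ (Ordinal t6)) => // i.
exact: (le1 i).1.
Qed.

(* Compares the angles at the center through the bounds of ang_calib; the two
   bounds belonging to a spoke decrease together as the spoke grows, by the
   Delaunay condition. *)
Lemma star_rigid_large : weights_large p -> star_nonneg p s -> star_nonneg p s' ->
  star_delaunay p s -> \sum_(t < 6) star_angle p s t != 0 ->
  \sum_(t < 6) star_angle p s t = \sum_(t < 6) star_angle p s' t ->
  forall t, (t < 6)%N -> s t = s' t.
Proof.
move=> wp D D' del n0 e.
have s'0 t : 0 < s' t by apply: lt_le_trans (s0 t) (ss t).
pose r (a : nat -> R) t := Num.sqrt (zz (p t) (a t)).
have p0 t : 0 <= p t by have [] := wp t.
have pN1 t : -1 < p t by have := p0 t; lra.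
have r0 a t : (forall t, 0 < a t) -> 0 < r a t.
  by move=> a0; rewrite sqrtr_gt0; apply: zz_gt0.
pose m t := mm (p t) (p t.+1) (p t.+2) (s t) (s t.+1).
pose m' t := mm (p t) (p t.+2) (p t.+1) (s t) (s (t + 5)%N).
have m'E t : m' t.+1 = mm (p t.+1) (p t) (p t.+2) (s t.+1) (s t).
  by rewrite /m' p3 addSnnS s6.
pose X a t := m t / r a t; pose Y a t := m' t / r a t.
have cal a t : (forall t, s t <= a t) -> star_nonneg p a ->
    [/\ -1 <= X a t <= 1, -1 <= Y a t.+1 <= 1,
     star_angle p a t <= asin (X a t) + asin (Y a t.+1) &
     star_angle p a t = asin (X a t) + asin (Y a t.+1) ->
     a t = s t -> a t.+1 = s t.+1].
  move=> sa Da; rewrite /X /Y /r m'E.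
  have [h1 h2 _ h3 h4] := ang_calib (p0 t) (p0 t.+1) (p0 t.+2) (wp t).2
    (s0 t) (s0 t.+1) (sa t) (sa t.+1) (D t) (Da t).
  by split.
(* On the old star the bounds are exact: the geometric center splits each angle into these two
   parts. *)
have calE t : star_angle p s t = asin (X s t) + asin (Y s t.+1).
  have [Q0 hcc ej ejk eQ] := calib_facts (wp t).2 (D t).
  have D2 : 0 <= DD (p t.+1) (p t) (p t.+2) (s t.+1) (s t) by rewrite DDC.
  have G2 : GG (p t.+1) (p t) (p t.+2) < 0 by rewrite GGC; case: (wp t).
  have [_ _ ek _ _] := calib_facts G2 D2.
  have [h1 h2 h0 h3 _] := ang_calib (p0 t) (p0 t.+1) (p0 t.+2) (wp t).2
    (s0 t) (s0 t.+1) (lexx _) (lexx _) (D t) (D t).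
  rewrite /X /Y /r m'E; apply: acos_asinD => //.
  have Dr : 0 <= Num.sqrt (DD (p t) (p t.+1) (p t.+2) (s t) (s t.+1)).
    exact: sqrtr_ge0.
  set Q := Num.sqrt (QQ _ _ _ _ _) in Q0 eQ.
  have Q2 : Q ^+ 2 = QQ (p t) (p t.+1) (p t.+2) (s t) (s t.+1).
    by rewrite sqr_sqrtr // ltW // -sqrtr_gt0.
  have e1 (f z mt : R) : 0 < f -> 0 < z -> mt ^+ 2 = z
      - f ^+ 2 * DD (p t) (p t.+1) (p t.+2) (s t) (s t.+1) / Q ^+ 2 ->
    Num.sqrt (1 - (mt / Num.sqrt z) ^+ 2) =
    f * Num.sqrt (DD (p t) (p t.+1) (p t.+2) (s t) (s t.+1)) / Q / Num.sqrt z.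
    move=> f0 z0 emt.
    have rz0 : 0 < Num.sqrt z by rewrite sqrtr_gt0.
    have -> : 1 - (mt / Num.sqrt z) ^+ 2 = (f * Num.sqrt
        (DD (p t) (p t.+1) (p t.+2) (s t) (s t.+1)) / Q / Num.sqrt z) ^+ 2.
      rewrite expr_div_n emt !exprMn !exprVn (sqr_sqrtr (D t)) (sqr_sqrtr (ltW z0)).
      by field; rewrite (lt0r_neq0 z0) lt0r_neq0.
    by rewrite sqrtr_sqr ger0_norm // !mulr_ge0 ?invr_ge0 // ltW.
  have DDQ : DD (p t) (p t.+1) (p t.+2) (s t) (s t.+1) / Q ^+ 2 =
      1 + GG (p t) (p t.+1) (p t.+2) / QQ (p t) (p t.+1) (p t.+2) (s t) (s t.+1).
    by rewrite Q2 DD_QQ mulrDl divff // lt0r_neq0 // -sqrtr_gt0.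
  have f1 : 0 < s t + p t by rewrite ltr_pwDl.
  have f2 : 0 < s t.+1 + p t.+1 by rewrite ltr_pwDl.
  rewrite (e1 _ _ _ f1 (zz_gt0 (pN1 t) (s0 t))); last first.
    by rewrite ej -[X in _ = _ - X]mulrA DDQ zzE; lra.
  rewrite (e1 _ _ _ f2 (zz_gt0 (pN1 t.+1) (s0 t.+1))); last first.
    by rewrite ek -[X in _ = _ - X]mulrA DDQ zzE GGC QQC; lra.
  have -> : NN (p t) (p t.+1) (p t.+2) (s t) (s t.+1) =
    (s t + p t) * (s t.+1 + p t.+1) *
      (DD (p t) (p t.+1) (p t.+2) (s t) (s t.+1) / Q ^+ 2)
    - mm (p t) (p t.+1) (p t.+2) (s t) (s t.+1) *
      mm (p t.+1) (p t) (p t.+2) (s t.+1) (s t).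
    by rewrite ejk DDQ /NN; lra.
  rewrite -{1}(sqr_sqrtr (D t)); set d := Num.sqrt (DD _ _ _ _ _).
  set z1 := Num.sqrt (zz (p t) _); set z2 := Num.sqrt (zz (p t.+1) _).
  have z10 : z1 != 0 by rewrite lt0r_neq0 // (r0 s).
  have z20 : z2 != 0 by rewrite lt0r_neq0 // (r0 s).
  by rewrite /m; field; rewrite z10 z20 lt0r_neq0.
have scal t : asin (X s' t) + asin (Y s' t) <= asin (X s t) + asin (Y s t) /\
    (asin (X s' t) + asin (Y s' t) = asin (X s t) + asin (Y s t) ->
      s' t = s t \/ X s t + Y s t = 0).
  pose k := r s t / r s' t.
  have k0 : 0 < k by rewrite divr_gt0 // r0.
  have rr : r s t <= r s' t.
    by apply/ler_wsqrtr/zz_le => //; rewrite ltr_pwDl.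
  have k1 : k <= 1 by rewrite ler_pdivrMr ?mul1r ?r0.
  have eX : X s' t = k * X s t.
    by rewrite /X /k; field; rewrite !lt0r_neq0 ?r0.
  have eY : Y s' t = k * Y s t.
    by rewrite /Y /k; field; rewrite !lt0r_neq0 ?r0.
  have [hX _ _ _] := cal s t (fun _ => lexx _) D.
  have hY : -1 <= Y s t <= 1.
    have [_ h _ _] := cal s (t + 5)%N (fun _ => lexx _) D.
    have p6 i : p (i + 6)%N = p i by rewrite !addnS addn0 !p3.
    have e6 : Y s (t + 6)%N = Y s t.
      by rewrite /Y /r /m' -!addSn !p6 addnAC !s6.
    by move: h; rewrite -addnS e6.
  have XY : 0 <= X s t + Y s t.
    by rewrite /X /Y -mulrDl divr_ge0 ?del // ltW // r0.
  have [h1 h2] := asin_sum_scale hX hY XY k0 k1.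
  rewrite eX eY; split=> // /h2[k_1|]; [left|by right].
  have rE : r s' t ^+ 2 = r s t ^+ 2.
    by congr (_ ^+ 2); apply/(mulfI (lt0r_neq0 k0));
      rewrite {1}/k divfK ?lt0r_neq0 ?r0 // k_1 mul1r.
  move: rE; rewrite /r !sqr_sqrtr ?(ltW (zz_gt0 _ _)) // /zz => rE.
  have : (s' t - s t) * (s' t + s t + 2 * p t) = 0 by lra.
  move/eqP; rewrite mulf_eq0 subr_eq0 => /orP[/eqP //|/eqP].
  by have := s0 t; have := s'0 t; have := p0 t; lra.
have Y6 a : (forall t, a (t + 6)%N = a t) -> asin (Y a 6) = asin (Y a 0).
  move=> a6; rewrite /Y /r /m'.
  by have := a6 0; have := s6 0; have := s6 5; rewrite !add0n !p3 /= => -> -> ->.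
have sumE a : (forall t, a (t + 6)%N = a t) ->
    \sum_(t < 6) (asin (X a t) + asin (Y a t.+1)) =
    \sum_(t < 6) (asin (X a t) + asin (Y a t)).
  move=> a6; rewrite !big_split /=; congr (_ + _).
  exact: (sum6_shift (F := fun t => asin (Y a t)) (Y6 a a6)).
have c1 : \sum_(t < 6) star_angle p s' t <=
    \sum_(t < 6) (asin (X s' t) + asin (Y s' t.+1)).
  by apply: ler_sum => i _; have [] := cal s' i ss D'.
have c2 : \sum_(t < 6) (asin (X s' t) + asin (Y s' t)) <=
    \sum_(t < 6) (asin (X s t) + asin (Y s t)).
  by apply: ler_sum => i _; case: (scal i).
have c3 : \sum_(t < 6) star_angle p s t =
    \sum_(t < 6) (asin (X s t) + asin (Y s t)).
  by rewrite -sumE //; apply: eq_bigr => i _; apply: calE.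
have E1 t : (t < 6)%N -> star_angle p s' t = asin (X s' t) + asin (Y s' t.+1).
  move=> t6; apply: (sum_le_eq (F := fun i : 'I_6 => star_angle p s' i)
    (G := fun i : 'I_6 => asin (X s' i) + asin (Y s' i.+1)) _ _ (Ordinal t6)).
    by move=> i; have [] := cal s' i ss D'.
  by move: c1 c2 c3 e; rewrite sumE //; lra.
have E2 t : (t < 6)%N ->
    asin (X s' t) + asin (Y s' t) = asin (X s t) + asin (Y s t).
  move=> t6; apply: (sum_le_eq (F := fun i : 'I_6 => asin (X s' i) + asin (Y s' i))
    (G := fun i : 'I_6 => asin (X s i) + asin (Y s i)) _ _ (Ordinal t6)).
    by move=> i; case: (scal i).
  by move: c1 c2 c3 e; rewrite sumE //; lra.
(* If every ratio changed, equality in [scal] would give [X s i + Y s i = 0] on all spokes, and the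
   total angle would be 0. *)
have [t t6 et] : exists2 t, (t < 6)%N & s' t = s t.
  apply: contrapT => no; move/eqP: n0; apply; rewrite c3 big1 // => i _.
  have [|h] := (scal i).2 (E2 i (ltn_ord i)).
    by move=> h; case: no; exists i.
  have [hX _ _ _] := cal s i (fun _ => lexx _) D.
  have -> : Y s i = - X s i by lra.
  by rewrite asinN // subrr.
(* Equality in [ang_calib] passes an unchanged ratio on to the next spoke, hence all the way
   around. *)
have step i : (i < 6)%N -> s' i = s i -> s' i.+1 = s i.+1.
  by move=> i6 ei; have [_ _ _] := cal s' i ss D'; apply=> //; apply: E1.
have s0E : s' 0 = s 0.
  have -> : s' 0 = s' 6 by rewrite -(s'6 0).
  have -> : s 0 = s 6 by rewrite -(s6 0).
  suff h i : (t + i <= 6)%N -> s' (t + i)%N = s (t + i)%N.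
    by have := h (6 - t)%N; rewrite subnKC ?(ltnW t6) // => ->.
  elim: i => [|i IH]; first by rewrite addn0.
  by rewrite addnS => h; apply: step => //; apply: IH; apply: ltnW.
have all6 i : (i <= 6)%N -> s' i = s i.
  by elim: i => // i IH i6; apply: step => //; apply: IH; apply: ltnW.
by move=> i i6; rewrite all6 // ltnW.
Qed.

End Rigidity.
End Star.

(** * Labels on the hexagonal lattice *)

Section HexLattice.

Lemma hex_dir_mod t : hex_dir (t %% 6) = hex_dir t.
Proof. by rewrite /hex_dir modn_mod. Qed.

Lemma hex_dir6 t : hex_dir (t + 6) = hex_dir t.
Proof. by rewrite -hex_dir_mod modnDr hex_dir_mod. Qed.

Lemma hex_dir_modD t k : hex_dir (t + k) = hex_dir (t %% 6 + k).
Proof. by rewrite -hex_dir_mod -[RHS]hex_dir_mod modnDml. Qed.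

Lemma hex_dirS t : hex_dir t.+1 = hex_dir t + hex_dir t.+2.
Proof.
rewrite -(addn2 t) -(addn1 t) hex_dir_modD (hex_dir_modD t 2) -(hex_dir_mod t).
have := ltn_pmod t (isT : (0 < 6)%N).
by move: (t %% 6)%N => [|[|[|[|[|[|]]]]]].
Qed.

Lemma hex_dirN t : hex_dir t.+3 = - hex_dir t.
Proof.
rewrite -(addn3 t) hex_dir_modD -(hex_dir_mod t).
have := ltn_pmod t (isT : (0 < 6)%N).
by move: (t %% 6)%N => [|[|[|[|[|[|]]]]]].
Qed.

Lemma vertexE (m n : int) : (m, n) = (1, 0) *~ m + (0, 1) *~ n :> vertex.
Proof.
have fstM (x : vertex) k : (x *~ k).1 = x.1 *~ k by rewrite (raddfMz fst).
have sndM (x : vertex) k : (x *~ k).2 = x.2 *~ k by rewrite (raddfMz snd).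
apply/eqP; rewrite -pair_eqE /pair_eq /= !fstM !sndM /=.
by rewrite !mul0rz addr0 add0r !intz !eqxx.
Qed.

Lemma hex_ind (P : vertex -> Prop) :
  P 0 -> (forall v t, P v -> P (v + hex_dir t)) -> forall v, P v.
Proof.
move=> P0 PS [m n]; rewrite vertexE.
have step v t : P v -> forall k : int, P (v + hex_dir t *~ k).
  move=> Pv; elim=> [|k IH|k IH]; first by rewrite mulr0z addr0.
    by rewrite intS [1 + _]addrC mulrzDr mulr1z addrA; apply: PS.
  rewrite intS opprD [- 1 + _]addrC mulrzDr mulrN1z -hex_dirN addrA; exact: PS.
rewrite -[X in P (X + _)]add0r.
exact: (step _ 1%N (step _ 0%N P0 m) n).
Qed.

Lemma hex_period (T : Type) (f : vertex -> T) :
  (forall v, f (v + hex_dir 0) = f v) -> (forall v, f (v + hex_dir 1) = f v) ->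
  forall v, f v = f 0.
Proof.
move=> d0 d1.
have d2 y : f (y + hex_dir 2) = f y.
  by rewrite -(d0 (y + _)) -addrA [hex_dir 2 + _]addrC -hex_dirS d1.
have d3 j y : (j < 3)%N -> f (y + hex_dir j) = f y.
  by case: j => [|[|[|//]]] _; [exact: d0|exact: d1|exact: d2].
have period i x : f (x + hex_dir i) = f x.
  rewrite -hex_dir_mod; have := ltn_pmod i (isT : (0 < 6)%N).
  move: (i %% 6)%N => j j6; have [j3|j3] := ltnP j 3; first exact: d3.
  rewrite -(subnK j3) addn3 hex_dirN -[in RHS](subrK (hex_dir (j - 3)) x).
  by rewrite d3 //; lia.
by elim/hex_ind => // v t <-.
Qed.

End HexLattice.

Lemma seq_argmin (T : eqType) d (O : orderType d) (f : T -> O) (S : seq T) x :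
  x \in S -> exists2 y, y \in S & forall z, z \in S -> (f y <= f z)%O.
Proof.
elim: S x => // a S IH x _.
have [->|[b bS]] : S = [::] \/ exists b, b \in S.
    by case: (S) => [|b S']; [left|right; exists b; rewrite mem_head].
  by exists a; rewrite ?mem_head // => z; rewrite inE => /eqP ->.
have [y yS hy] := IH _ bS; have [ay|ya] := leP (f a) (f y).
  exists a; rewrite ?mem_head // => z; rewrite inE => /predU1P[-> //|/hy].
  exact: le_trans.
exists y; rewrite ?inE ?yS ?orbT // => z; rewrite inE => /predU1P[->|/hy //].
exact: ltW.
Qed.

Section Labels.
Variables (R : realType) (p : nat -> R).
Hypothesis p3 : forall t, p t.+3 = p t.
Hypothesis wp : weights_small p \/ weights_large p.
Implicit Types (u : vertex -> R) (v : vertex).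

Definition rratio u v (t : nat) : R := expR (u v - u (v + hex_dir t)).

(** Only ratios of radii occur, so shifts and translations of the label preserve all clauses; each
    clause also passes to pointwise limits ([flat_label_lim]). *)
Definition flat_label u : Prop :=
  [/\ forall v, star_nonneg p (rratio u v),
      forall v, \sum_(t < 6) star_angle p (rratio u v) t = 2 * pi &
      weights_large p -> forall v, star_delaunay p (rratio u v)].

Lemma flat_label_rigid u u' v : flat_label u -> flat_label u' ->
  u' v = u v -> (forall t, u' (v + hex_dir t) <= u (v + hex_dir t)) ->
  forall t, u' (v + hex_dir t) = u (v + hex_dir t).
Proof.
move=> [D F del] [D' F' _] ev le t.
suff: rratio u v (t %% 6) = rratio u' v (t %% 6).
  by rewrite /rratio ev => /expR_inj /addrI /oppr_inj; rewrite hex_dir_mod.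
have t6 : (t %% 6 < 6)%N by rewrite ltn_pmod.
have r6 (a : vertex -> R) i : rratio a v (i + 6) = rratio a v i.
  by rewrite /rratio hex_dir6.
have r0 i : 0 < rratio u v i by apply: expR_gt0.
have rr i : rratio u v i <= rratio u' v i.
  by rewrite ler_expR ev lerD2l lerN2.
have n0 : \sum_(t < 6) star_angle p (rratio u v) t != 0.
  by rewrite F mulf_neq0 // lt0r_neq0 // pi_gt0.
have e : \sum_(t < 6) star_angle p (rratio u v) t =
    \sum_(t < 6) star_angle p (rratio u' v) t by rewrite F F'.
case: (wp) => [w|w]; first exact: star_rigid_small.
by apply: star_rigid_large => //; exact: del.
Qed.

Section Constant.
Hypothesis pN1 : forall t, -1 < p t.
(** A face with equal radii has no obtuse angle. Equivalently [hnum] at ratios 1 is nonnegative,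
    being the product of [1 + p t] and [1 + p t.+1 + p t.+2 - p t]. *)
Hypothesis acute : forall t, p t <= 1 + p t.+1 + p t.+2.

(** All faces are congruent, and the star shows each angle of the triangle twice. *)
Lemma flat_label_const (a : R) : flat_label (fun _ => a).
Proof.
have r1 v t : rratio (fun=> a) v t = 1 by rewrite /rratio subrr expR0.
have z1 (q : R) : zz q 1 = 2 * (1 + q) by rewrite /zz; ring.
have q0 t : 0 < 1 + p t by have := pN1 t; lra.
have DD1 t : 0 <= DD (p t) (p t.+1) (p t.+2) 1 1.
  have h0 := acute t; have h1 := acute t.+1; have h2 := acute t.+2.
  rewrite !p3 in h1 h2.
  have -> : DD (p t) (p t.+1) (p t.+2) 1 1 =
    (1 + p t.+1 + p t.+2 - p t) * (1 + p t.+2 + p t - p t.+1) +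
    (1 + p t.+2 + p t - p t.+1) * (1 + p t + p t.+1 - p t.+2) +
    (1 + p t + p t.+1 - p t.+2) * (1 + p t.+1 + p t.+2 - p t).
    by rewrite /DD /zz /NN; ring.
  by rewrite !addr_ge0 // mulr_ge0 ?subr_ge0.
split.
- by move=> v t; rewrite !r1.
- move=> v.
  pose A t := ang (p t) (p t.+1) (p t.+2) 1 1.
  have -> : \sum_(t < 6) star_angle p (rratio (fun=> a) v) t = \sum_(t < 6) A t.
    by apply: eq_bigr => t _; rewrite /star_angle !r1.
  have A3 t : A t.+3 = A t by rewrite /A !p3.
  rewrite !big_ord_recr big_ord0 /= !A3 add0r.
  suff h : A 0 + A 1%N + A 2%N = pi by rewrite -addrA -addrA [_ + (_ + _)]addrA h; lra.
  rewrite /A /ang !p3 !z1 /NN !mul1r.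
  have [[h0 h1] h2] := (q0 0, q0 1%N, q0 2%N).
  have [[a0 a1] a2] := (acute 0, acute 1%N, acute 2%N).
  rewrite !p3 in a1 a2.
  set x := Num.sqrt (2 * (1 + p 0)); set y := Num.sqrt (2 * (1 + p 1%N)).
  set z := Num.sqrt (2 * (1 + p 2%N)).
  have [x0 y0 z0] : [/\ 0 < x, 0 < y & 0 < z].
    by split; rewrite sqrtr_gt0 mulr_gt0.
  have x2 : x ^+ 2 = 2 * (1 + p 0) by rewrite sqr_sqrtr // mulr_ge0 // ltW.
  have y2 : y ^+ 2 = 2 * (1 + p 1%N) by rewrite sqr_sqrtr // mulr_ge0 // ltW.
  have z2 : z ^+ 2 = 2 * (1 + p 2%N) by rewrite sqr_sqrtr // mulr_ge0 // ltW.
  have p0E : p 0 = x ^+ 2 / 2 - 1 by rewrite x2; field.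
  have p1E : p 1%N = y ^+ 2 / 2 - 1 by rewrite y2; field.
  have p2E : p 2%N = z ^+ 2 / 2 - 1 by rewrite z2; field.
  have b t : -1 <= NN (p t) (p t.+1) (p t.+2) 1 1 /
      (Num.sqrt (zz (p t) 1) * Num.sqrt (zz (p t.+1) 1)) <= 1.
    by apply: DD_cos_bound; rewrite ?zz_gt0.
  have [[b0 b1] b2] := (b 0, b 1%N, b 2%N); move: b0 b1 b2.
  rewrite !p3 !z1 /NN !mul1r -/x -/y -/z => /andP[_ b0] /andP[_ b1] /andP[_ b2].
  apply: acos_sum; rewrite ?b0 ?b1 ?b2 ?andbT.
  + by rewrite divr_ge0 // ?mulr_ge0 ?(ltW x0) ?(ltW y0) //; lra.
  + by rewrite divr_ge0 // ?mulr_ge0 ?(ltW y0) ?(ltW z0) //; lra.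
  + by rewrite divr_ge0 // ?mulr_ge0 ?(ltW z0) ?(ltW x0) //; lra.
  rewrite p0E p1E p2E; field.
  by rewrite !lt0r_neq0.
move=> wl v t; rewrite !r1.
have h (q q' q'' : R) : 0 < 1 + q -> q <= 1 + q' + q'' -> 0 <= mm q q' q'' 1 1.
  move=> h0 h1; rewrite /mm divr_ge0 ?sqrtr_ge0 //.
  have -> : hnum q q' q'' 1 1 = (1 + q) * (1 + q' + q'' - q).
    by rewrite /hnum; ring.
  by rewrite mulr_ge0 ?subr_ge0 // ltW.
by rewrite addr_ge0 // h //; have := acute t; lra.
Qed.

(** At a minimizer in [S] with largest first coordinate, comparison with a constant label makes all
    neighbours minimizers; the one in direction [(1, 0)] contradicts the choice. *)
Lemma no_strict_min u (S : seq vertex) x : flat_label u -> x \in S ->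
  ~ (forall v t, v \in S -> v + hex_dir t \notin S -> u v < u (v + hex_dir t)).
Proof.
move=> fu xS out.
have [y yS hy] := seq_argmin u xS.
pose S' := [seq z <- S | u z == u y].
have yS' : y \in S' by rewrite mem_filter eqxx.
have [z zS' hz] := seq_argmin (fun z : vertex => - z.1) yS'.
move: zS'; rewrite mem_filter => /andP[/eqP uz zS].
have le t : u z <= u (z + hex_dir t).
  have [h|h] := boolP (z + hex_dir t \in S); first by rewrite uz hy.
  exact/ltW/out.
have e t : u z = u (z + hex_dir t).
  exact: (@flat_label_rigid u (fun=> u z) z fu (flat_label_const _) erefl le t).
have [h|h] := boolP (z + hex_dir 0 \in S); last by have := out _ _ zS h; rewrite -e ltxx.
have := hz (z + hex_dir 0); rewrite mem_filter h -e uz eqxx => /(_ isT).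
by rewrite lerN2 /= gerDl.
Qed.

Lemma no_strict_max u (S : seq vertex) x : flat_label u -> x \in S ->
  ~ (forall v t, v \in S -> v + hex_dir t \notin S -> u (v + hex_dir t) < u v).
Proof.
move=> fu xS out.
have [y yS hy] := seq_argmin (fun v => - u v) xS.
pose S' := [seq z <- S | u z == u y].
have yS' : y \in S' by rewrite mem_filter eqxx.
have [z zS' hz] := seq_argmin (fun z : vertex => - z.1) yS'.
move: zS'; rewrite mem_filter => /andP[/eqP uz zS].
have le t : u (z + hex_dir t) <= u z.
  have [h|h] := boolP (z + hex_dir t \in S); first by rewrite uz -lerN2 hy.
  exact/ltW/out.
have e t : u (z + hex_dir t) = u z.
  exact: (@flat_label_rigid (fun=> u z) u z (flat_label_const _) fu erefl le t).
have [h|h] := boolP (z + hex_dir 0 \in S); last by have := out _ _ zS h; rewrite e ltxx.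
have := hz (z + hex_dir 0); rewrite mem_filter h e uz eqxx => /(_ isT).
by rewrite lerN2 /= gerDl.
Qed.

End Constant.
End Labels.

(** * Plane geometry *)

Section PlaneGeometry.
Variable R : realType.
Local Notation plane := (R * R)%type.
Implicit Types b x y z P Q S l m t s : plane.

Definition det2 x y : R := x.1 * y.2 - x.2 * y.1.

Definition seg P Q z : Prop := exists a : R, 0 <= a <= 1 /\
  z = ((1 - a) * P.1 + a * Q.1, (1 - a) * P.2 + a * Q.2).

Definition hull3 P Q S z : Prop := exists a b c : R,
  [/\ 0 <= a, 0 <= b, 0 <= c, a + b + c = 1 &
      z = (a * P.1 + b * Q.1 + c * S.1, a * P.2 + b * Q.2 + c * S.2)].

Lemma seg_hull3 P Q S z : seg Q S z -> hull3 P Q S z.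
Proof.
case=> a [ha ->]; exists 0, (1 - a), a.
by split; [lra|lra|lra|ring|rewrite !mul0r !add0r].
Qed.

Lemma seg_hull_seg P Q S z y : seg Q S z -> seg P z y -> hull3 P Q S y.
Proof.
case=> a [ha ->] [c [hc ->]]; exists (1 - c), (c * (1 - a)), (c * a).
split=> /=; [lra|nra|nra|ring|by congr pair; ring].
Qed.

Lemma seg_sym P Q z : seg P Q z -> seg Q P z.
Proof.
by case=> a [ha ->]; exists (1 - a); split; [lra|congr pair; ring].
Qed.

Lemma hull3_inside P Q S z : 0 < det2 (P - z) (Q - z) ->
  0 < det2 (Q - z) (S - z) -> 0 < det2 (S - z) (P - z) -> hull3 P Q S z.
Proof.
set c := det2 (P - z) _; set a := det2 (Q - z) _; set d := det2 (S - z) _.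
move=> c0 a0 d0; have s0 : 0 < a + d + c by lra.
have n0 := lt0r_neq0 s0.
exists (a / (a + d + c)), (d / (a + d + c)), (c / (a + d + c)).
have ge (r : R) : 0 < r -> 0 <= r / (a + d + c).
  by move=> r0; rewrite divr_ge0 ?(ltW r0) ?(ltW s0).
split; [exact: ge|exact: ge|exact: ge|by field|].
have e1 : a * P.1 + d * Q.1 + c * S.1 = (a + d + c) * z.1.
  by rewrite /a /d /c /det2 /=; ring.
have e2 : a * P.2 + d * Q.2 + c * S.2 = (a + d + c) * z.2.
  by rewrite /a /d /c /det2 /=; ring.
rewrite [LHS]surjective_pairing; congr pair; apply: (mulfI n0).
  by rewrite -e1; field.
by rewrite -e2; field.
Qed.

(* The ray from x in direction b meets the segment from l to m in its
   relative interior. *)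
Definition in_cone b l m x : Prop := 0 < det2 (l - x) b /\ 0 < det2 b (m - x).

Definition height b l m x : R := det2 (l - x) (m - x) / det2 b (m - l).

Lemma in_cone_gt0 b l m x : in_cone b l m x -> 0 < det2 b (m - l).
Proof.
case=> h1 h2; have -> : det2 b (m - l) = det2 (l - x) b + det2 b (m - x).
  by rewrite /det2 /=; ring.
exact: addr_gt0.
Qed.

Lemma height_seg b l m x : in_cone b l m x ->
  seg l m (x.1 + height b l m x * b.1, x.2 + height b l m x * b.2).
Proof.
move=> c; have D0 := in_cone_gt0 c; case: c => h1 h2.
exists (det2 (l - x) b / det2 b (m - l)); split.
  rewrite divr_ge0 ?(ltW h1) ?(ltW D0) //= ler_pdivrMr // mul1r.
  by move: h1 h2; rewrite /det2 /=; lra.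
have n0 := lt0r_neq0 D0; move: n0; rewrite /height /det2 /= => n0.
by congr pair; field.
Qed.

Lemma in_cone_seg b l m x y z :
  in_cone b l m x -> in_cone b l m y -> seg x y z -> in_cone b l m z.
Proof.
move=> [h1 h2] [h3 h4] [a [/andP[a0 a1] ->]].
have conv (u v : R) : 0 < u -> 0 < v -> 0 < (1 - a) * u + a * v.
  move=> u0 v0; have [a0'|a0'] := ltP 0 a; last first.
    by have -> : a = 0 by [lra]; rewrite mul0r subr0 mul1r addr0.
  by rewrite ltr_wpDl // ?mulr_gt0 // mulr_ge0 ?subr_ge0 // ltW.
split.
- apply: lt_le_trans (conv _ _ h1 h3) _; rewrite le_eqVlt; apply/orP; left.
  by apply/eqP; rewrite /det2 /=; ring.
- apply: lt_le_trans (conv _ _ h2 h4) _; rewrite le_eqVlt; apply/orP; left.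
  by apply/eqP; rewrite /det2 /=; ring.
Qed.

Lemma height_aff b l m x y (a : R) :
  height b l m ((1 - a) * x.1 + a * y.1, (1 - a) * x.2 + a * y.2) =
  (1 - a) * height b l m x + a * height b l m y.
Proof. by rewrite /height /det2 /=; ring. Qed.

Lemma height_gt0 b l m x : in_cone b l m x ->
  (0 < height b l m x) = (0 < det2 (l - x) (m - x)).
Proof.
move=> /in_cone_gt0 D0; rewrite /height pmulr_lgt0 // invr_gt0 //.
Qed.

Lemma crossing (f0 f1 : R) : 0 < f0 -> f1 <= 0 ->
  exists2 a : R, 0 <= a <= 1 & (1 - a) * f0 + a * f1 = 0.
Proof.
move=> h0 h1; have n0 : 0 < f0 - f1 by lra.
exists (f0 / (f0 - f1)).
  by rewrite divr_ge0 ?(ltW n0) ?(ltW h0) //= ler_pdivrMr // mul1r; lra.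
by field; rewrite lt0r_neq0.
Qed.

(** The height below the segment from [l] to [m] is affine along the segment from [x] to [y]; a zero
    of it would be a common point. *)
Lemma no_crossing b l m x y : in_cone b l m x -> in_cone b l m y ->
  (forall z, seg x y z -> ~ seg l m z) ->
  0 < det2 (l - x) (m - x) -> 0 < det2 (l - y) (m - y).
Proof.
move=> cx cy disj; rewrite -(height_gt0 cx) -(height_gt0 cy) => hx.
rewrite ltNge; apply/negP => hy.
have [a ha e] := crossing hx hy; rewrite -height_aff in e.
set z := (_, _) in e.
have sz : seg x y z by exists a.
apply: (disj z) => //.
have := height_seg (in_cone_seg cx cy sz); rewrite e !mul0r !addr0.
by case: (z).
Qed.

(** Compare the heights [F] and [G] under the two far sides. If [F <= G] at [s] or [G <= F] at [t],
    the ray from that apex in direction [b] meets the nearer far side inside the other triangle.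
    Otherwise [F - G] changes sign between [s] and [t], and the far sides cross. *)
Lemma triangles_meet b l m l' m' t s :
  in_cone b l m t -> in_cone b l m s -> in_cone b l' m' t -> in_cone b l' m' s ->
  0 < det2 (l - t) (m - t) -> 0 < det2 (l - s) (m - s) ->
  0 < det2 (l' - t) (m' - t) -> 0 < det2 (l' - s) (m' - s) ->
  exists z, hull3 t l m z /\ hull3 s l' m' z.
Proof.
move=> ct cs ct' cs'.
rewrite -(height_gt0 ct) -(height_gt0 cs) -(height_gt0 ct') -(height_gt0 cs').
set F := height b l m; set G := height b l' m' => Ft Fs Gt Gs.
have below x (f g : R) : 0 < g -> 0 <= f -> f <= g ->
    seg x (x.1 + g * b.1, x.2 + g * b.2) (x.1 + f * b.1, x.2 + f * b.2).
  move=> g0 f0 fg; exists (f / g); split.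
    by rewrite divr_ge0 ?(ltW g0) //= ler_pdivrMr // mul1r.
  by congr pair => /=; field; rewrite lt0r_neq0.
have [h|h] := leP (F s) (G s).
  exists (s.1 + F s * b.1, s.2 + F s * b.2); split.
    exact/seg_hull3/height_seg.
  exact: seg_hull_seg (height_seg cs') (below _ _ _ Gs (ltW Fs) h).
have [h'|h'] := leP (G t) (F t).
  exists (t.1 + G t * b.1, t.2 + G t * b.2); split.
    exact: seg_hull_seg (height_seg ct) (below _ _ _ Ft (ltW Gt) h').
  exact/seg_hull3/height_seg.
have [||a ha e] := @crossing (F s - G s) (F t - G t); [lra|lra|].
pose z := ((1 - a) * s.1 + a * t.1, (1 - a) * s.2 + a * t.2).
have sz : seg s t z by exists a.
have FG : F z = G z by rewrite /F /G /z !height_aff -/F -/G; lra.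
exists (z.1 + F z * b.1, z.2 + F z * b.2); split.
  exact/seg_hull3/height_seg/(in_cone_seg cs ct sz).
rewrite FG; exact/seg_hull3/height_seg/(in_cone_seg cs' ct' sz).
Qed.

End PlaneGeometry.

(** * Pigeonhole principles and boxes *)

Section Pigeonhole.
Variable R : realType.

Lemma pigeonhole_box (d : nat) (C eps : R) : 0 < eps -> exists N : nat,
  forall c : 'I_N -> 'I_d -> R, (forall i j, `|c i j| <= C) ->
  exists i k, i != k /\ forall j, `|c i j - c k j| < eps.
Proof.
move=> e0; pose cell (x : R) := Num.truncn ((x + C) / eps).
pose K := (Num.truncn ((C + C) / eps)).+1.
exists #|{ffun 'I_d -> 'I_K}|.+1 => c hc.
have cell_lt x : `|x| <= C -> (cell x < K)%N.
  rewrite ler_norml => /andP[_ hx]; rewrite ltnS; apply: le_truncn.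
  by rewrite ler_pM2r ?invr_gt0 // lerD2r.
pose f i := [ffun j => Ordinal (cell_lt _ (hc i j))].
have [i [k [ik e]]] : exists i k, i != k /\ f i = f k.
  apply: contrapT => no.
  have finj : injective f.
    move=> i k e; apply/eqP; apply/negPn/negP => ik; apply: no.
    by exists i, k.
  by have := leq_card f finj; rewrite card_ord ltnn.
exists i, k; split=> // j.
have /(congr1 val) /= ej : f i j = f k j by rewrite e.
rewrite !ffunE /= in ej.
have nn x : `|x| <= C -> 0 <= (x + C) / eps.
  by rewrite ler_norml => /andP[hx _]; rewrite divr_ge0 ?(ltW e0) //; lra.
have /andP[a1 a2] := truncn_itv (nn _ (hc i j)).
have /andP[b1 b2] := truncn_itv (nn _ (hc k j)).
rewrite -/(cell _) ej in a1 a2; rewrite -/(cell _) in b1 b2.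
rewrite -natr1 in a2 b2.
rewrite -(divfK (lt0r_neq0 e0) (c i j - c k j)) normrM (gtr0_norm e0).
rewrite gtr_pMl //.
have -> : (c i j - c k j) / eps = (c i j + C) / eps - (c k j + C) / eps.
  by rewrite -mulrBl; congr (_ / _); ring.
by rewrite ltr_norml; lra.
Qed.

(* The n + 1 disjoint open intervals (a + kg, a + (k+1)g) cannot all meet a
   list of length n. *)
Lemma gap_threshold (s : seq R) (a g : R) : 0 < g ->
  exists k : nat, (k <= size s)%N /\
   forall x, x \in s -> x <= a + k%:R * g \/ a + k.+1%:R * g <= x.
Proof.
move=> g0; pose cell (x : R) := Num.truncn ((x - a) / g).
have [k ks kn] : exists2 k, (k <= size s)%N & k \notin map cell s.
  apply: contrapT => no.
  have sub : {subset iota 0 (size s).+1 <= map cell s}.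
    move=> k; rewrite mem_iota add0n ltnS /= => ks.
    by apply/negPn/negP => kn; apply: no; exists k.
  have := uniq_leq_size (iota_uniq 0 (size s).+1) sub.
  by rewrite size_iota size_map ltnn.
exists k; split=> // x xs.
have [h|h] := leP x (a + k%:R * g); [by left|right].
rewrite leNgt; apply/negP => h'.
move/negP: kn; apply; apply/mapP; exists x => //; apply/esym/truncn_def.
rewrite ler_pdivlMr // ltr_pdivrMr //; lra.
Qed.

End Pigeonhole.

Section Boxes.

Lemma hex_dir_bound t : [/\ (absz ((hex_dir t).1) <= 1)%N, (absz ((hex_dir t).2) <= 1)%N &
  (absz ((hex_dir t).1 + (hex_dir t).2)%R <= 1)%N].
Proof.
rewrite -hex_dir_mod; have := ltn_pmod t (isT : (0 < 6)%N).
by move: (t %% 6)%N => [|[|[|[|[|[|]]]]]].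
Qed.

(** Its balls are parallelograms, and its spheres are closed paths of lattice edges in directions 0
    and 1, hence connected ([ring_connected]). *)
Definition nrm (v : vertex) : nat := maxn (absz v.1) (absz v.2).

Lemma nrm_hex v t : (nrm (v + hex_dir t)%R <= (nrm v).+1)%N /\
  (nrm v <= (nrm (v + hex_dir t)%R).+1)%N.
Proof.
have [] := hex_dir_bound t; rewrite /nrm /=; move: (hex_dir t) => [a b] /=.
case: v => m n /=; rewrite /GRing.add /=; lia.
Qed.

Definition box (n : nat) : seq vertex :=
  [seq ((i%:Z - n%:Z), (j%:Z - n%:Z)) | i <- iota 0 (n + n).+1,
                                        j <- iota 0 (n + n).+1].

Lemma mem_box n v : (v \in box n) = (nrm v <= n)%N.
Proof.
apply/idP/idP.
  case/allpairsP => -[i j] []; rewrite !mem_iota /nrm => hi hj ->.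
  by move: hi hj => /=; lia.
case: v => a b; rewrite /nrm /= => h.
apply/allpairsP; exists (absz (a + n%:Z)%R, absz (b + n%:Z)%R).
rewrite !mem_iota; split=> /=; [lia|lia|congr pair; lia].
Qed.

Lemma ring_connected k (P : vertex -> Prop) :
  (forall a t, nrm a = k -> nrm (a + hex_dir t) = k -> P a <-> P (a + hex_dir t)) ->
  forall x y, nrm x = k -> nrm y = k -> P x -> P y.
Proof.
move=> inv.
have horiz b (j : nat) a : nrm (a, b) = k -> nrm (a + j%:Z, b) = k ->
    absz (b) = k -> P (a, b) <-> P (a + j%:Z, b).
  move=> ha; elim: j => [|j IH] hj hb; first by rewrite addr0.
  have hj' : nrm (a + j%:Z, b) = k by move: ha hj hb; rewrite /nrm /=; lia.
  have e : (a + j.+1%:Z, b) = (a + j%:Z, b) + hex_dir 0.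
    by congr pair; rewrite /=; lia.
  have h := inv (a + j%:Z, b) 0 hj'; rewrite -e in h.
  by have := IH hj' hb; have := h hj; tauto.
have vert a (j : nat) b : nrm (a, b) = k -> nrm (a, b + j%:Z) = k ->
    absz (a) = k -> P (a, b) <-> P (a, b + j%:Z).
  move=> ha; elim: j => [|j IH] hj hb; first by rewrite addr0.
  have hj' : nrm (a, b + j%:Z) = k by move: ha hj hb; rewrite /nrm /=; lia.
  have e : (a, b + j.+1%:Z) = (a, b + j%:Z) + hex_dir 1.
    by congr pair; rewrite /=; lia.
  have h := inv (a, b + j%:Z) 1%N hj'; rewrite -e in h.
  by have := IH hj' hb; have := h hj; tauto.
have corner x : nrm x = k -> P x <-> P (k%:Z, k%:Z).
  case: x => a b hx.
  have right b' : (absz (b') <= k)%N -> P (k%:Z, b') <-> P (k%:Z, k%:Z).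
    move=> hb; have := vert k%:Z (absz (k%:Z - b')%R) b'.
    have -> : b' + absz (k%:Z - b')%R = k%:Z by lia.
    by apply; rewrite /nrm /=; lia.
  have top a' : (absz (a') <= k)%N -> P (a', k%:Z) <-> P (k%:Z, k%:Z).
    move=> ha; have := horiz k%:Z (absz (k%:Z - a')%R) a'.
    have -> : a' + absz (k%:Z - a')%R = k%:Z by lia.
    by apply; rewrite /nrm /=; lia.
  have [ea|[ea|[eb|eb]]] : a = k%:Z \/ a = - k%:Z \/ b = k%:Z \/ b = - k%:Z.
    by move: hx; rewrite /nrm /=; lia.
  - by rewrite ea; apply: right; move: hx; rewrite /nrm /=; lia.
  - have := vert a (absz (k%:Z - b)%R) b.
    have -> : b + absz (k%:Z - b)%R = k%:Z by move: hx; rewrite /nrm /=; lia.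
    move=> h; apply: iff_trans (h _ _ _) _; rewrite ?hx //;
      try by move: hx; rewrite /nrm /=; lia.
    by apply: top; lia.
  - by rewrite eb; apply: top; move: hx; rewrite /nrm /=; lia.
  - have := horiz b (absz (k%:Z - a)%R) a.
    have -> : a + absz (k%:Z - a)%R = k%:Z by move: hx; rewrite /nrm /=; lia.
    move=> h; apply: iff_trans (h _ _ _) _; rewrite ?hx //;
      try by move: hx; rewrite /nrm /=; lia.
    by apply: right; lia.
by move=> x y hx hy Px; apply/(corner y hy)/(corner x hx).
Qed.

Lemma ring_edge k (P : vertex -> Prop) x y : nrm x = k -> nrm y = k ->
  P x -> ~ P y -> exists a t,
  [/\ nrm a = k, nrm (a + hex_dir t) = k, P a & ~ P (a + hex_dir t)].
Proof.
move=> hx hy Px nPy; apply: contrapT => no; apply: nPy.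
apply: ring_connected hx hy Px => a t ha hat; split=> [Pa|Pat].
  by apply: contrapT => n; apply: no; exists a, t.
apply: contrapT => n; apply: no; exists (a + hex_dir t), t.+3.
by rewrite hex_dirN addrK; split.
Qed.

End Boxes.

(** * Connected components inside a box *)

Section Components.
Variables (Q : vertex -> Prop) (n : nat) (x0 : vertex).

Definition step_in (a b : vertex) : bool :=
  `[< (exists t, b = a + hex_dir t) /\ Q b >] && (b \in box n).

Definition component (x : vertex) : Prop :=
  exists s, path step_in x0 s /\ last x0 s = x.

Hypotheses (Q0 : Q x0) (b0 : x0 \in box n).

Lemma component_sub x : component x -> Q x /\ x \in box n.
Proof.
case=> s [ps <-]; case/lastP: s ps => [|s y]; first by split.
by rewrite rcons_path last_rcons => /andP[_ /andP[/asboolP[_ Qy] by_]].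
Qed.

Lemma component_step x t : component x -> Q (x + hex_dir t) ->
  x + hex_dir t \in box n -> component (x + hex_dir t).
Proof.
case=> s [ps ls] Qx bx; exists (rcons s (x + hex_dir t)).
rewrite rcons_path last_rcons ps ls /step_in bx andbT; split=> //.
by apply/asboolP; split=> //; exists t.
Qed.

Lemma component_short x : component x ->
  exists s, [/\ path step_in x0 s, last x0 s = x & (size s <= size (box n))%N].
Proof.
case=> s [ps <-]; case/shortenP: ps => s' ps' us' _.
exists s'; split=> //; apply: uniq_leq_size; first by case/andP: us'.
move=> y; elim: s' (x0) {us'} ps' => //= z s' IH w /andP[/andP[_ bz] ps'].
rewrite inE => /predU1P[-> //|]; exact: IH ps'.
Qed.

(** A component that missed the ring would remain strictly inside it, and so be a finite set whose
    outer neighbours all violate [Q]. The first hypothesis, later the maximum principle, forbids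
    this. *)
Lemma component_ring k :
  (forall S : seq vertex, x0 \in S -> (forall v, v \in S -> Q v) ->
     ~ (forall v t, v \in S -> v + hex_dir t \notin S -> ~ Q (v + hex_dir t))) ->
  (nrm x0 <= k)%N -> (k <= n)%N -> exists2 x, nrm x = k & component x.
Proof.
move=> noS x0k kn; apply: contrapT => no.
have lt x : component x -> (nrm x < k)%N.
  case=> s [ps <-]; elim/last_ind: s ps => [|s y IH].
    move=> _ /=; rewrite ltn_neqAle x0k andbT; apply/eqP => e.
    by apply: no; exists x0 => //; exists [::].
  rewrite rcons_path => /andP[ps st]; have := IH ps.
  have : component (last x0 (rcons s y)).
    by exists (rcons s y); rewrite rcons_path ps st.
  rewrite last_rcons => cy.
  move: st => /andP[/asboolP[[t yE] _] _] h.
  rewrite ltn_neqAle; apply/andP; split.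
    by apply/eqP => e; apply: no; exists y.
  by rewrite yE; have [h1 _] := nrm_hex (last x0 s) t; apply: leq_trans h1 h.
pose S := [seq x <- box n | `[< component x >]].
have memS x : component x -> x \in S.
  move=> cx; rewrite mem_filter; apply/andP; split; first exact/asboolP.
  by case: (component_sub cx).
apply: (noS S); first by apply: memS; exists [::].
  by move=> v; rewrite mem_filter => /andP[/asboolP /component_sub[]].
move=> v t; rewrite mem_filter => /andP[/asboolP cv bv] nS Qv.
move/negP: nS; apply; apply/memS/component_step => //.
rewrite mem_box; have [h _] := nrm_hex v t.
by apply: leq_trans h (leq_trans (lt _ cv) kn).
Qed.

End Components.

(** * Finite approximate layouts *)

Section Embeddable.
Variables (R : realType) (p : nat -> R).
Local Notation plane := (R * R)%type.

Definition sqd (x y : plane) : R := (x.1 - y.1) ^+ 2 + (x.2 - y.2) ^+ 2.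

Definition len2 (u : vertex -> R) v t : R :=
  expR (u v) ^+ 2 + expR (u (v + hex_dir t)) ^+ 2
  + 2 * expR (u v) * expR (u (v + hex_dir t)) * p t.

Definition near_or_eq (x y : vertex) : Prop := y = x \/ exists t, y = x + hex_dir t.

(** Repeated vertices are allowed, so [faces_disjoint] also covers edges and vertices. *)
Definition simplex (x y z : vertex) : Prop :=
  [/\ near_or_eq x y, near_or_eq y z & near_or_eq x z].

Definition disjoint3 (x y z x' y' z' : vertex) : Prop :=
  forall a, a \in [:: x; y; z] -> a \notin [:: x'; y'; z'].

Definition faces_disjoint (F : seq vertex) (psi : vertex -> plane) : Prop :=
  forall x y z x' y' z', {subset [:: x; y; z; x'; y'; z'] <= F} ->
    simplex x y z -> simplex x' y' z' -> disjoint3 x y z x' y' z' ->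
    forall q, hull3 (psi x) (psi y) (psi z) q ->
              ~ hull3 (psi x') (psi y') (psi z') q.

Definition oriented (F : seq vertex) (psi : vertex -> plane) : Prop :=
  forall v t, v \in F -> v + hex_dir t \in F -> v + hex_dir t.+1 \in F ->
    0 < det2 (psi (v + hex_dir t) - psi v) (psi (v + hex_dir t.+1) - psi v).

(* Approximate layouts of finite pieces are all that is needed of embeddability;
   in this form it passes to pointwise limits of labels. *)
Definition embeddable_label (u : vertex -> R) : Prop :=
  forall (F : seq vertex) (eps : R), 0 < eps -> exists psi : vertex -> plane,
  [/\ forall v t, v \in F -> v + hex_dir t \in F ->
        `|sqd (psi v) (psi (v + hex_dir t)) - len2 u v t| < eps,
      oriented F psi & faces_disjoint F psi].

Lemma near_or_eq_sym x y : near_or_eq x y -> near_or_eq y x.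
Proof.
case=> [->|[t ->]]; first by left.
by right; exists t.+3; rewrite hex_dirN addrK.
Qed.

Lemma simplex_edge x y : near_or_eq x y -> simplex x x y.
Proof. by move=> h; split=> //; left. Qed.

Lemma simplex_face v t : simplex v (v + hex_dir t) (v + hex_dir t.+1).
Proof.
split; [by right; exists t| |by right; exists t.+1].
by right; exists t.+2; rewrite -addrA -hex_dirS.
Qed.

Lemma segments_disjoint F psi x y x' y' : faces_disjoint F psi ->
  {subset [:: x; y; x'; y'] <= F} -> near_or_eq x y -> near_or_eq x' y' ->
  x != x' -> x != y' -> y != x' -> y != y' ->
  forall q, seg (psi x) (psi y) q -> ~ seg (psi x') (psi y') q.
Proof.
move=> fd sF cxy cxy' n1 n2 n3 n4 q s1 s2.
have h (a b : vertex) : a \in [:: x; y; x'; y'] -> b = a -> b \in F.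
  by move=> ha ->; apply: sF.
apply: (fd x x y x' x' y' _ _ _ _ q (seg_hull3 _ s1) (seg_hull3 _ s2)).
- move=> a ha; apply: sF; move: ha; rewrite !inE.
  by repeat case/orP=> [->|]; rewrite ?orbT // => ->; rewrite ?orbT.
- exact: simplex_edge.
- exact: simplex_edge.
move=> a; rewrite !inE => ha; rewrite !negb_or.
by move: ha => /or3P[]/eqP->; rewrite ?n1 ?n2 ?n3 ?n4.
Qed.

End Embeddable.

(** * Ratios of adjacent radii are bounded *)

Section LargeAngle.
Variable R : realType.
Local Notation plane := (R * R)%type.

Definition sqn (x : plane) : R := x.1 ^+ 2 + x.2 ^+ 2.
Definition dot2 (x y : plane) : R := x.1 * y.1 + x.2 * y.2.

(* When two circles are much larger than a third one, the angle at the latter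
   is close to acos (- p3). *)
Lemma large_angle (k P G rt rm rl p1 p2 p3 X Y Z : R) :
  0 < k <= 1 -> 1 <= P -> 8 * (3 + 2 * P) <= k * G -> 0 < rt <= 1 ->
  G <= rm -> G <= rl -> `|p1| <= P -> `|p2| <= P -> k <= 1 + p3 ->
  `|X - (rt ^+ 2 + rm ^+ 2 + 2 * rt * rm * p1)| < 1 ->
  `|Y - (rt ^+ 2 + rl ^+ 2 + 2 * rt * rl * p2)| < 1 ->
  `|Z - (rm ^+ 2 + rl ^+ 2 + 2 * rm * rl * p3)| < 1 ->
  [/\ (G / 2) ^+ 2 <= X, (G / 2) ^+ 2 <= Y &
      (X + Y - Z) / 2 <= (1 - k / 2) * (Num.sqrt X * Num.sqrt Y)].
Proof.
move=> /andP[k0 k1] P1 hG /andP[t0 t1] Gm Gl hp1 hp2 hp3 hX hY hZ.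
have G1 : 1 <= G by clear - k0 k1 P1 hG; nra.
have m1 : 1 <= rm by lra.
have l1 : 1 <= rl by lra.
have kG r : G <= r -> 8 * (3 + 2 * P) * r <= k * r ^+ 2.
  move=> Gr; have h1 : 8 * (3 + 2 * P) * r <= k * G * r by apply: ler_wpM2r; lra.
  have h2 : k * r * G <= k * r * r.
    by clear - k0 Gr G1; apply: ler_wpM2l => //; apply: mulr_ge0; lra.
  by lra.
have low (q r W : R) : G <= r -> `|q| <= P ->
    `|W - (rt ^+ 2 + r ^+ 2 + 2 * rt * r * q)| < 1 ->
    ((1 - k / 8) * r ^+ 2 <= W) /\ rt * r * q <= P * r.
  move=> Gr; rewrite ltr_norml ler_norml => /andP[q1 q2] /andP[w1 w2].
  have h := kG _ Gr.
  have r1 : 1 <= r by lra.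
  have r0 : 0 <= r by lra.
  have a1 : 0 <= rt * r * (q + P).
    by clear - t0 r0 q1; rewrite mulr_ge0 ?mulr_ge0 ?(ltW t0) //; lra.
  have a2 : 0 <= rt * r * (P - q).
    by clear - t0 r0 q2; rewrite mulr_ge0 ?mulr_ge0 ?(ltW t0) //; lra.
  have a3 : 0 <= (1 - rt) * r * P.
    by clear - t1 r0 P1; rewrite mulr_ge0 ?mulr_ge0 //; lra.
  have a4 := sqr_ge0 rt.
  by split; clear - a1 a2 a3 a4 h w1 r1; lra.
have [X1 X2] := low _ _ _ Gm hp1 hX.
have [Y1 Y2] := low _ _ _ Gl hp2 hY.
have sq r W : G <= r -> (1 - k / 8) * r ^+ 2 <= W -> (G / 2) ^+ 2 <= W.
  move=> Gr h; apply: le_trans h.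
  have : G ^+ 2 <= r ^+ 2 by rewrite ler_pXn2r ?nnegrE //; lra.
  have : 0 <= (1 - k) * r ^+ 2 by rewrite mulr_ge0 ?sqr_ge0 //; lra.
  by have := sqr_ge0 r; lra.
split; [exact: sq X1|exact: sq Y1|].
have c0 : 0 <= 1 - k / 8 by lra.
have XY : (1 - k / 8) * (rm * rl) <= Num.sqrt X * Num.sqrt Y.
  rewrite -(ger0_norm (_ : 0 <= (1 - k / 8) * (rm * rl))); last first.
    by rewrite !mulr_ge0 //; lra.
  rewrite -sqrtr_sqr -sqrtrM; last first.
    by apply: le_trans X1; rewrite mulr_ge0 ?sqr_ge0.
  apply: ler_wsqrtr; have -> : ((1 - k / 8) * (rm * rl)) ^+ 2 =
    ((1 - k / 8) * rm ^+ 2) * ((1 - k / 8) * rl ^+ 2) by ring.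
  by apply: ler_pM => //; apply: mulr_ge0 => //; apply: sqr_ge0.
apply: le_trans (_ : (1 - k / 2) * ((1 - k / 8) * (rm * rl)) <= _); last first.
  by apply: ler_wpM2l; [lra|exact: XY].
have ml0 : 0 <= rm * rl by clear - m1 l1; rewrite mulr_ge0; lra.
have kk : 0 <= k * k * (rm * rl) by rewrite mulr_ge0 // mulr_ge0 // ltW.
have h1 : 8 * (3 + 2 * P) * rm <= k * (rm * rl).
  have a1 : 8 * (3 + 2 * P) * rm <= k * G * rm by clear - hG m1; apply: ler_wpM2r; lra.
  have a2 : k * rm * G <= k * rm * rl.
    by clear - k0 m1 l1 Gm Gl; apply: ler_wpM2l => //; apply: mulr_ge0; lra.
  by clear - a1 a2; lra.
have h2 : 8 * (3 + 2 * P) * rl <= k * (rm * rl).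
  have a1 : 8 * (3 + 2 * P) * rl <= k * G * rl by clear - hG l1; apply: ler_wpM2r; lra.
  have a2 : k * rl * G <= k * rl * rm.
    by clear - k0 m1 l1 Gm Gl; apply: ler_wpM2l => //; apply: mulr_ge0; lra.
  by clear - a1 a2; lra.
have h3 : 0 <= rm * rl * (1 + p3 - k) by rewrite mulr_ge0 //; lra.
have t2 : rt ^+ 2 <= 1 by rewrite expr_le1 //; lra.
have Pm : 0 <= (P - 1) * rm by clear - P1 m1; rewrite mulr_ge0; lra.
have Pl : 0 <= (P - 1) * rl by clear - P1 l1; rewrite mulr_ge0; lra.
move: hX hY hZ; rewrite !ltr_norml => /andP[x1 x2] /andP[y1 y2] /andP[z1 z2].
have U : (X + Y - Z) / 2 <= 3 + P * rm + P * rl - rm * rl * p3.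
  by clear - x2 y2 z1 X2 Y2 t2; lra.
apply: le_trans U _.
by clear - h1 h2 h3 kk Pm Pl m1 l1; lra.
Qed.

(** The witness is the difference of the unit vectors of [A] and [B], turned by a right angle; its
    determinants with them are the lengths times 1 minus the cosine. *)
Lemma bisector (A B : plane) (k : R) : 0 < sqn A -> 0 < sqn B ->
  dot2 A B <= (1 - k) * (Num.sqrt (sqn A) * Num.sqrt (sqn B)) ->
  exists b : plane, [/\ `|b.1| <= 2, `|b.2| <= 2,
    k * Num.sqrt (sqn A) <= det2 A b & k * Num.sqrt (sqn B) <= det2 b B].
Proof.
move=> A0 B0 h.
set a := Num.sqrt (sqn A) in h *; set c := Num.sqrt (sqn B) in h *.
have a0 : 0 < a by rewrite sqrtr_gt0.
have c0 : 0 < c by rewrite sqrtr_gt0.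
have a2 : a ^+ 2 = A.1 ^+ 2 + A.2 ^+ 2 by rewrite sqr_sqrtr // ltW.
have c2 : c ^+ 2 = B.1 ^+ 2 + B.2 ^+ 2 by rewrite sqr_sqrtr // ltW.
have le1 (x y r : R) : 0 < r -> r ^+ 2 = x ^+ 2 + y ^+ 2 ->
    `|x / r| <= 1 /\ `|y / r| <= 1.
  move=> r0 r2; rewrite !ler_norml; split; apply: sqr_le1;
    rewrite expr_div_n ler_pdivrMr ?exprn_gt0 // mul1r r2.
    by rewrite lerDl sqr_ge0.
  by rewrite lerDr sqr_ge0.
have [A1 A2] := le1 _ _ _ a0 a2; have [B1 B2] := le1 _ _ _ c0 c2.
exists (B.2 / c - A.2 / a, A.1 / a - B.1 / c); split=> /=.
- by apply: le_trans (ler_normB _ _) _; lra.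
- by apply: le_trans (ler_normB _ _) _; lra.
- have -> : det2 A (B.2 / c - A.2 / a, A.1 / a - B.1 / c) =
      (A.1 ^+ 2 + A.2 ^+ 2) / a - dot2 A B / c.
    by rewrite /det2 /dot2 /=; field; rewrite !lt0r_neq0.
  rewrite -a2 expr2 mulfK ?lt0r_neq0 //.
  have : dot2 A B / c <= (1 - k) * a by rewrite ler_pdivrMr // -mulrA.
  by lra.
have -> : det2 (B.2 / c - A.2 / a, A.1 / a - B.1 / c) B =
      (B.1 ^+ 2 + B.2 ^+ 2) / c - dot2 A B / a.
  by rewrite /det2 /dot2 /=; field; rewrite !lt0r_neq0.
rewrite -c2 expr2 mulfK ?lt0r_neq0 //.
have : dot2 A B / a <= (1 - k) * c by rewrite ler_pdivrMr // -mulrA [c * a]mulrC.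
by lra.
Qed.

Lemma det2_norm (x y : plane) (a b : R) : `|x.1| <= a -> `|x.2| <= a ->
  `|y.1| <= b -> `|y.2| <= b -> `|det2 x y| <= 2 * a * b.
Proof.
move=> x1 x2 y1 y2; rewrite /det2; apply: le_trans (ler_normB _ _) _.
rewrite !normrM; have -> : 2 * a * b = a * b + a * b by ring.
by apply: lerD; apply: ler_pM.
Qed.

End LargeAngle.


Section LabelSymmetries.
Variables (R : realType) (p : nat -> R).
Implicit Types u : vertex -> R.

Lemma flat_label_add u (a : R) : flat_label p u -> flat_label p (fun v => u v + a).
Proof.
have e v : rratio (fun v => u v + a) v = rratio u v.
  by apply/funext => t; rewrite /rratio; congr (expR _); ring.
by case=> h1 h2 h3; split=> *; rewrite e //; apply: h3.
Qed.

Lemma flat_label_translate u (c : vertex) : flat_label p u -> flat_label p (fun v => u (c + v)).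
Proof.
have e v : rratio (fun v => u (c + v)) v = rratio u (c + v).
  by apply/funext => t; rewrite /rratio addrA.
by case=> h1 h2 h3; split=> *; rewrite e //; apply: h3.
Qed.

Lemma embeddable_label_translate u (c : vertex) :
  embeddable_label p u -> embeddable_label p (fun v => u (c + v)).
Proof.
move=> emb F eps e0.
have [psi [h1 h2 h3]] := emb [seq c + v | v <- F] eps e0.
have memF v : v \in F -> c + v \in [seq c + v | v <- F] by exact: map_f.
have cl x y : near_or_eq x y -> near_or_eq (c + x) (c + y).
  by case=> [->|[t ->]]; [left|right; exists t; rewrite addrA].
exists (fun v => psi (c + v)); split.
- move=> v t vF wF; have := h1 (c + v) t; rewrite /len2 -!(addrA c).
  by apply; apply: memF.
- move=> v t vF wF zF; have := h2 (c + v) t; rewrite -!(addrA c).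
  by apply; apply: memF.
move=> x y z x' y' z' sF [s1 s2 s3] [s4 s5 s6] dj.
apply: h3; rewrite /simplex; try by split; apply: cl.
- move=> a; rewrite -[[:: c + x; _; _; _; _; _]]/([seq c + w | w <-
    [:: x; y; z; x'; y'; z']]) => /mapP[w wl ->].
  exact/memF/sF.
move=> a; have mE l : a \in [seq c + w | w <- l] = (a - c \in l).
  apply/mapP/idP => [[w wl ->]|h]; first by rewrite addrC addKr.
  by exists (a - c) => //; rewrite addrC subrK.
rewrite -[[:: c + x; _; _]]/([seq c + w | w <- [:: x; y; z]]).
rewrite -[[:: c + x'; _; _]]/([seq c + w | w <- [:: x'; y'; z']]).
by rewrite !mE; apply: dj.
Qed.

Lemma hull3_scale (a : R) P Q S q : a != 0 ->
  hull3 (a * P.1, a * P.2) (a * Q.1, a * Q.2) (a * S.1, a * S.2) q ->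
  hull3 P Q S (q.1 / a, q.2 / a).
Proof.
move=> a0 [x [y [z [x0 y0 z0 e ->]]]]; exists x, y, z; split=> //=.
by congr pair; field.
Qed.

Lemma embeddable_label_add u (a : R) :
  embeddable_label p u -> embeddable_label p (fun v => u v + a).
Proof.
move=> emb F eps e0; have c0 : 0 < expR a := expR_gt0 a.
have [|psi [h1 h2 h3]] := emb F (eps / expR a ^+ 2).
  by rewrite divr_gt0 // exprn_gt0.
exists (fun v => (expR a * (psi v).1, expR a * (psi v).2)); split.
- move=> v t vF wF; have := h1 v t vF wF.
  rewrite ltr_pdivlMr ?exprn_gt0 // -[X in _ * X](gtr0_norm (exprn_gt0 2 c0)).
  rewrite -normrM; congr (`|_| < _).
  by rewrite /sqd /len2 /= !expRD; ring.
- move=> v t vF wF zF; have := h2 v t vF wF zF.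
  rewrite -(pmulr_rgt0 _ (exprn_gt0 2 c0)); congr (_ < _).
  by rewrite /det2 /=; ring.
move=> x y z x' y' z' sF sx sy dj q /(hull3_scale (lt0r_neq0 c0)) q1.
move/(hull3_scale (lt0r_neq0 c0)); exact: h3 q1.
Qed.

End LabelSymmetries.

Section BoundedRatio.
Variables (R : realType) (p : nat -> R).
Local Notation plane := (R * R)%type.
Hypothesis p3 : forall t, p t.+3 = p t.
Hypothesis wp : weights_small p \/ weights_large p.
Hypothesis pN1 : forall t, -1 < p t.
Hypothesis acute : forall t, p t <= 1 + p t.+1 + p t.+2.

Lemma weight_bounds : exists k P : R,
  [/\ 0 < k <= 1, 1 <= P & forall t, k <= 1 + p t /\ `|p t| <= P].
Proof.
pose m := Num.min (1 + p 0) (Num.min (1 + p 1%N) (1 + p 2%N)).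
exists (Num.min 1 m), (1 + `|p 0| + `|p 1%N| + `|p 2%N|).
have n (t : nat) := normr_ge0 (p t).
have p0' t : 0 < 1 + p t by have := pN1 t; lra.
split.
- by rewrite ge_min lexx /= andbT !lt_min ltr01 !p0'.
- by have := n 0; have := n 1%N; have := n 2%N; lra.
have [n0 n1 n2] := And3 (n 0) (n 1%N) (n 2%N).
elim/ltn_ind => -[|[|[|t]]] IH; last by rewrite p3; apply: IH; lia.
- by split; [rewrite !ge_min lexx !orbT|lra].
- by split; [rewrite !ge_min lexx !orbT|lra].
- by split; [rewrite !ge_min lexx !orbT|lra].
Qed.

Section TinyLarge.
Variables (u : vertex -> R) (n : nat) (d0 : nat) (G : R).
Hypothesis fu : flat_label p u.
Hypothesis G1 : 1 < G.
Hypothesis u0 : u 0 <= 0.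
Hypothesis ud : G <= expR (u (hex_dir d0)).
Hypothesis n1 : (1 <= n)%N.

Let tiny v := u v <= 0.
Let large v := ~~ (u v <= 0).
Let T := component tiny n 0.
Let L := component large n (hex_dir d0).

Lemma large_seed : large (hex_dir d0).
Proof.
rewrite /large -ltNge; have := lt_le_trans G1 ud.
by rewrite -{1}expR0 ltr_expR.
Qed.

Lemma tiny_sub x : T x -> u x <= 0 /\ x \in box n.
Proof. by move=> Tx; apply: (component_sub _ _ Tx); rewrite // mem_box. Qed.

Lemma seed_box : hex_dir d0 \in box n.
Proof.
rewrite mem_box; have [h _] := nrm_hex 0 d0.
by apply: leq_trans n1; rewrite add0r in h; exact: h.
Qed.

Lemma large_sub x : L x -> large x /\ x \in box n.
Proof.
by move=> Lx; apply: (component_sub _ _ Lx); [exact: large_seed|exact: seed_box].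
Qed.

Lemma tiny_ring k : (k <= n)%N -> exists2 x, nrm x = k & T x.
Proof.
move=> kn; apply: component_ring => //; first by rewrite mem_box.
move=> S S0 St out; apply: (no_strict_min p3 wp pN1 acute fu S0).
move=> v t vS nS; have := St _ vS; have := out _ _ vS nS; rewrite /tiny.
by move/negP; rewrite -ltNge => h1 h2; apply: le_lt_trans h2 h1.
Qed.

Lemma large_ring k : (0 < k)%N -> (k <= n)%N -> exists2 x, nrm x = k & L x.
Proof.
move=> k0 kn; have nd : (nrm (hex_dir d0) <= 1)%N.
  by have [h _] := nrm_hex 0 d0; rewrite add0r in h; exact: h.
apply: component_ring => //; first exact: large_seed.
- exact: seed_box.
- move=> S S0 St out; apply: (no_strict_max p3 wp pN1 acute fu S0).
  move=> v t vS nS; have := St _ vS; have := out _ _ vS nS; rewrite /large.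
  by move/negP/negPn; rewrite -ltNge; apply: le_lt_trans.
exact: leq_trans nd k0.
Qed.

(* Turn around the large end point of an edge of the ring that leaves the tiny
   component until the next large vertex. *)
Lemma tiny_large_face k : (0 < k)%N -> (k < n)%N -> exists l b,
  [/\ nrm l = k, T (l + hex_dir b), large (l + hex_dir b.+1) & large l].
Proof.
move=> k0 kn; have [x xk Tx] := tiny_ring (ltnW kn).
have [y yk Ly] := large_ring k0 (ltnW kn).
have nTy : ~ T y.
  by move=> /tiny_sub[ty _]; have [ly _] := large_sub Ly; move: ly; rewrite /large ty.
have [a [t [ak lk Ta nTl]]] := ring_edge xk yk Tx nTy.
set l := a + hex_dir t in lk nTl.
have bl : l \in box n by rewrite mem_box lk ltnW.
have ll : large l.
  apply/negP => tl; apply: nTl; exact: component_step.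
have bn s : l + hex_dir s \in box n.
  by rewrite mem_box; have [h _] := nrm_hex l s; apply: leq_trans h _; rewrite lk.
have aE : a = l + hex_dir t.+3 by rewrite hex_dirN addrK.
(* With tiny neighbours only, [l] would be a strict local maximum. *)
have [j0 hj0] : exists j, large (l + hex_dir j).
  apply: contrapT => no.
  apply: (@no_strict_max _ _ p3 wp pN1 acute u [:: l] l fu (mem_head _ _)).
  move=> v s; rewrite inE => /eqP -> _.
  have h : u (l + hex_dir s) <= 0.
    by apply/negPn/negP => h; apply: no; exists s.
  by apply: le_lt_trans h _; rewrite ltNge.
have exj : exists j, large (l + hex_dir (t.+3 + j)).
  (* Adding [5 * t.+3] undoes the shift by [t.+3] modulo 6. *)
  exists (j0 + 5 * t.+3)%N; rewrite -hex_dir_mod.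
  have -> : (t.+3 + (j0 + 5 * t.+3) = j0 + t.+3 * 6)%N by lia.
  by rewrite modnMDr hex_dir_mod || rewrite addnC modnMDl hex_dir_mod.
case: (ex_minnP exj) => j lj minj.
have j_gt0 : (0 < j)%N.
  case: j lj {minj} => //; rewrite addn0 -aE.
  by have [ta _] := tiny_sub Ta; rewrite /large ta.
exists l, (t.+3 + j.-1)%N; split=> //; last by rewrite -addnS prednK.
have : (j.-1 < j)%N by rewrite prednK.
elim: (j.-1) => [|i IH] ij; first by rewrite addn0 -aE.
have := IH (ltnW ij); rewrite addnS => /component_step h.
have e : l + hex_dir (t.+3 + i).+1 = l + hex_dir (t.+3 + i)
    + hex_dir (t.+3 + i).+2 by rewrite -(addrA l) -hex_dirS.
rewrite e; apply: h; rewrite -e ?bn //.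
apply/negPn/negP => hl; have := minj i.+1; rewrite addnS => /(_ hl).
by rewrite leqNgt ij.
Qed.

End TinyLarge.
End BoundedRatio.

Section RingLemma.
Variables (R : realType) (p : nat -> R).
Local Notation plane := (R * R)%type.

Lemma sqn_bound (x : plane) : `|x.1| <= Num.sqrt (sqn x) /\ `|x.2| <= Num.sqrt (sqn x).
Proof.
by split; rewrite -sqrtr_sqr ler_wsqrtr // /sqn ?lerDl ?lerDr sqr_ge0.
Qed.

Lemma sqdE (x y : plane) : sqd x y = sqn (y - x).
Proof. by rewrite /sqd /sqn /=; ring. Qed.

Section Layout.
Variables (u : vertex -> R) (n : nat) (psi : vertex -> plane) (P : R).
Hypothesis P1 : 1 <= P.
Hypothesis pP : forall t, `|p t| <= P.
Hypothesis psi_len : forall v t, v \in box n -> v + hex_dir t \in box n ->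
  `|sqd (psi v) (psi (v + hex_dir t)) - len2 p u v t| < 1.
Hypothesis psi_disj : faces_disjoint (box n) psi.
Hypothesis u0 : u 0 <= 0.

Let tiny v := u v <= 0.
Let T := component tiny n 0.
Let B := 3 + 2 * P.
Let delta : R := (size (box n))%:R * B.

(** Two radii at most 1 give a squared length at most [2 + 2 * P]; the layout error adds 1, and
    [3 + 2 * P <= B ^+ 2]. *)
Lemma tiny_step_bound a t : u a <= 0 -> a \in box n ->
  u (a + hex_dir t) <= 0 -> a + hex_dir t \in box n ->
  `|(psi (a + hex_dir t) - psi a).1| <= B /\
  `|(psi (a + hex_dir t) - psi a).2| <= B.
Proof.
move=> ua ba ub bb; set b := a + hex_dir t in ub bb *.
have Pge := P1; have /(_ t) := pP; rewrite ler_norml => /andP[q1 q2].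
have B0 : 0 <= B by rewrite /B; lra.
have := psi_len ba bb; rewrite -/b sqdE /len2 -/b.
have ea : 0 < expR (u a) <= 1 by rewrite expR_gt0 -expR0 ler_expR.
have eb : 0 < expR (u b) <= 1 by rewrite expR_gt0 -expR0 ler_expR.
move: ea eb; set x := expR (u a); set y := expR (u b).
move=> /andP[x0 x1] /andP[y0 y1]; rewrite ltr_norml => /andP[_ h].
have x2 : x ^+ 2 <= 1 by rewrite expr_le1 // ltW.
have y2 : y ^+ 2 <= 1 by rewrite expr_le1 // ltW.
have xy : x * y * p t <= P.
  have a1 : 0 <= x * y * (P - p t).
    by apply: mulr_ge0; [rewrite mulr_ge0 // ltW|lra].
  have a2 : 0 <= (1 - x * y) * P.
    by apply: mulr_ge0; [rewrite subr_ge0 mulr_ile1 // ltW|lra].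
  by lra.
have sB : sqn (psi b - psi a) <= B ^+ 2.
  have : 3 + 2 * P <= B ^+ 2 by rewrite /B; nra.
  by lra.
have rB : Num.sqrt (sqn (psi b - psi a)) <= B.
  by rewrite -(ger0_norm B0) -sqrtr_sqr ler_wsqrtr.
have [h1 h2] := sqn_bound (psi b - psi a).
by split; [apply: le_trans h1 rB|apply: le_trans h2 rB].
Qed.

(** A path without repetitions has at most [size (box n)] steps, so the bound does not depend on the
    large radii. *)
Lemma tiny_component_bound x : T x ->
  `|(psi x - psi 0).1| <= delta /\ `|(psi x - psi 0).2| <= delta.
Proof.
have Pge := P1; have B0 : 0 <= B by rewrite /B; lra.
move=> /component_short[s [ps <- sz]].
suff [h1 h2] : `|(psi (last 0 s) - psi 0).1| <= (size s)%:R * B /\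
     `|(psi (last 0 s) - psi 0).2| <= (size s)%:R * B.
  have h : (size s)%:R * B <= delta by apply: ler_wpM2r => //; rewrite ler_nat.
  by split; [apply: le_trans h1 h|apply: le_trans h2 h].
elim/last_ind: s ps {sz} => [|s y IH]; first by rewrite /= !subrr normr0 mul0r.
rewrite rcons_path last_rcons size_rcons => /andP[ps st].
have [h1 h2] := IH ps.
have [ul bl] : u (last 0 s) <= 0 /\ last 0 s \in box n.
  have Tl : T (last 0 s) by exists s.
  by apply: (component_sub _ _ Tl); rewrite // mem_box.
move: st => /andP[/asboolP[[t yE] uy] by_]; rewrite yE in uy by_ *.
have [g1 g2] := tiny_step_bound ul bl uy by_.
have e w (z : plane) : w - psi 0 = (w - z) + (z - psi 0).
  by rewrite addrA subrK.
rewrite -natr1 mulrDl mul1r (e _ (psi (last 0 s))) addrC; split.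
  by apply: le_trans (ler_normD _ _) _; apply: lerD.
by apply: le_trans (ler_normD _ _) _; apply: lerD.
Qed.

(** An edge between tiny vertices shares no vertex with the side joining two large ones, so a tiny
    path never crosses that side. *)
Lemma tiny_same_side b l t : l \in box n -> l + hex_dir t \in box n ->
  ~ (u l <= 0) -> ~ (u (l + hex_dir t) <= 0) ->
  (forall x, T x -> in_cone b (psi (l + hex_dir t)) (psi l) (psi x)) ->
  forall x, T x ->
  0 < det2 (psi (l + hex_dir t) - psi 0) (psi l - psi 0) <->
  0 < det2 (psi (l + hex_dir t) - psi x) (psi l - psi x).
Proof.
move=> bl bm ul um cone x [s [ps <-]]; elim/last_ind: s ps => [//|s y IH].
rewrite rcons_path last_rcons => /andP[ps st].
apply: iff_trans (IH ps) _.
have Tl : T (last 0 s) by exists s.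
have Ty : T y by exists (rcons s y); rewrite rcons_path last_rcons ps st.
have sub z : T z -> u z <= 0 /\ z \in box n.
  by move=> Tz; apply: (component_sub _ _ Tz); rewrite // mem_box.
have [u1 b1] := sub _ Tl; have [u2 b2] := sub _ Ty.
have ne z w : u z <= 0 -> ~ (u w <= 0) -> z != w.
  by move=> uz uw; apply/eqP => e; apply: uw; rewrite -e.
move: st => /andP[/asboolP[[i yE] _] _].
have disj q : seg (psi (last 0 s)) (psi y) q ->
    ~ seg (psi (l + hex_dir t)) (psi l) q.
  apply: (segments_disjoint psi_disj) => //; try exact: ne.
  - move=> z; rewrite !inE => /or4P[]/eqP-> //.
  - by right; exists i.
  - by right; exists t.+3; rewrite hex_dirN addrK.
split; apply: no_crossing (cone _ _) (cone _ _) _ => //.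
by move=> q /seg_sym; apply: disj.
Qed.

End Layout.
End RingLemma.

Section RatioBounded.
Variables (R : realType) (p : nat -> R).
Local Notation plane := (R * R)%type.
Hypothesis p3 : forall t, p t.+3 = p t.
Hypothesis wp : weights_small p \/ weights_large p.
Hypothesis pN1 : forall t, -1 < p t.
Hypothesis acute : forall t, p t <= 1 + p t.+1 + p t.+2.

(* Many faces with one tiny and two large vertices are found at disjoint
   positions; two of them have nearly parallel bisectors, and since their tiny
   vertices are joined by a tiny path that avoids the long sides, they meet. *)
Lemma no_tiny_large (k P : R) (N : nat) (u : vertex -> R) (G : R) (d0 : nat) :
  0 < k <= 1 -> 1 <= P -> (forall t, k <= 1 + p t /\ `|p t| <= P) ->
  (forall c : 'I_N -> 'I_2 -> R, (forall i j, `|c i j| <= 2) ->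
     exists i i', i != i' /\ forall j, `|c i j - c i' j| < k / 16) ->
  let n := (3 * N).+3 in
  8 * (3 + 2 * P) <= k * G -> 64 * ((size (box n))%:R * (3 + 2 * P)) < k * G ->
  flat_label p u -> embeddable_label p u ->
  (forall v, v \in box n -> u v <= 0 \/ G <= expR (u v)) ->
  u 0 <= 0 -> ~ (G <= expR (u (hex_dir d0))).
Proof.
move=> hk P1 hkP pig n hG hG2 fu emb gap u0 ud.
have /andP[k0 k1] := hk.
have G1 : 1 < G.
  have h : k * G <= 1 * G \/ G < 0.
    by have [g|g] := leP 0 G; [left; rewrite ler_wpM2r|right].
  by case: h; nra.
have pP t : `|p t| <= P by case: (hkP t).
have [psi [h1 h2 h3]] := emb (box n) 1 ltr01.
have n1 : (1 <= n)%N by [].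
pose tiny v := u v <= 0.
pose T := component tiny n 0.
set B := 3 + 2 * P in hG hG2; pose delta := (size (box n))%:R * B.
have d_ge0 : 0 <= delta by rewrite mulr_ge0 // /B; lra.
have Tb x : T x -> `|(psi x - psi 0).1| <= delta /\ `|(psi x - psi 0).2| <= delta.
  exact: (tiny_component_bound P1 pP h1 u0).
have Tsub x : T x -> u x <= 0 /\ x \in box n by move=> Tx; apply: (component_sub _ _ Tx); rewrite ?mem_box.
(* A face based on ring [3 * i + 2] only touches the rings [3 * i + 1] to [3 * i + 3]; different [i]
   therefore give disjoint faces. *)
have face (i : 'I_N) : exists lb : vertex * nat,
    [/\ nrm lb.1 = (3 * i).+2, T (lb.1 + hex_dir lb.2),
        ~ (u (lb.1 + hex_dir lb.2.+1) <= 0) & ~ (u lb.1 <= 0)].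
  have kn : ((3 * i).+2 < n)%N.
    by rewrite /n !ltnS leq_mul2l ltnW // ltnS ltnW.
  have [l [b [f1 f2 f3 f4]]] :=
    tiny_large_face p3 wp pN1 acute fu G1 u0 ud n1 (ltn0Sn _) kn.
  by exists (l, b); split=> //; apply/negP.
have [f hf] := choice face.
pose L i := (f i).1; pose t i := L i + hex_dir (f i).2.
pose m i := L i + hex_dir (f i).2.+1.
have mE i : m i = t i + hex_dir (f i).2.+2.
  by rewrite /m /t hex_dirS -addrA.
have LE i : L i = t i + hex_dir (f i).2.+3 by rewrite /t hex_dirN addrK.
have Tt i : T (t i) by case: (hf i).
have near_nrm i v : v \in [:: t i; m i; L i] ->
    ((3 * i).+1 <= nrm v <= (3 * i).+3)%N.
  have [e _ _ _] := hf i; rewrite -/(L i) in e.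
  have [a1 a2] := nrm_hex (L i) (f i).2; have [a3 a4] := nrm_hex (L i) (f i).2.+1.
  rewrite !inE /t /m => /or3P[]/eqP->; clear - e a1 a2 a3 a4; lia.
have in_box i v : v \in [:: t i; m i; L i] -> v \in box n.
  move=> /near_nrm /andP[_ h]; rewrite mem_box (leq_trans h) // /n !ltnS leq_mul2l.
  by rewrite ltnW.
have bt i : t i \in box n by apply: (in_box i); rewrite !inE eqxx.
have bm i : m i \in box n by apply: (in_box i); rewrite !inE eqxx orbT.
have bL i : L i \in box n by apply: (in_box i); rewrite !inE eqxx !orbT.
have um i : ~ (u (m i) <= 0) by case: (hf i).
have uL i : ~ (u (L i) <= 0) by case: (hf i).
have big v : v \in box n -> ~ (u v <= 0) -> G <= expR (u v) by move=> /gap[].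
have G2 : 0 < G / 2 by lra.
have bis i : exists b : plane, [/\ `|b.1| <= 2, `|b.2| <= 2,
     k / 2 * Num.sqrt (sqn (psi (m i) - psi (t i))) <= det2 (psi (m i) - psi (t i)) b,
     k / 2 * Num.sqrt (sqn (psi (L i) - psi (t i))) <= det2 b (psi (L i) - psi (t i)) &
     G / 2 <= Num.sqrt (sqn (psi (m i) - psi (t i))) /\
     G / 2 <= Num.sqrt (sqn (psi (L i) - psi (t i)))].
  have X := h1 (t i) (f i).2.+2; rewrite -mE sqdE /len2 -mE in X.
  have Y := h1 (t i) (f i).2.+3; rewrite -LE sqdE /len2 -LE in Y.
  have Z := h1 (L i) (f i).2.+1; rewrite -/(m i) sqdE /len2 -/(m i) in Z.
  have Z' : `|sqn (psi (m i) - psi (L i)) - (expR (u (m i)) ^+ 2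
      + expR (u (L i)) ^+ 2 + 2 * expR (u (m i)) * expR (u (L i)) * p (f i).2.+1)| < 1.
    have -> : expR (u (m i)) ^+ 2 + expR (u (L i)) ^+ 2
        + 2 * expR (u (m i)) * expR (u (L i)) * p (f i).2.+1 =
      expR (u (L i)) ^+ 2 + expR (u (m i)) ^+ 2
        + 2 * expR (u (L i)) * expR (u (m i)) * p (f i).2.+1 by ring.
    exact: Z.
  have rt : 0 < expR (u (t i)) <= 1.
    by rewrite expR_gt0 -expR0 ler_expR; case: (Tsub _ (Tt i)).
  have [g1 g2 g3] := large_angle hk P1 hG rt (big _ (bm i) (um i))
    (big _ (bL i) (uL i)) (pP _) (pP _) (hkP _).1 (X (bt i) (bm i))
    (Y (bt i) (bL i)) Z'.
  set A := psi (m i) - psi (t i) in g1 g3 *.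
  set A' := psi (L i) - psi (t i) in g2 g3 *.
  have sq (w : plane) : (G / 2) ^+ 2 <= sqn w -> G / 2 <= Num.sqrt (sqn w) /\ 0 < sqn w.
    move=> h; split; first by rewrite -(ger0_norm (ltW G2)) -sqrtr_sqr ler_wsqrtr.
    by apply: lt_le_trans h; rewrite exprn_gt0.
  have [s1 s1'] := sq _ g1; have [s2 s2'] := sq _ g2.
  have [|b [b1 b2 b3 b4]] := bisector (k := k / 2) s1' s2'.
    apply: le_trans g3; rewrite le_eqVlt; apply/orP; left; apply/eqP.
    by rewrite /dot2 /sqn /A /A' /=; field.
  by exists b; split.
have [b hb] := choice bis.
have [|i [j [ij close]]] := pig (fun i s => if s == ord0 then (b i).1 else (b i).2).
  by move=> i s; case: ifP => _; case: (hb i).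
(* The margin is [k / 2] times a side of length at least [G / 2]. Changing the bisector costs
   [k / 8] times that side, moving the apex within the tiny component at most [8 * delta]. *)
have cone q : (`|(b i - b q).1| <= k / 16 /\ `|(b i - b q).2| <= k / 16) ->
    forall x, T x -> in_cone (b i) (psi (m q)) (psi (L q)) (psi x).
  move=> [c1 c2] x Tx; have [b1 b2 _ _ _] := hb i.
  have [_ _ b3 b4 [r1 r2]] := hb q.
  have [x1 x2] := Tb _ Tx; have [y1 y2] := Tb _ (Tt q).
  have D : `|(psi (t q) - psi x).1| <= 2 * delta /\ `|(psi (t q) - psi x).2| <= 2 * delta.
    have e : psi (t q) - psi x = (psi (t q) - psi 0) - (psi x - psi 0).
      by rewrite opprB addrA subrK.
    rewrite e; split; apply: le_trans (ler_normB _ _) _; lra.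
  have e1 := det2_norm D.1 D.2 b1 b2.
  have key (A : plane) : G / 2 <= Num.sqrt (sqn A) ->
      `|det2 A (b i - b q)| <= Num.sqrt (sqn A) * (k / 8).
    move=> _; have [a1 a2] := sqn_bound A.
    by apply: le_trans (det2_norm a1 a2 c1 c2) _; lra.
  have fin (A : plane) : G / 2 <= Num.sqrt (sqn A) ->
     8 * delta < k / 2 * Num.sqrt (sqn A) - Num.sqrt (sqn A) * (k / 8).
    move=> h; have : k * (G / 2) <= k * Num.sqrt (sqn A) by rewrite ler_wpM2l // ltW.
    by move: hG2; rewrite -/delta; lra.
  have k1' := key _ r1; have k2' := key _ r2.
  have f1 := fin _ r1; have f2 := fin _ r2.
  move: e1 k1' k2'; rewrite !ler_norml => /andP[e1 e1'] /andP[k3 k3'] /andP[k4 k4'].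
  split.
    have -> : det2 (psi (m q) - psi x) (b i) =
       det2 (psi (m q) - psi (t q)) (b q) + det2 (psi (m q) - psi (t q)) (b i - b q)
       + det2 (psi (t q) - psi x) (b i) by rewrite /det2 /=; ring.
    by clear - e1 k3 b3 f1; lra.
  have -> : det2 (b i) (psi (L q) - psi x) =
       det2 (b q) (psi (L q) - psi (t q)) - det2 (psi (L q) - psi (t q)) (b i - b q)
       - det2 (psi (t q) - psi x) (b i) by rewrite /det2 /=; ring.
  by clear - e1' k4' b4 f2; lra.
have ci := cone i; have cj := cone j.
have {}ci : forall x, T x -> in_cone (b i) (psi (m i)) (psi (L i)) (psi x).
  by apply: ci; rewrite !subrr /= normr0; split; lra.
have {}cj : forall x, T x -> in_cone (b i) (psi (m j)) (psi (L j)) (psi x).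
  by apply: cj; split; [have := close ord0|have := close ord_max] => /= /ltW.
have side q : (forall x, T x -> in_cone (b i) (psi (m q)) (psi (L q)) (psi x)) ->
    forall x, T x -> 0 < det2 (psi (m q) - psi x) (psi (L q) - psi x).
  move=> cq; have S := tiny_same_side h3 u0 (bL q) (bm q) (uL q) (um q) cq.
  have st : 0 < det2 (psi (m q) - psi (t q)) (psi (L q) - psi (t q)).
    have := h2 (t q) (f q).2.+2; rewrite -mE -LE; apply; [exact: bt|exact: bm|exact: bL].
  by move=> x Tx; apply/(S x Tx)/(S _ (Tt q)).
have [z [z1 z2]] := triangles_meet (ci _ (Tt i)) (ci _ (Tt j)) (cj _ (Tt i))
  (cj _ (Tt j)) (side _ ci _ (Tt i)) (side _ ci _ (Tt j)) (side _ cj _ (Tt i))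
  (side _ cj _ (Tt j)).
have simp q : simplex (t q) (m q) (L q).
  by rewrite mE LE; apply: simplex_face.
apply: (h3 (t i) (m i) (L i) (t j) (m j) (L j) _ _ _ _ z z1 z2) => //.
  move=> v; rewrite -[[:: t i; _; _; _; _; _]]/([:: t i; m i; L i] ++ [:: t j; m j; L j]).
  by rewrite mem_cat => /orP[]; apply: in_box.
move=> v vi; apply/negP => vj; have a1 := near_nrm _ _ vi; have a2 := near_nrm _ _ vj.
by move/eqP: ij; apply; apply: val_inj => /=; clear - a1 a2; lia.
Qed.

(** The box has [K] vertices, so among [K + 1] successive intervals of length [ln G] above the label
    of [v] one contains no label of the box. With its lower end moved to 0, every circle in the box
    is tiny or large, and a too large increment puts the neighbour beyond the gap. *)
Lemma ratio_bounded : exists M : R, forall u, flat_label p u ->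
  embeddable_label p u -> forall v t, u (v + hex_dir t) - u v <= M.
Proof.
have [k [P [hk P1 hkP]]] := weight_bounds p3 pN1.
have /andP[k0 k1] := hk.
have [|N pig] := @pigeonhole_box R 2 2 (k / 16); first by lra.
pose n := (3 * N).+3; pose K := size (box n).
pose G := (8 * (3 + 2 * P) + 64 * (K%:R * (3 + 2 * P)) + 1) / k.
have K0 : 0 <= K%:R * (3 + 2 * P) by rewrite mulr_ge0 //; lra.
have kG : k * G = 8 * (3 + 2 * P) + 64 * (K%:R * (3 + 2 * P)) + 1.
  by rewrite /G mulrCA mulfV ?lt0r_neq0 // mulr1.
have G1 : 1 < G by rewrite /G ltr_pdivlMr //; lra.
pose g := ln G; have g0 : 0 < g by rewrite ln_gt0.
exists (K.+1%:R * g) => u fu emb v t.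
rewrite leNgt; apply/negP => hM.
pose u1 x := u (v + x).
have fu1 : flat_label p u1 by apply: flat_label_translate.
have eu1 : embeddable_label p u1 by apply: embeddable_label_translate.
have [i [iK gap]] := gap_threshold (map u1 (box n)) (u1 0) g0.
rewrite size_map -/K in iK.
pose a := - (u1 0 + i%:R * g).
have gE : expR g = G by rewrite lnK // posrE; lra.
have iG : i.+1%:R * g = i%:R * g + g by rewrite -natr1 mulrDl mul1r.
have ig0 : 0 <= i%:R * g by rewrite mulr_ge0 // ltW.
have iM : i.+1%:R * g <= K.+1%:R * g by rewrite ler_wpM2r ?ler_nat // ltW.
apply: (@no_tiny_large k P N (fun x => u1 x + a) G t hk P1 hkP pig).
- by rewrite kG; lra.
- by rewrite kG -/n -/K; lra.
- exact: flat_label_add.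
- exact: embeddable_label_add.
- move=> x xb; have [|h|h] := gap (u1 x); first exact: map_f.
    by left; rewrite /a; lra.
  by right; rewrite -gE ler_expR /a; lra.
- by rewrite /a; lra.
by rewrite -gE ler_expR /a /u1 addr0; lra.
Qed.

End RatioBounded.

(** * Limits of labels *)

Lemma near_all (U : set_system nat) (FU : Filter U) (T : eqType) (s : seq T)
    (Q : T -> nat -> Prop) :
  (forall z : T, \forall n \near U, Q z n) ->
  \forall n \near U, forall z : T, z \in s -> Q z n.
Proof.
move=> h; elim: s => [|a s IH]; first exact: filterE.
apply: filterS2 (h a) IH => n h1 h2 z; rewrite inE => /predU1P[->//|]; exact: h2.
Qed.

Section UltraLimits.
Variables (R : realType) (U : set_system nat).
Context {UU : UltraFilter U}.
Hypothesis Uoo : \oo `<=` U.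
Implicit Types (x y : nat -> R) (a b l : R).

(** Along one fixed ultrafilter all bounded sequences converge, which replaces a diagonal extraction
    over the vertices. *)
Lemma ulim_exists x (C : R) : (\forall n \near U, `|x n| <= C) ->
  exists l, x n @[n --> U] --> l.
Proof.
move=> hx; have F : U (x @^-1` `[-C, C]).
  by apply: filterS hx => n /=; rewrite in_itv /= -ler_norml.
have [l [_ cl]] := @segment_compact R (-C) C (x @ U) _ F.
exists l => V Vl; have [//|h] := in_ultra_setVsetC (x @^-1` V) UU.
by have [z [z1 z2]] := cl (~` V) V h Vl.
Qed.

Lemma ulimC a : (fun _ : nat => a) n @[n --> U] --> a.
Proof. exact: cvg_cst. Qed.

Lemma ulimD x y a b : x n @[n --> U] --> a -> y n @[n --> U] --> b ->
  x n + y n @[n --> U] --> a + b.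
Proof. by move=> h1 h2; apply: cvgD. Qed.

Lemma ulimN x a : x n @[n --> U] --> a -> - x n @[n --> U] --> - a.
Proof. by move=> h1; apply: cvgN. Qed.

Lemma ulimM x y a b : x n @[n --> U] --> a -> y n @[n --> U] --> b ->
  x n * y n @[n --> U] --> a * b.
Proof. by move=> h1 h2; apply: cvgM. Qed.

Lemma ulimX x a k : x n @[n --> U] --> a -> x n ^+ k @[n --> U] --> a ^+ k.
Proof.
move=> h; elim: k => [|k IH]; first by rewrite expr0; apply: ulimC.
rewrite exprS; apply: cvg_trans (ulimM h IH).
by apply: near_eq_cvg; apply: filterE => n; rewrite exprS.
Qed.

Lemma ulimV x a : a != 0 -> x n @[n --> U] --> a -> (x n)^-1 @[n --> U] --> a^-1.
Proof. by move=> a0 h; apply: cvgV. Qed.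

Lemma ulim_sqrt x a : x n @[n --> U] --> a ->
  Num.sqrt (x n) @[n --> U] --> Num.sqrt a.
Proof. by move=> h; apply: continuous_cvg => //; apply: sqrt_continuous. Qed.

Lemma ulim_expR x a : x n @[n --> U] --> a -> expR (x n) @[n --> U] --> expR a.
Proof. by move=> h; apply: continuous_cvg => //; apply: continuous_expR. Qed.

Lemma ulim_ge0 x a : x n @[n --> U] --> a -> (forall n, 0 <= x n) -> 0 <= a.
Proof.
move=> h x0; rewrite leNgt; apply/negP => a0.
have /filter_ex[n] : \forall n \near U, x n < 0 by exact: (cvgr_lt _ h).
by rewrite ltNge x0.
Qed.

Lemma ulim_near x a (e : R) : x n @[n --> U] --> a -> 0 < e ->
  \forall n \near U, `|x n - a| < e.
Proof.
move=> h e0; have /cvgrPdist_lt/(_ e e0) := h.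
by apply: filterS => n; rewrite distrC.
Qed.

Lemma ulim_unique x a b : x n @[n --> U] --> a -> x n @[n --> U] --> b -> a = b.
Proof. by move=> h1 h2; apply: (cvg_unique _ h1 h2). Qed.

Lemma ulim_shrink (f : nat -> R) l : (forall n, l - n.+1%:R^-1 <= f n <= l) ->
  f n @[n --> U] --> l.
Proof.
move=> h; apply/cvgrPdist_lt => e e0; apply: Uoo.
have [N _ hN] := near_infty_natSinv_lt (PosNum e0).
exists N => // n Nn /=; have := hN n Nn; have := h n; rewrite /=.
move=> /andP[h1 h2] h3; rewrite ger0_norm ?subr_ge0 //.
by apply: le_lt_trans h3; rewrite lerBlDr -lerBlDl.
Qed.

(** The end points, where degenerate faces sit, are included: a limit of the angles exists by
    boundedness and is identified by its cosine. *)
Lemma ulim_acos x a : (forall n, -1 <= x n <= 1) -> x n @[n --> U] --> a ->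
  acos (x n) @[n --> U] --> acos a.
Proof.
move=> hx h; have [|l hl] := @ulim_exists (fun n => acos (x n)) pi.
  by apply: filterE => n; rewrite ger0_norm ?acos_ge0 ?acos_lepi.
have hc : cos (acos (x n)) @[n --> U] --> cos l.
  by apply: continuous_cvg hl; apply: continuous_cos.
have hc' : x n @[n --> U] --> cos l.
  apply: cvg_trans hc; apply: near_eq_cvg; apply: filterE => n.
  by rewrite acosK // in_itv /= hx.
have l0 : 0 <= l by apply: (ulim_ge0 hl) => n; exact: acos_ge0 (hx n).
have lpi : 0 <= pi - l.
  have h1 := ulimD (@ulimC pi) (ulimN hl); apply: (ulim_ge0 h1) => n.
  by rewrite subr_ge0; apply: acos_lepi; apply: hx.
by rewrite (ulim_unique h hc') cosK // in_itv /= l0 -subr_ge0.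
Qed.

Section Labels.
Variable p : nat -> R.
Hypothesis p3 : forall t, p t.+3 = p t.
Hypothesis pN1 : forall t, -1 < p t.
Variables (w : nat -> vertex -> R) (w' : vertex -> R).
Hypothesis lim_w : forall v, w n v @[n --> U] --> w' v.

Lemma ulim_rratio v t : rratio (w n) v t @[n --> U] --> rratio w' v t.
Proof. by apply: ulim_expR; apply: ulimD => //; apply: ulimN. Qed.

Arguments ulim_rratio : clear implicits.

Lemma ulim_zz q (s : nat -> R) s' : s n @[n --> U] --> s' ->
  zz q (s n) @[n --> U] --> zz q s'.
Proof.
move=> h; rewrite /zz; apply: ulimD; first by apply: ulimD; [exact: ulimC|exact: ulimX].
by apply: ulimM; [apply: ulimM => //; exact: ulimC|exact: ulimC].
Qed.

Lemma ulim_NN q1 q2 q3 (s t : nat -> R) s' t' : s n @[n --> U] --> s' ->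
  t n @[n --> U] --> t' -> NN q1 q2 q3 (s n) (t n) @[n --> U] --> NN q1 q2 q3 s' t'.
Proof.
move=> h1 h2; rewrite /NN; apply: ulimD; last exact: ulimC.
apply: ulimD; last by apply: ulimM => //; exact: ulimC.
by apply: ulimD; apply: ulimM => //; exact: ulimC.
Qed.

Lemma ulim_DD q1 q2 q3 (s t : nat -> R) s' t' : s n @[n --> U] --> s' ->
  t n @[n --> U] --> t' -> DD q1 q2 q3 (s n) (t n) @[n --> U] --> DD q1 q2 q3 s' t'.
Proof.
move=> h1 h2; rewrite /DD; apply: ulimD; first by apply: ulimM; apply: ulim_zz.
by apply/ulimN/ulimX/ulim_NN.
Qed.

Lemma ulim_mm q1 q2 q3 (s t : nat -> R) s' t' : s n @[n --> U] --> s' ->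
  t n @[n --> U] --> t' -> 0 < QQ q1 q2 q3 s' t' ->
  mm q1 q2 q3 (s n) (t n) @[n --> U] --> mm q1 q2 q3 s' t'.
Proof.
move=> h1 h2 Q0; rewrite /mm /hnum.
have aff q (x : nat -> R) a : x n @[n --> U] --> a -> x n + q @[n --> U] --> a + q.
  by move=> h; apply: ulimD => //; exact: ulimC.
have hs := aff q1 _ _ h1; have ht := aff q2 _ _ h2.
apply: ulimM.
  by apply: ulimD; apply: ulimM => //; exact: ulimC.
apply: ulimV; first by rewrite lt0r_neq0 // sqrtr_gt0.
apply: ulim_sqrt; rewrite /QQ; apply: ulimD; last first.
  by apply: ulimM; [exact: ulimC|exact: ulimX].
apply: ulimD; first by apply: ulimM; [exact: ulimC|exact: ulimX].
by apply: ulimM => //; apply: ulimM => //; exact: ulimC.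
Qed.

Lemma flat_label_lim : (forall n, flat_label p (w n)) -> flat_label p w'.
Proof.
move=> fw.
have s0 v t : 0 < rratio w' v t by apply: expR_gt0.
have D v : star_nonneg p (rratio w' v).
  move=> t.
  have h := @ulim_DD (p t) (p t.+1) (p t.+2) _ _ _ _ (ulim_rratio v t) (ulim_rratio v t.+1).
  by apply: (ulim_ge0 h) => n; case: (fw n) => D _ _; apply: D.
split=> //.
- move=> v.
  have A t : star_angle p (rratio (w n) v) t @[n --> U] -->
      star_angle p (rratio w' v) t.
    rewrite /star_angle /ang; apply: ulim_acos.
      move=> n; apply: DD_cos_bound; try by apply: zz_gt0 => //; apply: expR_gt0.
      by case: (fw n) => D' _ _; apply: D'.
    apply: ulimM; first by apply: ulim_NN; apply: ulim_rratio.
    apply: ulimV.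
      by rewrite mulf_neq0 // lt0r_neq0 // sqrtr_gt0; apply: zz_gt0.
    by apply: ulimM; apply: ulim_sqrt; apply: ulim_zz; apply: ulim_rratio.
  have S : \sum_(t < 6) star_angle p (rratio (w n) v) t @[n --> U] -->
      \sum_(t < 6) star_angle p (rratio w' v) t.
    rewrite !big_ord_recr big_ord0 /=.
    under eq_cvg do rewrite !big_ord_recr big_ord0 /=.
    by do 6 (apply: ulimD; last exact: A); exact: ulimC.
  apply: (ulim_unique S); apply: cvg_trans (@ulimC (2 * pi)).
  by apply: near_eq_cvg; apply: filterE => n; case: (fw n) => _ ->.
move=> wl v t.
(* The denominators of [mm] stay positive in the limit even if a face degenerates there. *)
have Q1 := QQ_gt0 (wl t).2 (D v t).
have Q2 : 0 < QQ (p t) (p t.+2) (p t.+1) (rratio w' v t) (rratio w' v (t + 5)).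
  rewrite -QQC; have := wl t.+2; rewrite !p3 => -[_ G].
  have := D v (t + 5)%N.
  have e i : p (t + 5 + i)%N = p (t + 2 + i)%N.
    by rewrite -(p3 (t + 2 + i)); congr p; lia.
  have := e 0; have := e 1%N; have := e 2%N.
  rewrite !addn0 !addn1 !addn2 p3 => -> -> ->.
  have -> : rratio w' v (t + 5).+1 = rratio w' v t.
    by rewrite -addnS /rratio hex_dir6.
  by rewrite p3 => h; exact: QQ_gt0 G h.
have h := ulimD (ulim_mm (ulim_rratio v t) (ulim_rratio v t.+1) Q1)
   (ulim_mm (ulim_rratio v t) (ulim_rratio v (t + 5)%N) Q2).
by apply: (ulim_ge0 h) => n; case: (fw n) => _ _ del; apply: del.
Qed.

Lemma embeddable_label_lim :
  (forall n, embeddable_label p (w n)) -> embeddable_label p w'.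
Proof.
move=> ew F eps e0; have e2 : 0 < eps / 2 by lra.
have L v t : len2 p (w n) v t @[n --> U] --> len2 p w' v t.
  rewrite /len2; apply: ulimD.
    by apply: ulimD; apply: ulimX; apply: ulim_expR.
  apply: ulimM; last exact: ulimC.
  apply: ulimM; last by apply: ulim_expR.
  by apply: ulimM; [exact: ulimC|apply: ulim_expR].
have pm t : p (t %% 6) = p t.
  elim/ltn_ind: t => t IH; have [t6|t6] := ltnP t 6; first by rewrite modn_small.
  rewrite -(subnK t6) modnDr IH ?ltn_subrL ?(leq_trans _ t6) //.
  by rewrite !addnS addn0 !p3.
have [n hn] := filter_ex (near_all _ F (fun v => near_all _ (iota 0 6)
   (fun t => ulim_near (L v t) e2))).
have [psi [h1 h2 h3]] := ew n F _ e2; exists psi; split=> // v t vF wF.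
have := h1 v t vF wF; have := hn v vF (t %% 6)%N.
rewrite mem_iota ltn_mod /= => /(_ isT).
have lm (z : vertex -> R) : len2 p z v (t %% 6) = len2 p z v t by rewrite /len2 hex_dir_mod pm.
rewrite !lm !ltr_norml; lra.
Qed.

End Labels.
End UltraLimits.

(** * Translation limits and reduction to linear labels *)

Section TranslationLimits.
Variables (R : realType) (p : nat -> R).
Hypothesis p3 : forall t, p t.+3 = p t.
Hypothesis wp : weights_small p \/ weights_large p.
Hypothesis pN1 : forall t, -1 < p t.
Hypothesis acute : forall t, p t <= 1 + p t.+1 + p t.+2.
Implicit Types u : vertex -> R.

Lemma lipschitz_bound u (M : R) : (forall v t, u (v + hex_dir t) - u v <= M) ->
  forall x, exists C, forall v, `|u (v + x) - u v| <= C.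
Proof.
move=> hM; elim/hex_ind => [|x t [C hC]].
  by exists 0 => v; rewrite addr0 subrr normr0.
exists (C + M) => v; have -> : u (v + (x + hex_dir t)) - u v =
  (u (v + x) - u v) + (u (v + x + hex_dir t) - u (v + x)) by rewrite addrA; ring.
apply: le_trans (ler_normD _ _) _; apply: lerD => //.
rewrite ler_norml hM andbT.
by have := hM (v + x + hex_dir t) t.+3; rewrite hex_dirN addrK; lra.
Qed.

(* Recenter where the increment in direction t is nearly maximal; in the limit
   the increment is maximal at the origin, hence constant. *)
Lemma translation_limit u t : flat_label p u -> embeddable_label p u ->
  exists S u', [/\ flat_label p u', embeddable_label p u',
    forall v, u' (v + hex_dir t) = u' v + S,
    forall v, u (v + hex_dir t) <= u v + S &
    forall i C, (forall v, u (v + hex_dir i) = u v + C) ->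
      forall v, u' (v + hex_dir i) = u' v + C].
Proof.
move=> fu eu.
have PF : ProperFilter (\oo : set_system nat) by exact: _.
have [U [UU Uoo]] := ultraFilterLemma PF.
have [M hM] := ratio_bounded p3 wp pN1 acute.
have {}hM := hM u fu eu.
pose E := [set u (v + hex_dir t) - u v | v in setT].
have hsE : has_sup E.
  by split; [exists (u (0 + hex_dir t) - u 0), 0|exists M => _ [v _ <-]].
pose S := sup E.
have ubS v : u (v + hex_dir t) - u v <= S.
  by apply: (sup_upper_bound hsE); exists v.
have near_sup (n : nat) : exists v, S - n.+1%:R^-1 < u (v + hex_dir t) - u v.
  have n0 : 0 < n.+1%:R^-1 :> R by rewrite invr_gt0.
  by have [_ [v _ <-] h] := sup_adherent n0 hsE; exists v.
have [c hc] := choice near_sup.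
pose w n v := u (c n + v) - u (c n).
have bound (v : vertex) : exists l : R, w n v @[n --> U] --> l.
  have [C hC] := lipschitz_bound hM v.
  by apply: (@ulim_exists R U UU (fun n => w n v) C); apply: filterE => n; apply: hC.
have [w' hw'] := choice bound.
have fw n : flat_label p (w n).
  exact: (@flat_label_add _ p (fun v => u (c n + v)) (- u (c n))
           (flat_label_translate _ fu)).
have ew n : embeddable_label p (w n).
  exact: (@embeddable_label_add _ p (fun v => u (c n + v)) (- u (c n))
           (embeddable_label_translate _ eu)).
have fw' : flat_label p w' by apply: flat_label_lim hw' fw.
have ew' : embeddable_label p w' by apply: embeddable_label_lim hw' ew.
have incr v i : w n (v + hex_dir i) - w n v @[n --> U] -->
    w' (v + hex_dir i) - w' v.
  exact: (ulimD (hw' _) (ulimN (hw' _))).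
have incrE n v i : w n (v + hex_dir i) - w n v =
    u (c n + v + hex_dir i) - u (c n + v) by rewrite /w addrA; ring.
have max0 : w' (0 + hex_dir t) - w' 0 = S.
  apply: (ulim_unique (incr 0 t)); apply: ulim_shrink => // n.
  by rewrite incrE addr0 ubS ltW.
have le_S v : w' (v + hex_dir t) <= w' v + S.
  have h : 0 <= S - (w' (v + hex_dir t) - w' v).
    apply: (ulim_ge0 (ulimD (@ulimC R U UU S) (ulimN (incr v t)))) => n.
    by rewrite /= incrE subr_ge0.
  by lra.
exists S, w'; split=> //.
(* The translate lowered by [S] lies below [w'] and touches it at the origin; by the maximum
   principle the contact spreads to all vertices. *)
- pose w'' v := w' (hex_dir t + v) + - S.
  have fw'' : flat_label p w''.
    have h := flat_label_add (- S) (flat_label_translate (hex_dir t) fw').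
    exact: h.
  have le'' v : w'' v <= w' v.
    by rewrite /w'' [hex_dir t + v]addrC; have := le_S v; lra.
  suff h v : w'' v = w' v.
    by move=> v; rewrite -(h v) /w'' [hex_dir t + v]addrC; lra.
  elim/hex_ind: v => [|v i IH].
    by rewrite /w'' [hex_dir t + 0]addrC; move: max0; lra.
  exact: (flat_label_rigid p3 wp fw' fw'' IH (fun s => le'' _)).
- by move=> v; have := ubS v; lra.
move=> i C hC v; have -> : C = w' (v + hex_dir i) - w' v; last by lra.
apply/esym/(ulim_unique (incr v i)); apply: cvg_trans (@ulimC R U UU C).
apply: near_eq_cvg; apply: filterE => n.
by rewrite incrE hC; ring.
Qed.

(** Limits are taken in directions [t], 0 and 1 in turn; each keeps the increments already constant.
    The last label is linear, so [S] vanishes and [u] does not increase in direction [t]; the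
    opposite direction gives equality. *)
Lemma constant_of_linear :
  (forall u S S', flat_label p u -> embeddable_label p u ->
     (forall v, u (v + hex_dir 0) = u v + S) ->
     (forall v, u (v + hex_dir 1) = u v + S') -> S = 0 /\ S' = 0) ->
  forall u, flat_label p u -> embeddable_label p u -> forall v v', u v = u v'.
Proof.
move=> lin u fu eu.
have le0 t v : u (v + hex_dir t) <= u v.
  have [S [u1 [f1 e1 h1 hS _]]] := translation_limit t fu eu.
  have [S0 [u2 [f2 e2 h2 _ k2]]] := translation_limit 0 f1 e1.
  have [S1 [u3 [f3 e3 h3 _ k3]]] := translation_limit 1 f2 e2.
  have {h2} h2 := k3 _ _ h2; have {h1} h1 := k3 _ _ (k2 _ _ h1).
  have [z0 z1] := lin _ _ _ f3 e3 h2 h3.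
  have period x : u3 x = u3 0.
    by apply: hex_period => y; [rewrite h2 z0 addr0|rewrite h3 z1 addr0].
  by have := hS v; have := h1 0; rewrite !period; lra.
have eq0 t v : u (v + hex_dir t) = u v.
  apply/eqP; rewrite eq_le le0 /=.
  by have := le0 t.+3 (v + hex_dir t); rewrite hex_dirN addrK.
have u0 v : u v = u 0 by elim/hex_ind: v => // v t <-.
by move=> v v'; rewrite u0 (u0 v').
Qed.

End TranslationLimits.

(** * Layouts of linear labels *)

Section DegenerateTriangles.
Variable R : realType.

Lemma hnumE (p q c s t : R) :
  hnum p q c s t = zz p s * (t + q) - (s + p) * NN p q c s t.
Proof. by rewrite /hnum /zz /NN; ring. Qed.

(* The radical axis of the circles i and j meets the line between those of the
   pairs i, k and k, j, so it is farther from i than the one of i and k. *)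
Lemma between_neg (ri rj rk p q c x m n : R) : 0 < ri -> 0 < rj -> 0 < rk ->
  0 <= p -> 0 <= q -> 0 <= c -> 0 < x -> 0 < m -> 0 < n ->
  x ^+ 2 = ri ^+ 2 + rj ^+ 2 + 2 * ri * rj * p ->
  m ^+ 2 = ri ^+ 2 + rk ^+ 2 + 2 * ri * rk * q ->
  n ^+ 2 = rj ^+ 2 + rk ^+ 2 + 2 * rj * rk * c ->
  x = m + n -> hnum p q c (ri / rj) (ri / rk) < 0.
Proof.
move=> i0 j0 k0 p0 q0 c0 x0 m0 n0 ex em en xmn.
have [in0 jn0 kn0] := And3 (lt0r_neq0 i0) (lt0r_neq0 j0) (lt0r_neq0 k0).
have pE : p = (x ^+ 2 - ri ^+ 2 - rj ^+ 2) / (2 * ri * rj).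
  by rewrite ex; field; rewrite in0 jn0.
have qE : q = (m ^+ 2 - ri ^+ 2 - rk ^+ 2) / (2 * ri * rk).
  by rewrite em; field; rewrite in0 kn0.
have cE : c = (n ^+ 2 - rj ^+ 2 - rk ^+ 2) / (2 * rj * rk).
  by rewrite en; field; rewrite jn0 kn0.
have -> : hnum p q c (ri / rj) (ri / rk) = - (x / (2 * ri * rj ^+ 2 * rk) *
    (n * (m ^+ 2 + rk ^+ 2 - ri ^+ 2) + m * (n ^+ 2 + rk ^+ 2 - rj ^+ 2))).
  by rewrite hnumE /zz /NN pE qE cE xmn; field; rewrite in0 jn0 kn0.
rewrite oppr_lt0 mulr_gt0 //.
  by rewrite divr_gt0 // !mulr_gt0 // exprn_gt0.
have rq : 0 <= ri * rk * q by rewrite !mulr_ge0 // ltW.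
have rc : 0 <= rj * rk * c by rewrite !mulr_ge0 // ltW.
have rk2 : 0 < rk ^+ 2 by rewrite exprn_gt0.
by rewrite addr_gt0 // mulr_gt0 //; [rewrite em|rewrite en]; lra.
Qed.

(** Sharpens [DD_ge0_mono]: regularity makes [hnum] positive, and [t * hnum] is one of the terms. *)
Lemma DD_gt0_small (p q c s t : R) : small_weights p q c ->
  ~ (p = 1 /\ q = - c) -> 0 < s -> 0 < t -> 0 < DD p q c s t.
Proof.
move=> sw reg s0 t0; have h := hnum_gt0 sw reg s0 t0.
have [hp hq hc [gp gq gc]] := sw.
have -> : DD p q c s t = t * hnum p q c s t
    + s * ((1 - q ^+ 2) * s + (c + p * q) * t + (p + q * c))
    + (1 - c ^+ 2) + (p + q * c) * s + (q + p * c) * t.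
  by rewrite /DD /hnum /zz /NN; ring.
have a1 := mulr_gt0 t0 h.
have a2 : 0 <= (1 - q ^+ 2) * s by rewrite mulr_ge0 ?one_sub_sqr_ge0 // ltW.
have a3 : 0 <= (c + p * q) * t by rewrite mulr_ge0 // ltW.
have a4 : 0 <= s * ((1 - q ^+ 2) * s + (c + p * q) * t + (p + q * c)).
  by apply: mulr_ge0; [exact: ltW|rewrite addr_ge0 // addr_ge0].
have a5 := one_sub_sqr_ge0 hc.
have a6 : 0 <= (p + q * c) * s by rewrite mulr_ge0 // ltW.
have a7 : 0 <= (q + p * c) * t by rewrite mulr_ge0 // ltW.
by clear - a1 a4 a5 a6 a7; lra.
Qed.

End DegenerateTriangles.

(** * Strips of triangles across an axis *)

Section Strips.
Variable R : realType.
Local Notation plane := (R * R)%type.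
Implicit Types l m x y z P Q S : plane.

Lemma seg_sub P Q x z : seg P Q x -> seg x Q z -> seg P Q z.
Proof.
case=> a [/andP[a0 a1] ->] [c [/andP[c0 c1] ->]] /=.
exists (1 - (1 - c) * (1 - a)); split; last by congr pair; ring.
by clear - a0 a1 c0 c1; apply/andP; split; nra.
Qed.

(** For [m] to the left and [l] to the right of the vertical axis through [O], [height b l m O] is
    the ordinate where the segment joining them crosses the axis. *)
Let b : plane := (0, 1).
Let O : plane := (0, 0).

Lemma in_coneE l m x : m.1 < x.1 -> x.1 < l.1 -> in_cone b l m x.
Proof. by move=> h1 h2; split; rewrite /det2 /b /=; lra. Qed.

Lemma height_O l m : m.1 < 0 -> 0 < l.1 -> seg l m (0, height b l m O).
Proof.
move=> m0 l0; have := height_seg (in_coneE (x := O) m0 l0).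
by rewrite /= mulr0 mulr1 !add0r.
Qed.

Lemma below_height l m (g : R) : m.1 < 0 -> 0 < l.1 ->
  (0 < det2 (l - (0, g)) (m - (0, g))) = (g < height b l m O).
Proof.
move=> m0 l0; have D0 : 0 < l.1 - m.1 by lra.
have -> : height b l m O = (l.1 * m.2 - l.2 * m.1) / (l.1 - m.1).
  by rewrite /height /det2 /b /O /=; congr (_ / _); ring.
rewrite ltr_pdivlMr // -[RHS]subr_gt0; congr (_ < _).
by rewrite /det2 /=; ring.
Qed.

Lemma height_lt_right l l' m : m.1 < 0 -> 0 < l.1 -> 0 < l'.1 ->
  0 < det2 (l' - l) (m - l) -> height b l m O < height b l' m O.
Proof.
move=> m0 l0 l0' h; have D0 : 0 < l.1 - m.1 by lra.
have D0' : 0 < l'.1 - m.1 by lra.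
have -> : height b l m O = (l.1 * m.2 - l.2 * m.1) / (l.1 - m.1).
  by rewrite /height /det2 /b /O /=; congr (_ / _); ring.
have -> : height b l' m O = (l'.1 * m.2 - l'.2 * m.1) / (l'.1 - m.1).
  by rewrite /height /det2 /b /O /=; congr (_ / _); ring.
rewrite ltr_pdivrMr // mulrAC ltr_pdivlMr // -subr_gt0.
have -> : (l'.1 * m.2 - l'.2 * m.1) * (l.1 - m.1) -
   (l.1 * m.2 - l.2 * m.1) * (l'.1 - m.1) = - m.1 * det2 (l' - l) (m - l).
  by rewrite /det2 /=; ring.
by rewrite mulr_gt0 // oppr_gt0.
Qed.

Lemma height_lt_left l m m' : m.1 < 0 -> m'.1 < 0 -> 0 < l.1 ->
  0 < det2 (m' - l) (m - l) -> height b l m O < height b l m' O.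
Proof.
move=> m0 m0' l0 h; have D0 : 0 < l.1 - m.1 by lra.
have D0' : 0 < l.1 - m'.1 by lra.
have -> : height b l m O = (l.1 * m.2 - l.2 * m.1) / (l.1 - m.1).
  by rewrite /height /det2 /b /O /=; congr (_ / _); ring.
have -> : height b l m' O = (l.1 * m'.2 - l.2 * m'.1) / (l.1 - m'.1).
  by rewrite /height /det2 /b /O /=; congr (_ / _); ring.
rewrite ltr_pdivrMr // mulrAC ltr_pdivlMr // -subr_gt0.
have -> : (l.1 * m'.2 - l.2 * m'.1) * (l.1 - m.1) -
   (l.1 * m.2 - l.2 * m.1) * (l.1 - m'.1) = l.1 * det2 (m' - l) (m - l).
  by rewrite /det2 /=; ring.
by rewrite mulr_gt0.
Qed.

Lemma seg_vertical (x g0 g g1 : R) : g0 <= g -> g <= g1 -> seg (x, g0) (x, g1) (x, g).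
Proof.
move=> h0 h1; have [e|ne] := eqVneq g0 g1.
  exists 0; split; first by rewrite lexx ler01.
  by congr pair; rewrite /=; lra.
have d : 0 < g1 - g0 by rewrite subr_gt0 lt_neqAle ne (le_trans h0 h1).
exists ((g - g0) / (g1 - g0)); split.
  apply/andP; split; first by apply: divr_ge0; lra.
  by rewrite ler_pdivrMr // mul1r; lra.
by congr pair => /=; field; rewrite lt0r_neq0.
Qed.

Lemma hull3_perm P Q S z : hull3 P Q S z -> hull3 Q S P z.
Proof.
case=> a [c [d [a0 c0 d0 e ->]]]; exists c, d, a; split=> //; first by lra.
by congr pair; ring.
Qed.

Lemma hull3_seg P Q S x y z : seg P Q x -> seg P S y -> seg x y z -> hull3 P Q S z.
Proof.
case=> a [/andP[a0 a1] ->] [c [/andP[c0 c1] ->]] [d [/andP[d0 d1] ->]] /=.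
exists (1 - (1 - d) * a - d * c), ((1 - d) * a), (d * c); split.
- have h1 : (1 - d) * a <= 1 - d by rewrite ler_piMr // subr_ge0.
  have h2 : d * c <= d by rewrite ler_piMr.
  by lra.
- by rewrite mulr_ge0 // subr_ge0.
- by rewrite mulr_ge0.
- by ring.
by congr pair; ring.
Qed.

Section OneStrip.
Variables (K : nat) (l m : nat -> plane).
Hypothesis l0 : forall i, 0 < (l i).1.
Hypothesis m0 : forall i, (m i).1 < 0.
Hypothesis o1 : forall i, (i < K)%N -> 0 < det2 (l i.+1 - l i) (m i - l i).
Hypothesis o2 : forall i, (i < K)%N ->
  0 < det2 (m i.+1 - l i.+1) (m i - l i.+1).
Let h i := height b (l i) (m i) O.

(** The rung moves in two steps, one end at a time; the positive orientation of the triangle swept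
    in each step pushes the crossing up. *)
Lemma strip_height_step i : (i < K)%N ->
  h i < height b (l i.+1) (m i) O < h i.+1.
Proof.
move=> iK; rewrite height_lt_right ?o1 //=.
by apply: height_lt_left; rewrite ?o2.
Qed.

Lemma strip_height_lt : (0 < K)%N -> h 0 < h K.
Proof.
move=> K0; have le k : (k < K)%N -> h 0 < h k.+1.
  elim: k => [|k IH] kK; have /andP[a1 a2] := strip_height_step kK.
    exact: lt_trans a1 a2.
  exact: lt_trans (IH (ltnW kK)) (lt_trans a1 a2).
by rewrite -(prednK K0); apply: le; rewrite prednK.
Qed.

Lemma strip_cover g : h 0 <= g -> g <= h K -> (0 < K)%N ->
  exists2 i, (i < K)%N & hull3 (l i) (l i.+1) (m i) (0, g) \/
                         hull3 (l i.+1) (m i.+1) (m i) (0, g).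
Proof.
move=> g0 gK K0.
have [i iK /andP[gi gi1]] : exists2 i, (i < K)%N & h i <= g <= h i.+1.
  have : forall k, (k <= K)%N -> g <= h k ->
      (exists2 i, (i < K)%N & h i <= g <= h i.+1) \/ g <= h 0.
    elim=> [|k IH] kK gk; first by right.
    have [g1|g1] := leP g (h k); first exact: IH (ltnW kK) g1.
    by left; exists k => //; rewrite gk ltW.
  case/(_ K (leqnn K) gK) => // g1; exists 0%N => //; rewrite g0 /=.
  by have /andP[a1 a2] := strip_height_step K0; rewrite (le_trans g1) // ltW // (lt_trans a1).
exists i => //; have [g1|g1] := leP g (height b (l i.+1) (m i) O).
  left; apply: hull3_perm.
  apply: (hull3_seg (x := (0, h i)) (y := (0, height b (l i.+1) (m i) O))).
  - exact/seg_sym/height_O.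
  - exact/seg_sym/height_O.
  - exact: seg_vertical.
right.
apply: (hull3_seg (x := (0, h i.+1)) (y := (0, height b (l i.+1) (m i) O))).
- exact: height_O.
- exact: height_O.
- by apply/seg_sym/seg_vertical; [exact: ltW|].
Qed.

End OneStrip.

(* Two strips spread over the origin, one above the other; the long end of the
   lower one separates the short ends, which a short path joins. *)
Lemma strips_contra (K : nat) (l m l' m' : nat -> plane) : (0 < K)%N ->
  (forall i, 0 < (l i).1) -> (forall i, (m i).1 < 0) ->
  (forall i, 0 < (l' i).1) -> (forall i, (m' i).1 < 0) ->
  (forall i, (i < K)%N -> 0 < det2 (l i.+1 - l i) (m i - l i)) ->
  (forall i, (i < K)%N -> 0 < det2 (m i.+1 - l i.+1) (m i - l i.+1)) ->
  (forall i, (i < K)%N -> 0 < det2 (l' i.+1 - l' i) (m' i - l' i)) ->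
  (forall i, (i < K)%N -> 0 < det2 (m' i.+1 - l' i.+1) (m' i - l' i.+1)) ->
  (m K).1 < (m 0).1 -> (l' 0).1 < (l K).1 ->
  (m' K).1 < (m 0).1 -> (l' 0).1 < (l' K).1 ->
  (forall i z, (i < K)%N -> hull3 (l i) (l i.+1) (m i) z \/
      hull3 (l i.+1) (m i.+1) (m i) z ->
    ~ seg (l' 0) (m' 0) z /\ ~ seg (l' K) (m' K) z) ->
  (forall i z, (i < K)%N -> hull3 (l' i) (l' i.+1) (m' i) z \/
      hull3 (l' i.+1) (m' i.+1) (m' i) z ->
    ~ seg (l 0) (m 0) z /\ ~ seg (l K) (m K) z) ->
  (forall z, seg (l K) (m K) z ->
    [/\ ~ seg (l 0) (m 0) z, ~ seg (m 0) (l' 0) z & ~ seg (l' 0) (m' 0) z]) ->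
  (forall z, seg (l' K) (m' K) z ->
    [/\ ~ seg (l 0) (m 0) z, ~ seg (m 0) (l' 0) z & ~ seg (l' 0) (m' 0) z]) ->
  False.
Proof.
move=> K0 l0 m0 l'0 m'0 o1 o2 o1' o2' w1 w2 w3 w4 dA dB eK e'K.
pose h i := height b (l i) (m i) O; pose h' i := height b (l' i) (m' i) O.
have hh : h 0 < h K := strip_height_lt l0 m0 o1 o2 K0.
have hh' : h' 0 < h' K := strip_height_lt l'0 m'0 o1' o2' K0.
have s i : seg (l i) (m i) (0, h i) by apply: height_O.
have s' i : seg (l' i) (m' i) (0, h' i) by apply: height_O.
(* The first strip covers the axis between [h 0] and [h K], so the rungs that avoid it cross the
   axis elsewhere. *)
have av0 : h' 0 < h 0 \/ h K < h' 0.
  have [|g1] := ltP (h' 0) (h 0); first by left.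
  have [|g2] := ltP (h K) (h' 0); first by right.
  have [i iK c] := strip_cover l0 m0 o1 o2 g1 g2 K0.
  by have [n _] := dA _ _ iK c; case: n.
have avK : h' K < h 0 \/ h K < h' K.
  have [|g1] := ltP (h' K) (h 0); first by left.
  have [|g2] := ltP (h K) (h' K); first by right.
  have [i iK c] := strip_cover l0 m0 o1 o2 g1 g2 K0.
  by have [_ n] := dA _ _ iK c; case: n.
have av0' : h 0 < h' 0 \/ h' K < h 0.
  have [|g1] := ltP (h 0) (h' 0); first by left.
  have [|g2] := ltP (h' K) (h 0); first by right.
  have [i iK c] := strip_cover l'0 m'0 o1' o2' g1 g2 K0.
  by have [n _] := dB _ _ iK c; case: n.
have [m00 l'00] := (m0 0, l'0 0).
(* The path from the crossing at [h 0] through [m 0] and [l' 0] to the crossing at [h' 0] starts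
   below the last rung of the first strip and does not meet it, so it ends below it. The other case
   follows the path backwards under the last rung of the second strip. *)
have [lt|lt] := ltP (h K) (h' 0).
  have : h' 0 < h K.
    rewrite -below_height //.
    have b0 : 0 < det2 (l K - (0, h 0)) (m K - (0, h 0)) by rewrite below_height.
    have b1 : 0 < det2 (l K - m 0) (m K - m 0).
      apply: no_crossing b0; [apply: in_coneE => //=|apply: in_coneE|]; [|lra|].
        exact: w1.
      move=> z z1 /eK[n _ _]; apply: n; exact: seg_sub z1.
    have b2 : 0 < det2 (l K - l' 0) (m K - l' 0).
      apply: no_crossing b1; [apply: in_coneE; lra|apply: in_coneE => //; lra|].
      by move=> z z1 /eK[_ n _]; apply: n.
    apply: no_crossing b2; [apply: in_coneE => //; lra|apply: in_coneE => //=|].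
    move=> z /seg_sym z1 /eK[_ _ n]; apply: n; apply/seg_sym.
    exact: seg_sub (seg_sym (s' 0)) z1.
  by lra.
have lt1 : h' 0 < h 0 by case: av0 => //; lra.
have lt2 : h' K < h 0 by case: av0' => //; lra.
have : h 0 < h' K.
  rewrite -below_height //.
  have b0 : 0 < det2 (l' K - (0, h' 0)) (m' K - (0, h' 0)) by rewrite below_height.
  have b1 : 0 < det2 (l' K - l' 0) (m' K - l' 0).
    apply: no_crossing b0; [apply: in_coneE => //=|apply: in_coneE => //; lra|].
    move=> z z1 /e'K[_ _ n]; apply: n; apply/seg_sym.
    exact: seg_sub (seg_sym (s' 0)) z1.
  have b2 : 0 < det2 (l' K - m 0) (m' K - m 0).
    apply: no_crossing b1; [apply: in_coneE => //; lra|apply: in_coneE => //; lra|].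
    by move=> z /seg_sym z1 /e'K[_ n _]; apply: n.
  apply: no_crossing b2; [apply: in_coneE => //; lra|apply: in_coneE => //=|].
  move=> z /seg_sym z1 /e'K[n _ _]; apply: n; exact: seg_sub (s 0) z1.
by lra.
Qed.

(** Seen from the centroid, each side has a determinant of at least [d / 3]; moving the vertices by
    [e] changes it by at most [4 * B * e + 2 * e ^+ 2]. *)
Lemma hull3_centroid x1 x2 x3 y1 y2 y3 (B d e : R) : 0 <= e -> 0 <= B ->
  (forall i : bool, `|(if i then (x2 - x1).1 else (x2 - x1).2)| <= B) ->
  (forall i : bool, `|(if i then (x3 - x1).1 else (x3 - x1).2)| <= B) ->
  d <= det2 (x2 - x1) (x3 - x1) -> 4 * B * e + 2 * e ^+ 2 < d / 3 ->
  (forall y x, (y, x) \in [:: (y1, x1); (y2, x2); (y3, x3)] ->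
     `|(y - x).1| <= e /\ `|(y - x).2| <= e) ->
  hull3 y1 y2 y3 ((x1.1 + x2.1 + x3.1) / 3, (x1.2 + x2.2 + x3.2) / 3).
Proof.
move=> e0 B0 h2 h3 hd hB hy; set q := (_, _).
have near i : i \in [:: x1; x2; x3] -> `|(i - q).1| <= B /\ `|(i - q).2| <= B.
  have := h2 true; have := h2 false; have := h3 true; have := h3 false.
  rewrite /= !ler_norml => /andP[a1 a2] /andP[a3 a4] /andP[a5 a6] /andP[a7 a8].
  by rewrite !inE /q => /or3P[]/eqP->; split; rewrite /=; lra.
have key a a' y y' : a \in [:: x1; x2; x3] -> a' \in [:: x1; x2; x3] ->
    (y, a) \in [:: (y1, x1); (y2, x2); (y3, x3)] ->
    (y', a') \in [:: (y1, x1); (y2, x2); (y3, x3)] ->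
    d / 3 <= det2 (a - q) (a' - q) -> 0 < det2 (y - q) (y' - q).
  move=> ha ha' hya hya' hdet.
  have [n1 n2] := near _ ha; have [n1' n2'] := near _ ha'.
  have [k1 k2] := hy _ _ hya; have [k1' k2'] := hy _ _ hya'.
  have e1 := det2_norm n1 n2 k1' k2'; have e2 := det2_norm k1 k2 n1' n2'.
  have e3 := det2_norm k1 k2 k1' k2'.
  move: e1 e2 e3; rewrite !ler_norml => /andP[e1 _] /andP[e2 _] /andP[e3 _].
  have -> : det2 (y - q) (y' - q) = det2 (a - q) (a' - q)
      + det2 (a - q) (y' - a') + det2 (y - a) (a' - q) + det2 (y - a) (y' - a').
    by rewrite /det2 /=; ring.
  by clear - e1 e2 e3 hdet hB; lra.
have dE : det2 (x2 - x1) (x3 - x1) / 3 = det2 (x1 - q) (x2 - q) /\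
   det2 (x2 - x1) (x3 - x1) / 3 = det2 (x2 - q) (x3 - q) /\
   det2 (x2 - x1) (x3 - x1) / 3 = det2 (x3 - q) (x1 - q).
  by rewrite /det2 /q /=; split; [field|split; field].
have hd3 : d / 3 <= det2 (x2 - x1) (x3 - x1) / 3 by lra.
have [d1 [d2 d3]] := dE.
by apply: hull3_inside; [apply: (key x1 x2)|apply: (key x2 x3)|apply: (key x3 x1)];
  rewrite ?inE ?eqxx ?orbT -?d1 -?d2 -?d3.
Qed.

End Strips.

Section AffineImages.
Variable R : realType.
Local Notation plane := (R * R)%type.

Definition affine (a b c d e f : R) (x : plane) : plane :=
  (a * x.1 + b * x.2 + e, c * x.1 + d * x.2 + f).

Lemma hull3_affine a b c d e f (P Q S z : plane) : hull3 P Q S z ->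
  hull3 (affine a b c d e f P) (affine a b c d e f Q) (affine a b c d e f S)
    (affine a b c d e f z).
Proof.
case=> x [y [w [x0 y0 w0 s ->]]]; exists x, y, w; split=> //.
have xE : x = 1 - y - w by lra.
by rewrite /affine /= xE; congr pair; ring.
Qed.

Lemma faces_disjoint_affine a b c d e f F (psi psi' : vertex -> plane) :
  (forall v, psi v = affine a b c d e f (psi' v)) ->
  faces_disjoint F psi -> faces_disjoint F psi'.
Proof.
move=> E fd x y z x' y' z' sF s1 s2 dj q h1 h2.
have := fd x y z x' y' z' sF s1 s2 dj (affine a b c d e f q).
rewrite !E => h; apply: h; exact: hull3_affine.
Qed.

Lemma oriented_affine a b c d e f F (psi psi' : vertex -> plane) :
  (forall v, psi v = affine a b c d e f (psi' v)) -> 0 < a * d - b * c ->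
  oriented F psi -> oriented F psi'.
Proof.
move=> E D h v t vF wF zF; have := h v t vF wF zF; set X := det2 _ _.
have -> : X = (a * d - b * c) * det2 (psi' (v + hex_dir t) - psi' v)
                                     (psi' (v + hex_dir t.+1) - psi' v).
  by rewrite /X !E /det2 /affine /=; ring.
by rewrite pmulr_rgt0.
Qed.

End AffineImages.

Section Layout.
Variables (R : realType) (p : nat -> R) (u : vertex -> R).
Local Notation plane := (R * R)%type.
Hypothesis eu : embeddable_label p u.

(** Layouts of growing boxes, pinned at the vertex 0, are bounded at each vertex. Their limit has
    exact lengths, but its faces may collapse; the last clause therefore retains embedded layouts
    arbitrarily close to it. *)
Lemma layout_limit : exists phi : vertex -> plane,
  [/\ forall v t, sqd (phi v) (phi (v + hex_dir t)) = len2 p u v t,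
      forall v t, 0 <= det2 (phi (v + hex_dir t) - phi v)
                            (phi (v + hex_dir t.+1) - phi v) &
      forall (F : seq vertex) (e : R), 0 < e -> exists psi : vertex -> plane,
        [/\ oriented F psi, faces_disjoint F psi &
            forall v, v \in F -> `|(psi v - phi v).1| < e /\ `|(psi v - phi v).2| < e]].
Proof.
have inv0 (n : nat) : 0 < n.+1%:R^-1 :> R by rewrite invr_gt0.
have [psi0 h0] := choice (fun n => eu (box n) (inv0 n)).
pose psi n v := psi0 n v - psi0 n 0.
have lenE n v w : sqd (psi n v) (psi n w) = sqd (psi0 n v) (psi0 n w).
  by rewrite /sqd /psi /=; ring.
have aff n v : psi0 n v = affine 1 0 0 1 (psi0 n 0).1 (psi0 n 0).2 (psi n v).
  by rewrite /affine /psi /= [LHS]surjective_pairing; congr pair; ring.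
have or n : oriented (box n) (psi n).
  apply: (oriented_affine (aff n)); first by rewrite mulr1 mul0r subr0.
  by case: (h0 n).
have fd n : faces_disjoint (box n) (psi n).
  by apply: (faces_disjoint_affine (aff n)); case: (h0 n).
have len n v t : (nrm v < n)%N ->
    `|sqd (psi n v) (psi n (v + hex_dir t)) - len2 p u v t| < n.+1%:R^-1.
  move=> vn; rewrite lenE; have [h _ _] := h0 n; apply: h; rewrite mem_box.
    exact: ltnW.
  by apply: leq_trans vn; case: (nrm_hex v t).
have PF : ProperFilter (\oo : set_system nat) by exact: _.
have [U [UU Uoo]] := ultraFilterLemma PF.
have FU : Filter U by exact: _.
have big (k : nat) : \forall n \near U, (k <= n)%N.
  by apply: Uoo; exists k.
have inv1 (n : nat) : n.+1%:R^-1 <= 1 :> R by rewrite invf_le1 // ler1n.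
have bound v : exists C : R, \forall n \near U,
    `|(psi n v).1| <= C /\ `|(psi n v).2| <= C.
  elim/hex_ind: v => [|v t [C hC]].
    exists 0; apply: filterE => n; rewrite /psi subrr /= normr0; split; exact: lexx.
  pose r := Num.sqrt (len2 p u v t + 1).
  exists (C + r); apply: filterS2 hC (big (nrm v).+1) => n [c1 c2] vn.
  have := len n v t vn; rewrite ltr_norml sqdE => /andP[_ h].
  have hr : Num.sqrt (sqn (psi n (v + hex_dir t) - psi n v)) <= r.
    by apply: ler_wsqrtr; rewrite -lerBlDl; apply: le_trans (ltW h) (inv1 n).
  have [b1 b2] := sqn_bound (psi n (v + hex_dir t) - psi n v).
  have tri (x y a c : R) : `|x| <= a -> `|y - x| <= c -> `|y| <= a + c.
    move=> hx hy; have -> : y = x + (y - x) by ring.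
    by apply: le_trans (ler_normD _ _) _; apply: lerD.
  by split; [apply: tri c1 (le_trans b1 hr)|apply: tri c2 (le_trans b2 hr)].
have lim1 v : exists l : R, (psi n v).1 @[n --> U] --> l.
  have [C hC] := bound v.
  by apply: (@ulim_exists R U UU (fun n => (psi n v).1) C); apply: filterS hC => n [].
have lim2 v : exists l : R, (psi n v).2 @[n --> U] --> l.
  have [C hC] := bound v.
  by apply: (@ulim_exists R U UU (fun n => (psi n v).2) C); apply: filterS hC => n [].
have [phi1 hphi1] := choice lim1; have [phi2 hphi2] := choice lim2.
have d1 v w : (psi n v).1 - (psi n w).1 @[n --> U] --> phi1 v - phi1 w.
  exact: (ulimD (hphi1 _) (ulimN (hphi1 _))).
have d2 v w : (psi n v).2 - (psi n w).2 @[n --> U] --> phi2 v - phi2 w.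
  exact: (ulimD (hphi2 _) (ulimN (hphi2 _))).
exists (fun v => (phi1 v, phi2 v)); split.
- move=> v t; set w := v + hex_dir t.
  have lim : sqd (psi n v) (psi n w) @[n --> U] -->
      sqd (phi1 v, phi2 v) (phi1 w, phi2 w).
    rewrite /sqd /=; apply: ulimD; apply: ulimX; [exact: d1|exact: d2].
  apply/eqP; rewrite -subr_eq0 -normr_le0 leNgt; apply/negP => e0.
  set e := `|_| in e0; have e2 : 0 < e / 2 by rewrite divr_gt0.
  have small : \forall n \near U, n.+1%:R^-1 < e / 2.
    exact: Uoo _ (near_infty_natSinv_lt (PosNum e2)).
  have /filter_ex[n [[n1 n2] n3]] : \forall n \near U,
     (`|sqd (psi n v) (psi n w) - sqd (phi1 v, phi2 v) (phi1 w, phi2 w)| < e / 2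
      /\ n.+1%:R^-1 < e / 2) /\ (nrm v < n)%N.
    apply: filterS2 (big (nrm v).+1) (filterI (ulim_near lim e2) small).
    by move=> n k1 [k2 k3]; split=> //; split.
  have := lt_trans (len n v t n3) n2; rewrite -/w => n4.
  have : e < e / 2 + e / 2.
    rewrite {1}/e; have -> : sqd (phi1 v, phi2 v) (phi1 w, phi2 w) - len2 p u v t =
     (sqd (psi n v) (psi n w) - len2 p u v t) -
     (sqd (psi n v) (psi n w) - sqd (phi1 v, phi2 v) (phi1 w, phi2 w)) by ring.
    by apply: le_lt_trans (ler_normB _ _) _; apply: ltrD; [exact: n4|exact: n1].
  by rewrite -splitr ltxx.
- move=> v t; set w := v + hex_dir t; set z := v + hex_dir t.+1.
  have lim : det2 (psi n w - psi n v) (psi n z - psi n v) @[n --> U] -->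
    det2 ((phi1 w, phi2 w) - (phi1 v, phi2 v)) ((phi1 z, phi2 z) - (phi1 v, phi2 v)).
    rewrite /det2 /=; apply: ulimD; first by apply: ulimM; [exact: d1|exact: d2].
    by apply: ulimN; apply: ulimM; [exact: d2|exact: d1].
  rewrite leNgt; apply/negP => neg.
  set D := det2 _ _ in lim neg; have e0 : 0 < - D by rewrite oppr_gt0.
  have /filter_ex[n [n1 n2]] : \forall n \near U,
      `|det2 (psi n w - psi n v) (psi n z - psi n v) - D| < - D /\ (nrm v < n)%N.
    apply: filterS2 (big (nrm v).+1) (ulim_near lim e0) => n k1 k2; by split.
  have inb s : v + hex_dir s \in box n.
    by rewrite mem_box; apply: leq_trans n2; case: (nrm_hex v s).
  have := or n v t _ (inb t) (inb t.+1); rewrite mem_box (ltnW n2) => /(_ isT).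
  by move: n1; rewrite ltr_norml -/w -/z => /andP[_ k1] k2; lra.
move=> F e e0.
have nearF : \forall n \near U, forall v, v \in F ->
    [/\ `|(psi n v).1 - phi1 v| < e, `|(psi n v).2 - phi2 v| < e & (nrm v <= n)%N].
  apply: near_all => v.
  apply: filterS3 (big (nrm v)) (ulim_near (hphi1 v) e0) (ulim_near (hphi2 v) e0).
  by move=> n k1 k2 k3; split.
have [n hn] := filter_ex nearF.
have Fb v : v \in F -> v \in box n by rewrite mem_box => /hn[].
exists (psi n); split.
- by move=> v t vF wF zF; apply: or; apply: Fb.
- move=> x y z x' y' z' sF; apply: fd => w wF; exact/Fb/sF.
by move=> v /hn[].
Qed.

End Layout.

(** * Similarities acting on the layout of a linear label *)

Section LinearLayout.
Local Open Scope complex_scope.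
Variable R : realType.
Local Notation plane := (R * R)%type.

Definition toC (x : plane) : R[i] := x.1 +i* x.2.
Definition csq (z : R[i]) : R := complex.Re z ^+ 2 + complex.Im z ^+ 2.

Lemma csqM z w : csq (z * w) = csq z * csq w.
Proof. by case: z => a b; case: w => c d; rewrite /csq /=; ring. Qed.

Lemma csq_eq0 z : (csq z == 0) = (z == 0).
Proof.
case: z => a b; rewrite /csq /= paddr_eq0 ?sqr_ge0 // !sqrf_eq0.
by rewrite eq_complex /=.
Qed.

Lemma toCB x y : toC (x - y) = toC x - toC y.
Proof. by rewrite /toC /=; simpc. Qed.

Lemma sqd_csq x y : sqd x y = csq (toC y - toC x).
Proof. by rewrite sqdE -toCB. Qed.

Lemma similar_triangle (A B : plane) (a c w : R) : 0 < a -> sqn A = a ->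
  sqn B = c -> dot2 A B = w -> 0 <= det2 A B ->
  toC B = ((w / a) +i* (Num.sqrt (a * c - w ^+ 2) / a)) * toC A.
Proof.
move=> a0 ea ec ew d0.
have -> : Num.sqrt (a * c - w ^+ 2) = det2 A B.
  rewrite -(ger0_norm d0) -sqrtr_sqr; congr Num.sqrt.
  by rewrite -ea -ec -ew /sqn /dot2 /det2; ring.
have an : A.1 ^+ 2 + A.2 ^+ 2 != 0 by rewrite -/(sqn A) ea lt0r_neq0.
rewrite /toC -ew -ea /sqn /dot2 /det2; simpc.
by congr (_ +i* _); field.
Qed.

Variables (p : nat -> R) (u : vertex -> R) (sg : nat -> R).
Hypothesis pN1 : forall t, -1 < p t.
Hypothesis ulin : forall v t, u (v + hex_dir t) = u v + sg t.
Variable phi : vertex -> plane.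
Hypothesis phi_len : forall v t, sqd (phi v) (phi (v + hex_dir t)) = len2 p u v t.
Hypothesis phi_det : forall v t,
  0 <= det2 (phi (v + hex_dir t) - phi v) (phi (v + hex_dir t.+1) - phi v).

Let E v := expR (u v) ^+ 2.
Let L t := 1 + expR (sg t) ^+ 2 + 2 * expR (sg t) * p t.
Let N t := expR (sg t) ^+ 2 + expR (sg t.+1) ^+ 2
   + 2 * expR (sg t) * expR (sg t.+1) * p t.+2.
Let W t := (L t + L t.+1 - N t) / 2.
(** Gram determinant of the spokes [t] and [t + 1] about a vertex of radius 1; it vanishes exactly
    when the face they span is degenerate. *)
Definition lin_disc t := L t * L t.+1 - W t ^+ 2.
(** Complex ratio of consecutive spokes. It is the same at all vertices, since the stars of a linear
    label are similar. *)
Let zeta t : R[i] := (W t / L t) +i* (Num.sqrt (lin_disc t) / L t).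
Let C v := toC (phi v).

Lemma E_gt0 v : 0 < E v.
Proof. by rewrite exprn_gt0 // expR_gt0. Qed.

Lemma L_gt0 t : 0 < L t.
Proof.
have -> : L t = zz (p t) (expR (sg t)) by rewrite /L /zz; ring.
by apply: zz_gt0 => //; apply: expR_gt0.
Qed.

Lemma len2_lin v t : len2 p u v t = E v * L t.
Proof. by rewrite /len2 ulin expRD /E /L; ring. Qed.

Lemma len2_rim v t : len2 p u (v + hex_dir t) t.+2 = E v * N t.
Proof.
have e : v + hex_dir t + hex_dir t.+2 = v + hex_dir t.+1 by rewrite -addrA -hex_dirS.
by rewrite /len2 e !ulin !expRD /E /N; ring.
Qed.

Lemma sqn_side v t : sqn (phi (v + hex_dir t) - phi v) = E v * L t.
Proof. by rewrite -sqdE phi_len len2_lin. Qed.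

Lemma dot_side v t : dot2 (phi (v + hex_dir t) - phi v)
  (phi (v + hex_dir t.+1) - phi v) = E v * W t.
Proof.
have h1 := sqn_side v t; have h2 := sqn_side v t.+1.
have h3 : sqd (phi (v + hex_dir t)) (phi (v + hex_dir t.+1)) = E v * N t.
  by rewrite -len2_rim -phi_len -[v + _ + _]addrA -hex_dirS.
have -> : E v * W t = (E v * L t + E v * L t.+1 - E v * N t) / 2.
  by rewrite /W; field.
by rewrite -h1 -h2 -h3 /dot2 /sqn /sqd /=; field.
Qed.

Lemma layout_zeta v t : C (v + hex_dir t.+1) - C v = zeta t * (C (v + hex_dir t) - C v).
Proof.
have El : 0 < E v * L t by rewrite mulr_gt0 ?E_gt0 ?L_gt0.
have := similar_triangle El (sqn_side v t) (sqn_side v t.+1) (dot_side v t) (phi_det v t).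
rewrite !toCB -/(C _) -/(C _) -/(C _) => ->; congr (_ * _).
have E0 := E_gt0 v; have L0 := L_gt0 t.
have -> : E v * L t * (E v * L t.+1) - (E v * W t) ^+ 2 = E v ^+ 2 * lin_disc t.
  by rewrite /lin_disc; ring.
rewrite sqrtrM ?sqr_ge0 // sqrtr_sqr (gtr0_norm E0) /zeta.
by congr (_ +i* _); field; rewrite !lt0r_neq0.
Qed.

Lemma layout_det v t : 0 < lin_disc t ->
  det2 (phi (v + hex_dir t) - phi v) (phi (v + hex_dir t.+1) - phi v) =
  E v * Num.sqrt (lin_disc t).
Proof.
move=> d0; rewrite -(ger0_norm (phi_det v t)) -sqrtr_sqr.
rewrite -[X in X * _](gtr0_norm (E_gt0 v)) -sqrtr_sqr -sqrtrM ?sqr_ge0 //.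
congr Num.sqrt; have h1 := sqn_side v t; have h2 := sqn_side v t.+1.
have h3 := dot_side v t.
have -> : E v ^+ 2 * lin_disc t = (E v * L t) * (E v * L t.+1) - (E v * W t) ^+ 2.
  by rewrite /lin_disc; ring.
by rewrite -h1 -h2 -h3 /sqn /dot2 /det2; ring.
Qed.

Lemma lin_disc_ge0 t : 0 <= lin_disc t.
Proof.
have E0 := E_gt0 0; have h1 := sqn_side 0 t; have h2 := sqn_side 0 t.+1.
have h3 := dot_side 0 t.
rewrite -(pmulr_rge0 _ (exprn_gt0 2 E0)).
have -> : E 0 ^+ 2 * lin_disc t = (E 0 * L t) * (E 0 * L t.+1) - (E 0 * W t) ^+ 2.
  by rewrite /lin_disc; ring.
rewrite -h1 -h2 -h3; set A := phi _ - _; set B := phi _ - _.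
have -> : sqn A * sqn B - dot2 A B ^+ 2 = det2 A B ^+ 2.
  by rewrite /sqn /dot2 /det2; ring.
exact: sqr_ge0.
Qed.

Lemma lin_discE v t : lin_disc t = (expR (sg t) * expR (sg t.+1)) ^+ 2 *
  DD (p t) (p t.+1) (p t.+2) (rratio u v t) (rratio u v t.+1).
Proof.
have r i : rratio u v i = (expR (sg i))^-1.
  by rewrite /rratio ulin -expRN; congr expR; ring.
rewrite !r /lin_disc /W /L /N /DD /zz /NN.
by field; rewrite !lt0r_neq0 ?expR_gt0.
Qed.

Lemma side_neq0 v t : C (v + hex_dir t) - C v != 0.
Proof.
rewrite -csq_eq0 -sqd_csq phi_len len2_lin.
by rewrite lt0r_neq0 // mulr_gt0 ?E_gt0 ?L_gt0.
Qed.

Let a v := C (v + hex_dir 0) - C v.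
(** [mu1] and [mu2] multiply the side in direction 0 under translation by [hex_dir 0] and
    [hex_dir 1]. Turning twice about [v + hex_dir 0] leads to [v + hex_dir 1] and determines [mu1];
    closing a parallelogram determines [mu2]. *)
Let mu1 := (zeta 0 - 1) / (zeta 0 * zeta 1%N).
Let mu2 := zeta 0 * mu1 + 1 - zeta 0.

Lemma zeta_neq0 t : zeta t != 0.
Proof.
apply/eqP => z; have := side_neq0 0 t.+1.
by rewrite layout_zeta z mul0r eqxx.
Qed.

Lemma side_mu1 v : a (v + hex_dir 0) = mu1 * a v.
Proof.
have e0 := zeta_neq0 0; have e1 := zeta_neq0 1.
have h1 := layout_zeta v 0; have h2 := layout_zeta (v + hex_dir 0) 0.
have h3 := layout_zeta (v + hex_dir 0) 1.
rewrite -[v + hex_dir 0 + hex_dir 2]addrA -hex_dirS in h3.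
rewrite -/(a _) in h1 h2 *.
have h4 : (zeta 0 - 1) * a v = zeta 1%N * (zeta 0 * a (v + hex_dir 0)).
  rewrite -h2 -h3 mulrBl -h1 mul1r /a; ring.
apply: (mulfI (mulf_neq0 e0 e1)).
have -> : zeta 0 * zeta 1%N * a (v + hex_dir 0) =
  zeta 1%N * (zeta 0 * a (v + hex_dir 0)) by ring.
by rewrite -h4 /mu1; field; rewrite e0 e1.
Qed.

Lemma side_mu2 v : a (v + hex_dir 1) = mu2 * a v.
Proof.
have h1 : C (v + hex_dir 1) - C v = zeta 0 * a v := layout_zeta v 0.
have h2 : C (v + hex_dir 0 + hex_dir 1) - C (v + hex_dir 0) =
    zeta 0 * (mu1 * a v) by rewrite -side_mu1; exact: layout_zeta.
have -> : a (v + hex_dir 1) = (C (v + hex_dir 0 + hex_dir 1) - C (v + hex_dir 0))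
    + a v - (C (v + hex_dir 1) - C v).
  by rewrite /a -!addrA [hex_dir 0 + _]addrC; ring.
by rewrite h1 h2 /mu2; ring.
Qed.

Lemma csq_mu v : csq (a v) = E v * L 0.
Proof. by rewrite /a -sqd_csq phi_len len2_lin. Qed.

(** [mu1 = 1] forces [mu2 = 1]; sides then keep their length under translation, and the slopes
    vanish. *)
Lemma mu_neq1 : sg 0 != 0 \/ sg 1%N != 0 -> mu1 != 1.
Proof.
move=> s0; apply/eqP => m1.
have m2 : mu2 = 1 by rewrite /mu2 m1; ring.
have key t : (forall v, a (v + hex_dir t) = a v) -> sg t = 0.
  move=> h; have := csq_mu (0 + hex_dir t); rewrite h csq_mu.
  move/(mulIf (lt0r_neq0 (L_gt0 0)))/eqP.
  rewrite eqrXn2 ?expR_ge0 // => /eqP/expR_inj.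
  by rewrite ulin => e; lra.
have k0 := key 0 (fun v => _); have k1 := key 1%N (fun v => _).
move: s0; rewrite k0 ?k1 ?eqxx; first by case.
  by move=> v; rewrite side_mu2 m2 mul1r.
by move=> v; rewrite side_mu1 m1 mul1r.
Qed.

(** The center is the fixed point [C v - a v / (mu1 - 1)], which both translations leave
    unchanged. *)
Lemma layout_center : sg 0 != 0 \/ sg 1%N != 0 -> exists c k : R[i],
  [/\ forall v, C v - c = k * a v, k != 0,
      forall v, C (v + hex_dir 0) - c = mu1 * (C v - c) &
      forall v, C (v + hex_dir 1) - c = mu2 * (C v - c)].
Proof.
move=> s0; have m1 : mu1 - 1 != 0 by rewrite subr_eq0 mu_neq1.
pose k := (mu1 - 1)^-1; pose f v := C v - k * a v.
have f0 v : f v = f 0.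
  apply: (hex_period (f := f)) => w.
    rewrite /f side_mu1; have -> : C (w + hex_dir 0) = C w + a w by rewrite /a; ring.
    by rewrite /k; field.
  rewrite /f side_mu2.
  have -> : C (w + hex_dir 1) = C w + zeta 0 * a w.
    by rewrite -layout_zeta; ring.
  by rewrite /k /mu2; field.
have cE v : C v - f 0 = k * a v by rewrite -(f0 v) /f; ring.
exists (f 0), k; split=> //; first by rewrite invr_neq0.
- by move=> v; rewrite !cE side_mu1; ring.
- by move=> v; rewrite !cE side_mu2; ring.
Qed.

Lemma mu_real : lin_disc 0 = 0 -> lin_disc 1%N = 0 ->
  complex.Im mu1 = 0 /\ complex.Im mu2 = 0.
Proof.
move=> d0 d1; have e0 := zeta_neq0 0; have e1 := zeta_neq0 1.
have z t : lin_disc t = 0 -> zeta t = (W t / L t)%:C.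
  by move=> d; rewrite /zeta d sqrtr0 mul0r.
move: (z 0 d0) (z 1%N d1); move: (W 0 / L 0) (W 1%N / L 1%N) => x y z0 z1.
have m : mu1 = ((x - 1) / (x * y))%:C.
  by rewrite /mu1 z0 z1 rmorphM fmorphV rmorphM rmorphB.
split; first by rewrite m.
by rewrite /mu2 m z0; move: (_ / _) => c; simpc.
Qed.

(** Distances from the center are proportional to the radii, so vertices on which [u] is bounded
    above have bounded images. *)
Lemma layout_similarity : sg 0 != 0 \/ sg 1%N != 0 ->
  exists (c mu nu : R[i]) (K : R),
  [/\ 0 < K, forall v, csq (toC (phi v) - c) = K * expR (u v) ^+ 2,
      forall v, toC (phi (v + hex_dir 0)) - c = mu * (toC (phi v) - c),
      forall v, toC (phi (v + hex_dir 1)) - c = nu * (toC (phi v) - c) &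
      lin_disc 0 = 0 -> lin_disc 1%N = 0 ->
      complex.Im mu = 0 /\ complex.Im nu = 0].
Proof.
move=> s0; have [c [k [ck k0 c1 c2]]] := layout_center s0.
exists c, mu1, mu2, (csq k * L 0); split=> //.
- rewrite mulr_gt0 ?L_gt0 // lt_neqAle eq_sym csq_eq0 k0.
  by rewrite addr_ge0 ?sqr_ge0.
- by move=> v; rewrite -/(C v) ck csqM csq_mu /E; ring.
exact: mu_real.
Qed.

End LinearLayout.

Section LinearLabels.
Variables (R : realType) (p : nat -> R) (u : vertex -> R) (S S' : R).
Local Notation plane := (R * R)%type.
Hypothesis pN1 : forall t, -1 < p t.
Hypothesis eu : embeddable_label p u.
Hypothesis uS : forall v, u (v + hex_dir 0) = u v + S.
Hypothesis uS' : forall v, u (v + hex_dir 1) = u v + S'.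

Definition slope (t : nat) : R := u (hex_dir t) - u 0.

Lemma linear_slope v t : u (v + hex_dir t) = u v + slope t.
Proof.
have h : u (v + hex_dir t) - u v = u (0 + hex_dir t) - u 0.
  apply: (hex_period (f := fun v => u (v + hex_dir t) - u v)) => w.
    by rewrite addrAC !uS; ring.
  by rewrite addrAC !uS'; ring.
by move: h; rewrite add0r /slope => <-; ring.
Qed.

Lemma linear_labelE v : u v = u 0 + v.1%:~R * S + v.2%:~R * S'.
Proof.
have h : u v - v.1%:~R * S - v.2%:~R * S' = u 0 - (0 : vertex).1%:~R * S - (0 : vertex).2%:~R * S'.
  apply: (hex_period (f := fun v : vertex => u v - v.1%:~R * S - v.2%:~R * S')) => w.
    by rewrite uS /hex_dir /= !intrD; ring.
  by rewrite uS' /hex_dir /= !intrD; ring.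
by move: h; rewrite /= !mul0r !subr0 => <-; ring.
Qed.

Lemma slope_neq0 : ~ (S = 0 /\ S' = 0) -> slope 0 != 0 \/ slope 1%N != 0.
Proof.
move=> h; have -> : slope 0 = S by rewrite /slope -[hex_dir 0]add0r uS; ring.
have -> : slope 1 = S' by rewrite /slope -[hex_dir 1]add0r uS'; ring.
have [s0|] := eqVneq S 0; last by left.
by right; apply/eqP => s1; apply: h.
Qed.

(** Along a level line of [u] the first coordinate is obtained by rounding; the factor 3 keeps the
    faces at different points disjoint. *)
Lemma level_points : exists (V : nat -> vertex) (B : R),
  (forall i, `|u (V i) - u 0| <= B) /\
  forall i j, i != j -> (2 < absz ((V i).1 - (V j).1)%R)%N \/
                        (2 < absz ((V i).2 - (V j).2)%R)%N.
Proof.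
have [s0|s0] := eqVneq S 0.
  exists (fun i => (3 * i%:Z, 0)), 0; split=> [i|i j ij].
    by rewrite linear_labelE s0 /= mulr0 mul0r !addr0 subrr normr0.
  by left => /=; move: ij; lia.
pose k (i : nat) := Num.floor (i%:R * S' / S).
exists (fun i => (- 3 * k i, 3 * i%:Z)), (3 * `|S|); split=> [i|i j ij]; last first.
  by right => /=; move: ij; lia.
have -> : u (- 3 * k i, 3 * i%:Z) - u 0 = 3 * S * (i%:R * S' / S - (k i)%:~R).
  rewrite linear_labelE /= !intrM -[i%:~R]/(i%:R : R).
  have -> : (- 3)%:~R = - 3 :> R by rewrite mulrNz.
  by field.
rewrite !normrM ger0_norm // -[X in _ <= X]mulr1 ler_wpM2l ?mulr_ge0 //.
have := Num.Theory.real_floor_itv (num_real (i%:R * S' / S)); rewrite -/(k i).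
rewrite intrD => /andP[h1 h2]; rewrite ler_norml; apply/andP.
by move: h1 h2; move: (_ / S) (k i)%:~R => x y; rewrite /= => h1 h2; split; lra.
Qed.

(* Far apart on a level line of u, the faces are congruent and accumulate, so
   two of them overlap. *)
Lemma linear_nondegenerate : ~ (S = 0 /\ S' = 0) ->
  forall t, lin_disc p slope t <= 0.
Proof.
move=> SS t; rewrite leNgt; apply/negP => d0.
have [phi [plen pdet papp]] := layout_limit eu.
have [c [mu [nu [K [K0 cK _ _ _]]]]] :=
  layout_similarity pN1 linear_slope plen pdet (slope_neq0 SS).
have [V [B [uB sep]]] := level_points.
pose dir (m : nat) : vertex := match m with 0 => 0 | 1 => hex_dir t | _ => hex_dir t.+1 end.
pose W i m := V i + dir m.
pose B' := B + (`|slope t| + `|slope t.+1|).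
have uW i m : u (W i m) <= u 0 + B'.
  have h := uB i; rewrite ler_norml in h; case/andP: h => _ h.
  have := ler_norm (slope t); have := ler_norm (slope t.+1).
  have := normr_ge0 (slope t); have := normr_ge0 (slope t.+1).
  rewrite /W /dir /B'; case: m => [|[|m]]; rewrite ?addr0 ?linear_slope; lra.
pose r := Num.sqrt (K * expR (u 0 + B') ^+ 2).
pose C := `|complex.Re c| + `|complex.Im c| + r.
have r0 : 0 <= r := sqrtr_ge0 _.
have coord i m : `|(phi (W i m)).1| <= C /\ `|(phi (W i m)).2| <= C.
  have h : csq (toC (phi (W i m)) - c) <= K * expR (u 0 + B') ^+ 2.
    rewrite cK ler_wpM2l ?(ltW K0) //.
    by rewrite ler_pXn2r ?nnegrE ?expR_ge0 // ler_expR.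
  have hr := ler_wsqrtr h.
  have := sqn_bound (phi (W i m) - (complex.Re c, complex.Im c)).
  have -> : sqn (phi (W i m) - (complex.Re c, complex.Im c)) = csq (toC (phi (W i m)) - c).
    by clear; case: c.
  case=> /=; rewrite -/r in hr => h1 h2.
  have tri (x y a : R) : `|x - y| <= r -> `|y| <= a -> `|x| <= a + r.
    by move=> hx hy; rewrite -[x](subrK y) addrC; apply: le_trans (ler_normD _ _) _; apply: lerD.
  split; [apply: (tri _ _ _ (le_trans h1 hr))|apply: (tri _ _ _ (le_trans h2 hr))].
    by rewrite lerDl.
  by rewrite lerDr.
have normB (x y : R) : `|x| <= C -> `|y| <= C -> `|y - x| <= 2 * C.
  by move=> hx hy; apply: le_trans (ler_normB _ _) _; rewrite mulrDl mul1r lerD.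
have C0 : 0 <= C by rewrite !addr_ge0.
pose d := expR (u 0 - B) ^+ 2 * Num.sqrt (lin_disc p slope t).
have dpos : 0 < d by rewrite mulr_gt0 ?sqrtr_gt0 // exprn_gt0 // expR_gt0.
have detW i : d <= det2 (phi (W i 1) - phi (W i 0)) (phi (W i 2) - phi (W i 0)).
  rewrite /W /= addr0 (layout_det linear_slope plen pdet) //.
  rewrite ler_wpM2r ?sqrtr_ge0 // ler_pXn2r ?nnegrE ?expR_ge0 // ler_expR.
  by have h := uB i; rewrite ler_norml in h; case/andP: h => h _; lra.
(* This gives [e < 1] and [(16 * C + 9) * e < d / 3], enough for [hull3_centroid] with the bound
   [2 * C] and the error [2 * e]. *)
pose e := d / (d + 3 * (16 * C + 9)).
have Q0 : 0 < d + 3 * (16 * C + 9) by lra.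
have e0 : 0 < e by rewrite divr_gt0.
have eE : e * (d + 3 * (16 * C + 9)) = d by rewrite /e divfK // lt0r_neq0.
have e1 : e < 1 by rewrite /e ltr_pdivrMr // mul1r; lra.
have small : 4 * (2 * C) * (2 * e) + 2 * (2 * e) ^+ 2 < d / 3.
  have h := mulr_gt0 dpos e0; have h2 : e ^+ 2 <= e by rewrite expr2 ler_piMr // ltW.
  by clear - eE h h2 e0; lra.
(* Six numbers: two coordinates for each vertex of a face. *)
have [N pig] := @pigeonhole_box R 6 C e e0.
pose co i j := if odd j then (phi (W i j./2)).2 else (phi (W i j./2)).1.
have coC i j : `|co i j| <= C by rewrite /co; case: odd; case: (coord i j./2).
have [i [k [ik near]]] := pig (fun i j => co i j) (fun i j => coC i j).
have {}near m : (m < 3)%N -> `|(phi (W i m) - phi (W k m)).1| < e /\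
    `|(phi (W i m) - phi (W k m)).2| < e.
  move=> m3; have m1 : (m.*2 < 6)%N by rewrite (ltn_double m 3).
  have m2 : (m.*2.+1 < 6)%N by rewrite (ltn_Sdouble m 3).
  have := near (Ordinal m1); have := near (Ordinal m2).
  by rewrite /co /= odd_double /= uphalf_double doubleK.
pose F := [seq W i m | m <- iota 0 3] ++ [seq W k m | m <- iota 0 3].
have [psi [_ fd ps]] := papp F e e0.
have inF j m : j \in [:: nat_of_ord i; nat_of_ord k] -> (m < 3)%N -> W j m \in F.
  rewrite in_cons mem_seq1 /F mem_cat => /orP[]/eqP-> m3; apply/orP; [left|right];
    by apply/mapP; exists m; rewrite // mem_iota.
pose q := (((phi (W i 0)).1 + (phi (W i 1)).1 + (phi (W i 2)).1) / 3,
           ((phi (W i 0)).2 + (phi (W i 1)).2 + (phi (W i 2)).2) / 3).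
have hull j : j \in [:: nat_of_ord i; nat_of_ord k] ->
    hull3 (psi (W j 0)) (psi (W j 1)) (psi (W j 2)) q.
  move=> jik; apply: (@hull3_centroid _ _ _ _ _ _ _ (2 * C) d (2 * e)).
  - by rewrite mulr_ge0 // ltW.
  - by rewrite mulr_ge0.
  - by have [a1 a2] := coord i 0; have [b1 b2] := coord i 1; case; apply: normB.
  - by have [a1 a2] := coord i 0; have [b1 b2] := coord i 2; case; apply: normB.
  - exact: detW.
  - exact: small.
  have close m : (m < 3)%N -> `|(psi (W j m) - phi (W i m)).1| <= 2 * e /\
      `|(psi (W j m) - phi (W i m)).2| <= 2 * e.
    move=> m3; have [a1 a2] := ps _ (inF j m jik m3); have [b1 b2] := near m m3.
    move: jik; rewrite in_cons mem_seq1 => /orP[]/eqP jE; rewrite jE in a1 a2 *.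
      by split; apply: ltW; [apply: lt_trans a1 _|apply: lt_trans a2 _]; lra.
    have tri (x y z : R) : `|x - y| < e -> `|z - y| < e -> `|x - z| <= 2 * e.
      move=> hx hy; have -> : x - z = (x - y) - (z - y) by ring.
      by apply: le_trans (ler_normB _ _) _; rewrite mulrDl mul1r lerD // ltW.
    by split; [exact: tri a1 b1|exact: tri a2 b2].
  by move=> y x; rewrite !inE => /or3P[]/eqP[-> ->]; apply: close.
have simp j : simplex (W j 0) (W j 1) (W j 2).
  by rewrite /W /= addr0; apply: simplex_face.
apply: (fd (W i 0) (W i 1) (W i 2) (W k 0) (W k 1) (W k 2) _ (simp _) (simp _) _ q).
- have ii : nat_of_ord i \in [:: nat_of_ord i; nat_of_ord k] by rewrite mem_head.
  have kk : nat_of_ord k \in [:: nat_of_ord i; nat_of_ord k].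
    by rewrite in_cons mem_head orbT.
  by apply/allP; rewrite /= !(inF _ _ ii) // !(inF _ _ kk).
- have b m : (absz (dir m).1 <= 1)%N /\ (absz (dir m).2 <= 1)%N.
    by case: m => [|[|m]] //=; [case: (hex_dir_bound t)|case: (hex_dir_bound t.+1)].
  have ne m n : W i m != W k n.
    apply/eqP => E; have [b1 b2] := b m; have [b3 b4] := b n.
    have E1 : (V i).1 + (dir m).1 = (V k).1 + (dir n).1 := congr1 fst E.
    have E2 : (V i).2 + (dir m).2 = (V k).2 + (dir n).2 := congr1 snd E.
    by case: (sep i k ik); clear - b1 b2 b3 b4 E1 E2; lia.
  by move=> a; rewrite !inE => /or3P[]/eqP->; rewrite !negb_or !ne.
- by apply: hull; rewrite inE eqxx.
by apply: hull; rewrite !inE eqxx orbT.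
Qed.

End LinearLabels.

(** * Collinear layouts with factors of both signs *)

Section RealSpirals.
Variable R : realType.
Local Notation plane := (R * R)%type.

Lemma hex_dir_det t :
  (hex_dir t).1 * (hex_dir t.+1).2 - (hex_dir t).2 * (hex_dir t.+1).1 = 1.
Proof.
rewrite -[t.+1]addn1 hex_dir_modD -[hex_dir t]hex_dir_mod addn1.
by have := ltn_pmod t (isT : (0 < 6)%N); move: (t %% 6)%N => [|[|[|[|[|[|]]]]]].
Qed.

Lemma small_positive (s : seq R) : (forall x, x \in s -> 0 < x) ->
  exists2 d : R, 0 < d & forall x, x \in s -> d <= x.
Proof.
elim: s => [|a s IH] h; first by exists 1.
have [x xs|d d0 hd] := IH; first by apply: h; rewrite in_cons xs orbT.
exists (Num.min a d); first by rewrite lt_min d0 h ?mem_head.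
by move=> x; rewrite in_cons ge_min => /orP[/eqP->|/hd ->]; rewrite ?lexx ?orbT.
Qed.

Lemma exprn_unbounded (x b : R) : 1 < x -> exists n : nat, b < x ^+ n.
Proof.
move=> x1; have d0 : 0 < x - 1 by rewrite subr_gt0.
have bern n : 1 + n%:R * (x - 1) <= x ^+ n.
  elim: n => [|n IH]; first by rewrite mul0r addr0 expr0.
  rewrite exprS; apply: le_trans (ler_wpM2l _ IH); last by lra.
  have n0 : 0 <= n%:R * (x - 1) ^+ 2 by rewrite mulr_ge0 ?sqr_ge0.
  by rewrite -natr1; lra.
exists (Num.bound `|b / (x - 1)|); apply: lt_le_trans (bern _).
have : b / (x - 1) < (Num.bound `|b / (x - 1)|)%:R.
  exact: le_lt_trans (ler_norm _) (archi_boundP (normr_ge0 _)).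
by rewrite ltr_pdivrMr // => /lt_trans; apply; rewrite ltrDr ltr01.
Qed.

Section Lattice.
Variable t : nat.
Definition grid (i n : nat) : vertex := hex_dir t *+ i + hex_dir t.+1 *+ n.

Lemma grid0 : grid 0 0 = 0.
Proof. by rewrite /grid !mulr0n addr0. Qed.

Lemma gridS i n : grid i.+1 n = grid i n + hex_dir t.
Proof. by rewrite /grid mulrSr addrAC. Qed.

Lemma gridSr i n : grid i n.+1 = grid i n + hex_dir t.+1.
Proof. by rewrite /grid mulrSr addrA. Qed.

Lemma grid_back i n : grid i n.+1 = grid i.+1 n + hex_dir t.+2.
Proof. by rewrite gridSr gridS -[RHS]addrA -hex_dirS. Qed.

Lemma unimodular_inj (a b c d x z x' z' : int) : a * d - b * c = 1 ->
  a * x + c * z = a * x' + c * z' -> b * x + d * z = b * x' + d * z' ->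
  x = x' /\ z = z'.
Proof.
move=> D e1 e2; split.
  have e : d * (a * x + c * z) - c * (b * x + d * z) =
      d * (a * x' + c * z') - c * (b * x' + d * z') by rewrite e1 e2.
  have E (y w : int) : d * (a * y + c * w) - c * (b * y + d * w) = (a * d - b * c) * y.
    by ring.
  by move: e; rewrite !E D !mul1r.
have e : a * (b * x + d * z) - b * (a * x + c * z) =
    a * (b * x' + d * z') - b * (a * x' + c * z') by rewrite e1 e2.
have E (y w : int) : a * (b * y + d * w) - b * (a * y + c * w) = (a * d - b * c) * w.
  by ring.
by move: e; rewrite !E D !mul1r.
Qed.

Lemma grid_inj i n i' n' : grid i n = grid i' n' -> i = i' /\ n = n'.
Proof.
have m1 (v : vertex) k : (v *+ k).1 = v.1 * k%:Z.
  by elim: k => [|k IH]; rewrite ?mulr0 // mulrSr intS mulrDr mulr1 addrC -IH.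
have m2 (v : vertex) k : (v *+ k).2 = v.2 * k%:Z.
  by elim: k => [|k IH]; rewrite ?mulr0 // mulrSr intS mulrDr mulr1 addrC -IH.
move=> E; have e1 := congr1 fst E; have e2 := congr1 snd E.
rewrite /grid !raddfD /= !m1 in e1; rewrite /grid !raddfD /= !m2 in e2.
by have [[->] [->]] := unimodular_inj (hex_dir_det t) e1 e2.
Qed.

End Lattice.

(* The rows of the grid are alternately on the two sides of the origin. *)
Lemma no_alternating_spiral (t : nat) (y : vertex -> R) (l m : R) :
  1 < l -> m < 0 -> y 0 = 1 ->
  (forall v, y (v + hex_dir t) = l * y v) ->
  (forall v, y (v + hex_dir t.+1) = m * y v) ->
  ~ (forall (F : seq vertex) (e : R), 0 < e -> exists psi : vertex -> plane,
      [/\ oriented F psi, faces_disjoint F psi &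
          forall v, v \in F -> `|(psi v).1 - y v| < e]).
Proof.
move=> l1 m0 y0 yl ym app.
have yE i n : y (grid t i n) = l ^+ i * m ^+ n.
  elim: i => [|i IH]; last by rewrite gridS yl IH exprS mulrA.
  rewrite expr0 mul1r; elim: n => [|n IH]; last by rewrite gridSr ym IH exprS.
  by rewrite grid0 y0 expr0.
(* For such [K] the last rungs of both strips extend beyond the first points of rows 1 and 2, as
   [strips_contra] requires. *)
have [K hK] := exprn_unbounded (1 + m ^+ 2 + (m ^+ 2)^-1) l1.
have m2 : 0 < m ^+ 2 by rewrite -sqrrN exprn_gt0 // oppr_gt0.
have im2 : 0 < (m ^+ 2)^-1 by rewrite invr_gt0.
have K1 : 1 < l ^+ K by lra.
have K2 : m ^+ 2 < l ^+ K by lra.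
have K3 : (m ^+ 2)^-1 < l ^+ K by lra.
have K0 : (0 < K)%N by case: (K) K1 => //; rewrite expr0 ltxx.
have li i : 1 <= l ^+ i by rewrite exprn_ege1 // ltW.
have K4 : 1 < l ^+ K * m ^+ 2 by rewrite -ltr_pdivrMr // mul1r.
(* [d] is at most every distance between abscissas that matters, so an error below [d / 2] preserves
   their signs and their order. *)
have [|d d0 hd] := @small_positive [:: 1; - m; m ^+ 2; - m ^+ 3;
   m - l ^+ K * m; l ^+ K - m ^+ 2; m - l ^+ K * m ^+ 3; (l ^+ K - 1) * m ^+ 2].
  have m3 : 0 < - m ^+ 3 by rewrite exprS -mulNr mulr_gt0 // oppr_gt0.
  apply/allP; rewrite /= ltr01 m2 m3 oppr_gt0 m0 !subr_gt0 K2 /=.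
  rewrite gtr_nMl // K1 mulr_gt0 ?subr_gt0 //=.
  by rewrite exprSr mulrA gtr_nMl // K4.
have {}hd x : x \in [:: 1; - m; m ^+ 2; - m ^+ 3;
   m - l ^+ K * m; l ^+ K - m ^+ 2; m - l ^+ K * m ^+ 3; (l ^+ K - 1) * m ^+ 2] -> d <= x.
  exact: hd.
pose F := [seq grid t i n | i <- iota 0 K.+1, n <- iota 0 4].
have inF i n : (i <= K)%N -> (n < 4)%N -> grid t i n \in F.
  by move=> iK n4; apply: allpairs_f; rewrite mem_iota.
have d2 : 0 < d / 2 by rewrite divr_gt0.
have [psi [or fd ap]] := app F (d / 2) d2.
pose P (a : nat * nat) := psi (grid t a.1 a.2).
have apP i n : (i <= K)%N -> (n < 4)%N ->
    l ^+ i * m ^+ n - d / 2 < (P (i, n)).1 < l ^+ i * m ^+ n + d / 2.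
  move=> iK n4; have := ap _ (inF i n iK n4); rewrite yE ltr_norml.
  by rewrite ltrBrDr ltrBlDr [- _ + _]addrC [_ / 2 + _]addrC.
pose ok (a : nat * nat) := (a.1 <= K)%N && (a.2 < 4)%N.
have okn i n : (i <= K)%N -> (n < 3)%N -> ok (i, n) && ok (i, n.+1).
  by move=> iK n3; rewrite /ok /= iK; apply/andP; split; [exact: leqW|exact: n3].
have dis (a b c a' b' c' : nat * nat) : all ok [:: a; b; c; a'; b'; c'] ->
    simplex (grid t a.1 a.2) (grid t b.1 b.2) (grid t c.1 c.2) ->
    simplex (grid t a'.1 a'.2) (grid t b'.1 b'.2) (grid t c'.1 c'.2) ->
    ~~ has (mem [:: a'; b'; c']) [:: a; b; c] ->
    forall q, hull3 (P a) (P b) (P c) q -> ~ hull3 (P a') (P b') (P c') q.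
  move=> /allP oks s1 s2 dj q; apply: fd s1 s2 _ q.
    have gi x : x \in [:: a; b; c; a'; b'; c'] -> grid t x.1 x.2 \in F.
      by move/oks => /andP[h1 h2]; apply: inF.
    by apply/allP; rewrite /= !gi // !inE eqxx ?orbT.
  have inj x x' : grid t x.1 x.2 = grid t x'.1 x'.2 -> x = x'.
    by case: x x' => [? ?] [? ?] /grid_inj[/= -> ->].
  have nE x x' : x \in [:: a; b; c] -> x' \in [:: a'; b'; c'] ->
      (grid t x.1 x.2 == grid t x'.1 x'.2) = false.
    move=> xs xs'; apply/eqP => /inj e; case/negP: dj; apply/hasP; exists x => //.
    by rewrite e.
  by move=> z; rewrite !inE => /or3P[]/eqP->; rewrite !nE // !inE eqxx ?orbT.
have sE i n : simplex (grid t i n) (grid t i n) (grid t i n.+1).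
  by apply: simplex_edge; right; exists t.+1; rewrite gridSr.
have sL i n : simplex (grid t i n) (grid t i.+1 n) (grid t i n.+1).
  by rewrite gridS gridSr; apply: simplex_face.
have sH i n : simplex (grid t i.+1 n) (grid t i.+1 n.+1) (grid t i n.+1).
  by rewrite (grid_back t i) (gridSr t i.+1); apply: simplex_face.
have edge i n q : seg (P (i, n)) (P (i, n.+1)) q ->
  hull3 (P (i, n)) (P (i, n)) (P (i, n.+1)) q by apply: seg_hull3.
(* Rows are continued constantly beyond [K], since the side conditions of [strips_contra] range over
   all [i]. *)
pose row n i := P (minn i K, n).
have oL i n : (i < K)%N -> (n < 3)%N -> 0 < det2 (row n i.+1 - row n i) (row n.+1 i - row n i).
  move=> iK n3; rewrite /row (minn_idPl iK) (minn_idPl (ltnW iK)) /P /= gridS gridSr.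
  by apply: or; rewrite -?gridS -?gridSr; apply: inF; rewrite ?ltnS // ltnW // ltnW.
have oH i n : (i < K)%N -> (n < 3)%N ->
    0 < det2 (row n.+1 i.+1 - row n i.+1) (row n.+1 i - row n i.+1).
  move=> iK n3; rewrite /row (minn_idPl iK) (minn_idPl (ltnW iK)) /P /= (grid_back t i) (gridSr t i.+1).
  by apply: or; rewrite -?(grid_back t i) -?(gridSr t i.+1); apply: inF; rewrite ?ltnS // ltnW // ltnW.
have side n i : (n < 4)%N -> if odd n then (row n i).1 < 0 else 0 < (row n i).1.
  move=> n4; have /andP[h1 h2] := apP (minn i K) n (geq_minr _ _) n4.
  have hl := li (minn i K); rewrite /row.
  case: n n4 h1 h2 => [|[|[|[|//]]]] _ /=; rewrite ?expr0 ?mulr1 => h1 h2.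
  - by have := hd 1; rewrite !inE eqxx => /(_ isT); clear - h1 h2 hl d0; lra.
  - have := hd (- m); rewrite !inE eqxx ?orbT => /(_ isT).
    by clear - h1 h2 hl d0 m0; nra.
  - have := hd (m ^+ 2); rewrite !inE eqxx ?orbT => /(_ isT).
    by clear - h1 h2 hl d0 m2; move: (m ^+ 2) (l ^+ _) h1 h2 hl m2 => a b *; nra.
  have := hd (- m ^+ 3); rewrite !inE eqxx ?orbT => /(_ isT).
  by clear - h1 h2 hl d0; move: (m ^+ 3) (l ^+ _) h1 h2 hl => a b *; nra.
have rowK n : row n K = P (K, n) by rewrite /row minnn.
have row0 n : row n 0%N = P (0%N, n) by rewrite /row min0n.
have far n n' i i' : (n < 4)%N -> (n' < 4)%N -> (i <= K)%N -> (i' <= K)%N ->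
    d <= l ^+ i' * m ^+ n' - l ^+ i * m ^+ n -> (P (i, n)).1 < (P (i', n')).1.
  move=> n4 n4' iK iK' h; have /andP[_ h1] := apP i n iK n4.
  have /andP[h2 _] := apP i' n' iK' n4'.
  by clear - h h1 h2; lra.
have strip n n' i j z : (i < K)%N -> (j <= K)%N -> (n < 3)%N -> (n' < 3)%N ->
    n != n' -> n.+1 != n' -> n != n'.+1 ->
    hull3 (row n i) (row n i.+1) (row n.+1 i) z \/
    hull3 (row n i.+1) (row n.+1 i.+1) (row n.+1 i) z ->
    ~ seg (P (j, n')) (P (j, n'.+1)) z.
  move=> iK jK n3 n'3 e1 e2 e3; rewrite /row (minn_idPl iK) (minn_idPl (ltnW iK)).
  move=> h /edge; case: h; apply: dis => //=.
  - have /andP[a1 a2] := okn _ _ iK n3; have /andP[a3 a4] := okn _ _ (ltnW iK) n3.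
    by have /andP[a5 a6] := okn _ _ jK n'3; rewrite ?a1 ?a2 ?a3 ?a4 ?a5 ?a6.
  - by rewrite !inE !xpair_eqE (negPf e1) (negPf e2) (negPf e3) eqSS (negPf e1) !andbF.
  - have /andP[a1 a2] := okn _ _ iK n3; have /andP[a3 a4] := okn _ _ (ltnW iK) n3.
    by have /andP[a5 a6] := okn _ _ jK n'3; rewrite ?a1 ?a2 ?a3 ?a4 ?a5 ?a6.
  by rewrite !inE !xpair_eqE (negPf e1) (negPf e2) (negPf e3) eqSS (negPf e1) !andbF.
have cut n n' z : (n < 3)%N -> (n' < 3)%N ->
    seg (P (K, n)) (P (K, n.+1)) z -> ~ seg (P (0%N, n')) (P (0%N, n'.+1)) z.
  move=> n3 n'3 /edge h /edge; apply: dis h => //=.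
    have /andP[a1 a2] := okn _ _ (leqnn K) n3; have /andP[a3 a4] := okn _ _ (leq0n K) n'3.
    by rewrite a1 a2 a3 a4.
  by rewrite !inE !xpair_eqE eqn0Ngt K0.
apply: (@strips_contra R K (row 0) (row 1%N) (row 2) (row 3) K0
  (fun i => side 0%N i isT) (fun i => side 1%N i isT)
  (fun i => side 2%N i isT) (fun i => side 3%N i isT)
  (fun i iK => oL i 0%N iK isT) (fun i iK => oH i 0%N iK isT)
  (fun i iK => oL i 2 iK isT) (fun i iK => oH i 2 iK isT)).
- by rewrite rowK row0; apply: far => //; rewrite !expr0 mul1r expr1; apply: hd; rewrite !inE eqxx ?orbT.
- by rewrite rowK row0; apply: far => //; rewrite !expr0 mul1r mulr1; apply: hd; rewrite !inE eqxx ?orbT.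
- by rewrite rowK row0; apply: far => //; rewrite !expr0 mul1r; apply: hd; rewrite !inE eqxx ?orbT.
- rewrite rowK row0; apply: far => //; rewrite !expr0 mul1r -[X in _ - X]mul1r -mulrBl.
  by apply: hd; rewrite !inE eqxx ?orbT.
- by move=> i z iK h; rewrite !row0 !rowK; split; apply: strip h.
- by move=> i z iK h; rewrite !row0 !rowK; split; apply: strip h.
- by move=> z; rewrite !row0 !rowK => h; split; apply: cut h.
- by move=> z; rewrite !row0 !rowK => h; split; apply: cut h.
Qed.

End RealSpirals.

Section DegenerateLayout.
Variables (R : realType) (p : nat -> R) (u : vertex -> R) (S S' : R).
Local Notation plane := (R * R)%type.
Hypothesis pN1 : forall t, -1 < p t.
Hypothesis eu : embeddable_label p u.
Hypothesis uS : forall v, u (v + hex_dir 0) = u v + S.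
Hypothesis uS' : forall v, u (v + hex_dir 1) = u v + S'.

(* y v is the position of v on the line, the center of similarity being the
   origin and the vertex 0 being at 1. *)
Lemma collinear_layout : ~ (S = 0 /\ S' = 0) -> exists (y : vertex -> R) (Z : R),
  [/\ 0 < Z /\ y 0 = 1, forall v, y v != 0,
      forall v t, y (v + hex_dir t) = y (hex_dir t) * y v,
      forall v t, ((y (v + hex_dir t) - y v) * Z) ^+ 2 = len2 p u v t &
      forall (F : seq vertex) (e : R), 0 < e -> exists psi : vertex -> plane,
      [/\ oriented F psi, faces_disjoint F psi &
          forall v, v \in F -> `|(psi v).1 - y v| < e]].
Proof.
move=> SS.
have lin := linear_slope uS uS'.
have [phi [plen pdet papp]] := layout_limit eu.
have [c [mu [nu [K [K0 cK c1 c2 im]]]]] :=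
  layout_similarity pN1 lin plen pdet (slope_neq0 uS uS' SS).
have disc t : lin_disc p (slope u) t = 0.
  apply/eqP; rewrite eq_le (linear_nondegenerate pN1 eu uS uS' SS).
  exact: (lin_disc_ge0 lin plen).
have [imm imn] := im (disc 0%N) (disc 1%N).
pose z v : R[i] := toC (phi v) - c.
have zc v : csq (z v) = K * expR (u v) ^+ 2 := cK v.
have z0 v : z v != 0 by rewrite -csq_eq0 zc lt0r_neq0 // mulr_gt0 // exprn_gt0 // expR_gt0.
have real (a : R[i]) : complex.Im a = 0 -> a = (complex.Re a)%:C%C.
  by case: a => a b /= ->.
have muE := real mu imm; have nuE := real nu imn.
pose y v := complex.Re (z v / z 0).
have yz v : z v = (y v)%:C%C * z 0.
  have h : complex.Im (z v / z 0) = 0.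
    have g w (s : R) : complex.Im (s%:C%C * w) = s * complex.Im w.
      by case: w => ? ? /=; ring.
    pose m0 := complex.Re mu; pose n0 := complex.Re nu.
    have m00 : m0 != 0.
      apply/eqP => m0E; have := z0 (0 + hex_dir 0).
      by rewrite /z c1 muE -/m0 m0E mul0r eqxx.
    have n00 : n0 != 0.
      apply/eqP => m0E; have := z0 (0 + hex_dir 1).
      by rewrite /z c2 nuE -/n0 m0E mul0r eqxx.
    have q : forall v, `[< complex.Im (z v / z 0) = 0 >] =
        `[< complex.Im (z 0 / z 0) = 0 >].
      apply: hex_period => w; apply: asbool_equiv_eq.
        rewrite /z c1 muE -/m0 -mulrA g; split=> [/eqP|->]; last by rewrite mulr0.
        by rewrite mulf_eq0 (negPf m00) => /eqP.
      rewrite /z c2 nuE -/n0 -mulrA g; split=> [/eqP|->]; last by rewrite mulr0.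
      by rewrite mulf_eq0 (negPf n00) => /eqP.
    by apply/asboolP; rewrite q divff //; apply/asboolP.
  by rewrite -real // divfK.
have yc v : y v ^+ 2 * csq (z 0) = csq (z v).
  by rewrite [in RHS]yz csqM /csq /=; ring.
have y1 : y 0 = 1 by rewrite /y divff.
have y0 v : y v != 0.
  by apply/eqP => e; have := z0 v; rewrite yz e mul0r eqxx.
have csq0 : 0 < csq (z 0) by rewrite zc mulr_gt0 // exprn_gt0 // expR_gt0.
have inj (a b : R) : a%:C%C * z 0 = b%:C%C * z 0 -> a = b.
  by move/(mulIf (z0 0)) => [].
have ym v : y (v + hex_dir 0) = complex.Re mu * y v.
  apply: inj; rewrite -yz /z c1 {1}muE -/(z v) [in LHS]yz rmorphM mulrA; done.
have yn v : y (v + hex_dir 1) = complex.Re nu * y v.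
  apply: inj; rewrite -yz /z c2 {1}nuE -/(z v) [in LHS]yz rmorphM mulrA; done.
exists y, (Num.sqrt (csq (z 0))); split=> //.
- by rewrite sqrtr_gt0.
- move=> v t; apply: (mulIf (invr_neq0 (y0 v))); rewrite mulfK //.
  have := hex_period (f := fun v => y (v + hex_dir t) / y v) _ _ v.
  rewrite add0r y1 divr1; apply=> w.
    rewrite addrAC !ym; field; rewrite y0 /=.
    by apply/eqP => e; have := y0 (w + hex_dir 0); rewrite ym e mul0r eqxx.
  rewrite addrAC !yn; field; rewrite y0 /=.
  by apply/eqP => e; have := y0 (w + hex_dir 1); rewrite yn e mul0r eqxx.
- move=> v t; rewrite -plen sqd_csq exprMn sqr_sqrtr ?(ltW csq0) //.
  have -> : toC (phi (v + hex_dir t)) - toC (phi v) =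
      (y (v + hex_dir t) - y v)%:C%C * z 0.
    by rewrite rmorphB mulrBl -!yz /z; ring.
  by rewrite csqM /csq /=; ring.
move=> F e e0.
pose a := complex.Re (z 0); pose b := complex.Im (z 0); pose N := csq (z 0).
have NE : N = a ^+ 2 + b ^+ 2 by [].
have N0 : N != 0 by rewrite lt0r_neq0.
pose c1' := complex.Re c; pose c2' := complex.Im c.
have B0 : 0 < `|a| + `|b| + 1 by rewrite ltr_wpDl // addr_ge0.
have e'0 : 0 < e * N / (`|a| + `|b| + 1) by rewrite divr_gt0 // mulr_gt0.
have [psi [or fd ap]] := papp F _ e'0.
(* Subtraction of [c] and division by [z 0], in real coordinates: the line of the layout becomes the
   first axis. *)
pose psi' v : plane := ((a * ((psi v).1 - c1') + b * ((psi v).2 - c2')) / N,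
  (a * ((psi v).2 - c2') - b * ((psi v).1 - c1')) / N).
have aff v : psi v = affine a (- b) b a c1' c2' (psi' v).
  rewrite [LHS]surjective_pairing /affine /psi' /=.
  by congr pair; rewrite NE in N0 *; field.
exists psi'; split.
- by apply: oriented_affine aff _ or; rewrite mulNr opprK -!expr2 -NE.
- exact: faces_disjoint_affine aff fd.
move=> v vF; have [h1 h2] := ap v vF.
have yE : y v = (a * ((phi v).1 - c1') + b * ((phi v).2 - c2')) / N.
  have := yz v; rewrite /z -/(z 0).
  have -> : z 0 = (a +i* b)%C by rewrite /a /b; case: (z 0).
  have -> : c = (c1' +i* c2')%C by rewrite /c1' /c2'; case: (c).
  rewrite /toC; simpc => -[-> ->].
  by rewrite NE in N0 *; field.
have -> : (psi' v).1 - y v = (a * (psi v - phi v).1 + b * (psi v - phi v).2) / N.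
  by rewrite yE /psi' /=; field.
rewrite normrM normfV (gtr0_norm csq0) ltr_pdivrMr //.
apply: le_lt_trans (ler_normD _ _) _; rewrite !normrM.
set E := e * N / _ in h1 h2 e'0.
have -> : e * csq (z 0) = `|a| * E + `|b| * E + E.
  by rewrite /E -/N; field; rewrite lt0r_neq0.
apply: le_lt_trans (_ : `|a| * E + `|b| * E < _); last by rewrite ltrDl.
by apply: lerD; apply: ler_wpM2l; rewrite // ltW.
Qed.

End DegenerateLayout.

Section LinearRigidity.
Variables (R : realType) (p : nat -> R).
Hypothesis p3 : forall t, p t.+3 = p t.
Hypothesis pN1 : forall t, -1 < p t.

Section Spiral.
Variables (u y : vertex -> R) (Z : R).
Hypothesis wl : weights_large p.
Hypothesis fu : flat_label p u.
Hypothesis Z0 : 0 < Z.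
Hypothesis y1 : y 0 = 1.
Hypothesis yD : forall v t, y (v + hex_dir t) = y (hex_dir t) * y v.
Hypothesis ylen : forall v t, ((y (v + hex_dir t) - y v) * Z) ^+ 2 = len2 p u v t.
Let M t := y (hex_dir t).

Lemma spiral6 t : M (t + 6) = M t.
Proof. by rewrite /M hex_dir6. Qed.

Lemma spiralS t : M t.+1 = M t * M t.+2.
Proof. by rewrite /M hex_dirS yD mulrC. Qed.

Lemma spiralN t : M t * M t.+3 = 1.
Proof. by rewrite mulrC -yD hex_dirN subrr y1. Qed.

Lemma len2_gt0 v t : 0 < len2 p u v t.
Proof.
have [w0 _] := wl t.
by rewrite ltr_wpDr ?mulr_ge0 ?expR_ge0 // addr_gt0 // exprn_gt0 // expR_gt0.
Qed.

Lemma spiral_neq1 t : M t != 1.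
Proof.
apply/eqP => e; have := ylen 0 t; have := len2_gt0 0 t.
rewrite add0r y1 -/(M t) e subrr mul0r expr0n /= => h h'.
by move: h; rewrite -h' ltxx.
Qed.

(** The last hypothesis puts [M s] strictly between 1 and [M t]: the face is degenerate with its
    flat vertex opposite to spoke [t], and [between_neg] applies. *)
Lemma spiral_hnum_lt0 t s c : 0 <= c ->
  ((M t - M s) * Z) ^+ 2 = expR (u (hex_dir t)) ^+ 2 + expR (u (hex_dir s)) ^+ 2
    + 2 * expR (u (hex_dir t)) * expR (u (hex_dir s)) * c ->
  0 < (M s - 1) * (M t - M s) ->
  hnum (p t) (p s) c (rratio u 0 t) (rratio u 0 s) < 0.
Proof.
move=> c0 rim btw; rewrite /rratio !add0r !expRB.
have len i : (`|M i - 1| * Z) ^+ 2 = expR (u 0) ^+ 2 + expR (u (hex_dir i)) ^+ 2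
    + 2 * expR (u 0) * expR (u (hex_dir i)) * p i.
  by have := ylen 0 i; rewrite add0r y1 /len2 add0r => <-; rewrite !exprMn real_normK ?num_real.
have [pt _] := wl t; have [ps _] := wl s.
have ne : M s - 1 != 0 /\ M t - M s != 0.
  by split; apply/eqP => e; move: btw; rewrite e ?mul0r ?mulr0 ltxx.
have sum : `|M t - 1| = `|M s - 1| + `|M t - M s|.
  have [h|h] := ltP 0 (M s - 1).
    have h' : 0 < M t - M s by rewrite -(pmulr_rgt0 _ h).
    by rewrite !gtr0_norm //; lra.
  have {}h : M s - 1 < 0 by rewrite lt_neqAle h ne.1.
  have h' : M t - M s < 0 by rewrite -(nmulr_rgt0 _ h).
  by rewrite !ltr0_norm //; lra.
have n1 : 0 < `|M s - 1| by rewrite normr_gt0 ne.1.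
have n2 : 0 < `|M t - M s| by rewrite normr_gt0 ne.2.
apply: (@between_neg R _ _ _ _ _ _ (`|M t - 1| * Z) (`|M s - 1| * Z) (`|M t - M s| * Z));
  rewrite ?expR_gt0 ?len ?mulr_gt0 //; first by rewrite sum addr_gt0.
  by rewrite exprMn real_normK ?num_real // -exprMn.
by rewrite sum mulrDl.
Qed.

(** Otherwise spoke [t = k - 1] has [M t = M t.+1 * M (t + 5)] with both factors on the same side of
    1. Its end lies beyond both neighbouring ends, both faces along it have their flat vertex
    opposite to it, and the Delaunay sum is negative. *)
Lemma spiral_not_positive k : 0 < M k -> 0 < M k.+1 -> 0 <= (M k - 1) * (M k.+1 - 1).
Proof.
move=> k0 k1; rewrite leNgt; apply/negP => neg.
have [sn _ sd] := fu.
pose t := (k + 5)%N; have a : M t.+1 = M k by rewrite /t -addnS spiral6.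
have b : M k.+1 * M (t + 5)%N = 1.
  by rewrite /t -addnA -[(5 + 5)%N]/(4 + 6)%N addnA spiral6 addnC spiralN.
have b0 : 0 < M (t + 5)%N by rewrite -(pmulr_rgt0 _ k1) b.
have ab : M t = M (t + 5)%N * M t.+1.
  have e : (t + 5).+2 = (t.+1 + 6)%N by rewrite addSn -!addnS.
  by have := spiralS (t + 5); rewrite e spiral6 -addnS spiral6.
have pos : 0 < (M t.+1 - 1) * (M (t + 5)%N - 1).
  rewrite a -(pmulr_lgt0 _ k1).
  have -> : (M k - 1) * (M (t + 5)%N - 1) * M k.+1 = - ((M k - 1) * (M k.+1 - 1)).
    rewrite -mulrA [(M (t + 5)%N - 1) * _]mulrBl mul1r [M (t + 5)%N * _]mulrC b; ring.
  by rewrite oppr_gt0.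
have p5 : p (t + 5)%N = p t.+2 by rewrite addnC -[(5 + t)%N]/t.+2.+3 p3.
have p7 : p (t + 5)%N.+2 = p t.+1 by rewrite addnC -[(5 + t)%N.+2]/t.+1.+3.+3 !p3.
have n1 : hnum (p t) (p t.+1) (p t.+2) (rratio u 0 t) (rratio u 0 t.+1) < 0.
  apply: spiral_hnum_lt0; first by case: (wl t.+2).
    rewrite /M hex_dirS -[X in X * Z]opprB mulNr sqrrN ylen /len2; ring.
  by rewrite ab; have := mulr_gt0 pos (_ : 0 < M t.+1); rewrite a; nra.
have n2 : hnum (p t) (p t.+2) (p t.+1) (rratio u 0 t) (rratio u 0 (t + 5)%N) < 0.
  rewrite -p5; apply: spiral_hnum_lt0; first by case: (wl t.+1).
    have e : hex_dir t = hex_dir (t + 5) + hex_dir (t + 5).+2.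
      by rewrite -hex_dirS -addnS hex_dir6.
    by rewrite /M {1}e ylen /len2 -e p7; ring.
  by rewrite ab; have := mulr_gt0 pos b0; nra.
have := sd wl 0 t; rewrite leNgt => /negP; apply.
have [_ g1] := wl t; have d1 := sn 0 t.
have [_ g2] := wl (t + 5)%N; have d2 := sn 0 (t + 5)%N.
rewrite p5 p7 in g2 d2.
have p6 : p (t + 5).+1 = p t by rewrite addnC -[(5 + t)%N.+1]/t.+3.+3 !p3.
have r6 : rratio u 0 (t + 5).+1 = rratio u 0 t by rewrite /rratio -addnS hex_dir6.
rewrite p6 r6 in g2 d2.
have {}g2 : GG (p t) (p t.+2) (p t.+1) < 0.
  by move: g2; congr (_ < _); rewrite /GG; ring.
have {}d2 : 0 <= DD (p t) (p t.+2) (p t.+1) (rratio u 0 t) (rratio u 0 (t + 5)%N).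
  by move: d2; congr (_ <= _); rewrite /DD /NN; ring.
have q1 := QQ_gt0 g1 d1; have q2 := QQ_gt0 g2 d2.
have m1 : mm (p t) (p t.+1) (p t.+2) (rratio u 0 t) (rratio u 0 t.+1) < 0.
  by rewrite /mm pmulr_llt0 // invr_gt0 sqrtr_gt0.
have m2 : mm (p t) (p t.+2) (p t.+1) (rratio u 0 t) (rratio u 0 (t + 5)%N) < 0.
  by rewrite /mm pmulr_llt0 // invr_gt0 sqrtr_gt0.
by lra.
Qed.

(** If [M 0] and [M 1] were positive, [M 0] to [M 3] would lie on one side of 1, against
    [M 0 * M 3 = 1]. So the sign changes somewhere; if the positive factor is below 1, the opposite
    directions have the reciprocal factors. *)
Lemma spiral_neg : exists t, 1 < M t /\ M t.+1 < 0.
Proof.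
have n0 t : M t != 0.
  by apply/eqP => e; have := spiralN t; rewrite e mul0r => /eqP; rewrite eq_sym oner_eq0.
have [k [k0 k1]] : exists k, 0 < M k /\ M k.+1 < 0.
  have neg t : M t <= 0 -> M t < 0 by rewrite lt_neqAle n0.
  have [m0|/neg m0] := ltP 0 (M 0).
    have [m1|/neg m1] := ltP 0 (M 1%N); last by exists 0%N.
    have m2 : 0 < M 2 by rewrite -(pmulr_rgt0 _ m0) -spiralS.
    have m3 : 0 < M 3 by rewrite -(pmulr_rgt0 _ m0) spiralN.
    have h0 := spiral_not_positive m0 m1; have h1 := spiral_not_positive m1 m2.
    have h2 := spiral_not_positive m2 m3; have inv := spiralN 0.
    have u0 := spiral_neq1 0; have u1 := spiral_neq1 1; have u2 := spiral_neq1 2.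
    have u3 := spiral_neq1 3; exfalso.
    have st a b : 0 <= (M a - 1) * (M b - 1) -> M a != 1 -> 1 < M a -> M b != 1 -> 1 < M b.
      move=> h _ a1 b1; rewrite lt_neqAle eq_sym b1 /= -subr_ge0.
      by rewrite -(pmulr_rge0 _ (_ : 0 < M a - 1)) ?subr_gt0.
    have st' a b : 0 <= (M a - 1) * (M b - 1) -> M a < 1 -> M b != 1 -> M b < 1.
      move=> h a1 b1; rewrite lt_neqAle b1 /= -subr_le0.
      by rewrite -(nmulr_rge0 _ (_ : M a - 1 < 0)) ?subr_lt0.
    have [m|m] := ltP 1 (M 0).
      have m' := st _ _ h2 u2 (st _ _ h1 u1 (st _ _ h0 u0 m u1) u2) u3.
      have : 1 < M 0 * M 3 by rewrite mulr_egt1.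
      by rewrite inv ltxx.
    have {}m : M 0 < 1 by rewrite lt_neqAle u0.
    have m' := st' _ _ h2 (st' _ _ h1 (st' _ _ h0 m u1) u2) u3.
    have : M 0 * M 3 < 1 by rewrite mulr_ilt1 // ltW.
    by rewrite inv ltxx.
  have [m1|/neg m1] := ltP 0 (M 1%N).
    exists 1%N; split=> //; rewrite -(nmulr_rgt0 _ m0) -spiralS //.
  exists 2; split; first by rewrite -(nmulr_rlt0 _ m0) -spiralS.
  by rewrite -(nmulr_rgt0 _ m0) spiralN.
have inv := spiralN k; have inv1 := spiralN k.+1.
have [h|h] := ltP 1 (M k); first by exists k.
have {}h : M k < 1 by rewrite lt_neqAle spiral_neq1.
exists k.+3; split; last by rewrite -(nmulr_rgt0 _ k1) inv1.
by rewrite -(ltr_pM2l k0) inv mulr1.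
Qed.

End Spiral.

Hypothesis wp : weights_small p \/ weights_large p.

Lemma linear_label_const u S S' : flat_label p u -> embeddable_label p u ->
  (forall v, u (v + hex_dir 0) = u v + S) ->
  (forall v, u (v + hex_dir 1) = u v + S') -> S = 0 /\ S' = 0.
Proof.
move=> fu eu uS uS'; apply: contrapT => SS.
have disc t := linear_nondegenerate pN1 eu uS uS' SS t.
case: wp => [ws|wl].
  have [sw reg] := ws 0%N; have := disc 0%N.
  rewrite (lin_discE p (linear_slope uS uS') 0) leNgt => /negP; apply.
  rewrite mulr_gt0 ?exprn_gt0 ?mulr_gt0 ?expR_gt0 //.
  by apply: DD_gt0_small; rewrite ?expR_gt0.
have [y [Z [[Z0 y1] y0 yD ylen app]]] := collinear_layout pN1 eu uS uS' SS.
have [t [t1 tn]] := spiral_neg wl fu Z0 y1 yD ylen.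
by apply: (no_alternating_spiral t1 tn y1 (fun v => yD v t) (fun v => yD v t.+1)).
Qed.

End LinearRigidity.

(** * Angles and centers of the faces *)

Section FaceGeometry.
Variables (R : realType) (I : vertex -> vertex -> R) (u : vertex -> R).
Variables i j k : vertex.
Local Notation l := (cp_length I u).
Let p := I i j.
Let q := I i k.
Let c := I j k.
Let s := expR (u i - u j).
Let t := expR (u i - u k).
Hypothesis hp : -1 < p.
Hypothesis hq : -1 < q.
Hypothesis hc : -1 < c.

Let s0 : 0 < s := expR_gt0 _.
Let t0 : 0 < t := expR_gt0 _.
Let z1 : 0 < zz p s := zz_gt0 hp s0.
Let z2 : 0 < zz q t := zz_gt0 hq t0.

Lemma cp_length_sqr a b : -1 < I a b ->
  l a b ^+ 2 = expR (u a) ^+ 2 + expR (u b) ^+ 2 + 2 * expR (u a) * expR (u b) * I a b.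
Proof.
move=> h; rewrite /cp_length sqr_sqrtr //.
have ra := expR_gt0 (u a); have rb := expR_gt0 (u b).
have : 0 <= 2 * (expR (u a) * expR (u b)) * (1 + I a b).
  by rewrite mulr_ge0 ?mulr_ge0 ?ltW //; lra.
by have := sqr_ge0 (expR (u a) - expR (u b)); lra.
Qed.

Lemma cp_lengthE a b : l a b = expR (u b) * Num.sqrt (zz (I a b) (expR (u a - u b))).
Proof.
rewrite -[X in X * _]gtr0_norm ?expR_gt0 // -sqrtr_sqr -sqrtrM ?sqr_ge0 //.
rewrite /cp_length; congr Num.sqrt; rewrite /zz expRB; field.
by rewrite lt0r_neq0 ?expR_gt0.
Qed.

Lemma cp_cosine : l i j ^+ 2 + l i k ^+ 2 - l j k ^+ 2 =
  2 * (expR (u j) * expR (u k)) * NN p q c s t.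
Proof.
rewrite !cp_length_sqr // /NN /s /t /p /q /c !expRB; field.
by rewrite !lt0r_neq0 ?expR_gt0.
Qed.

Lemma inner_angle_ang : inner_angle l i j k = ang p q c s t.
Proof.
rewrite /inner_angle cp_cosine !cp_lengthE /ang; congr acos.
rewrite -/p -/q -/s -/t; field.
by rewrite !lt0r_neq0 ?expR_gt0 ?sqrtr_gt0.
Qed.

Lemma heron : 4 * (expR (u j) * expR (u k)) ^+ 2 * DD p q c s t =
  (l i j + l i k + l j k) * (l i k + l j k - l i j) *
  (l i j + l j k - l i k) * (l i j + l i k - l j k).
Proof.
have -> : 4 * (expR (u j) * expR (u k)) ^+ 2 * DD p q c s t =
   4 * l i j ^+ 2 * l i k ^+ 2 - (l i j ^+ 2 + l i k ^+ 2 - l j k ^+ 2) ^+ 2.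
  rewrite cp_cosine !cp_lengthE !exprMn !sqr_sqrtr ?ltW // /DD; ring.
by ring.
Qed.

Lemma DD_triangle : 0 < l i j -> 0 < l i k -> 0 < l j k -> l i j <= l i k + l j k ->
  l i k <= l i j + l j k -> l j k <= l i j + l i k -> 0 <= DD p q c s t.
Proof.
move=> a b d e f g; have := heron.
have r0 : 0 < 4 * (expR (u j) * expR (u k)) ^+ 2.
  by rewrite mulr_gt0 // exprn_gt0 // mulr_gt0 ?expR_gt0.
rewrite -(pmulr_rge0 _ r0) => ->.
by rewrite !mulr_ge0 ?subr_ge0 //; lra.
Qed.

Lemma DD_triangle_strict : 0 < l i j -> 0 < l i k -> 0 < l j k -> l i j < l i k + l j k ->
  l i k < l i j + l j k -> l j k < l i j + l i k -> 0 < DD p q c s t.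
Proof.
move=> a b d e f g; have := heron.
have r0 : 0 < 4 * (expR (u j) * expR (u k)) ^+ 2.
  by rewrite mulr_gt0 // exprn_gt0 // mulr_gt0 ?expR_gt0.
rewrite -(pmulr_rgt0 _ r0) => ->.
by rewrite !mulr_gt0 ?subr_gt0 //; lra.
Qed.

Lemma d_E : d_ I u i j = expR (u i) * (s + p) / Num.sqrt (zz p s).
Proof.
have Z0 : 0 < Num.sqrt (zz p s) by rewrite sqrtr_gt0.
rewrite /d_ cp_lengthE -/p -/s; move: (Num.sqrt _) Z0 => Z Z0.
by rewrite /s expRB; field; rewrite !lt0r_neq0 ?expR_gt0.
Qed.

(** The point with abscissa [d_] and the claimed ordinate satisfies the equations of the center;
    uniqueness identifies it with the chosen one. *)
Lemma h_E : 0 < DD p q c s t ->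
  h_ I u i j k = expR (u i) * hnum p q c s t / (Num.sqrt (DD p q c s t) * Num.sqrt (zz p s)).
Proof.
move=> D0; have ri := expR_gt0 (u i); have rj := expR_gt0 (u j); have rk := expR_gt0 (u k).
pose Z := Num.sqrt (zz p s); have Z0 : 0 < Z by rewrite sqrtr_gt0.
pose Y := Num.sqrt (zz q t); have Y0 : 0 < Y by rewrite sqrtr_gt0.
pose Q := Num.sqrt (DD p q c s t); have Q0 : 0 < Q by rewrite sqrtr_gt0.
have Z2 : Z ^+ 2 = zz p s by rewrite sqr_sqrtr // ltW.
have Y2 : Y ^+ 2 = zz q t by rewrite sqr_sqrtr // ltW.
have Q2 : Q ^+ 2 = DD p q c s t by rewrite sqr_sqrtr // ltW.
have lij : l i j = expR (u j) * Z := cp_lengthE i j.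
have bound := DD_cos_bound z1 z2 (ltW D0).
have apexE : apex l i j k = (expR (u k) * NN p q c s t / Z, expR (u k) * Q / Z).
  rewrite /apex inner_angle_ang cp_lengthE -/q -/t -/Y /ang.
  rewrite acosK // sin_acos // -/Z -/Y; congr pair.
    by field; rewrite !lt0r_neq0.
  have -> : 1 - (NN p q c s t / (Z * Y)) ^+ 2 = (Q / (Z * Y)) ^+ 2.
    by rewrite !expr_div_n Q2 /DD -Z2 -Y2; field; rewrite !lt0r_neq0.
  rewrite sqrtr_sqr gtr0_norm ?divr_gt0 ?mulr_gt0 //.
  by field; rewrite !lt0r_neq0.
have lij0 : l i j != 0 by rewrite lij lt0r_neq0 // mulr_gt0.
have ap0 : (apex l i j k).2 != 0 by rewrite apexE /= lt0r_neq0 // divr_gt0 // mulr_gt0.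
have [x [hx ux]] := geometric_center_unique (expR (u i)) (expR (u j)) (expR (u k)) lij0 ap0.
rewrite /h_ -/Z -/Q.
set A := [set _ | _]; have : A (xget 0 A) by apply: (@xgetPex _ 0 A); exists x.
move=> /ux <-.
pose y : R * R := (d_ I u i j, expR (u i) * hnum p q c s t / (Q * Z)).
suff /ux -> : geometric_center (0, 0) (l i j, 0) (apex l i j k)
  (expR (u i)) (expR (u j)) (expR (u k)) y by [].
have powE (a b : R * R) r : power a b r = (a.1 - b.1) ^+ 2 + (a.2 - b.2) ^+ 2 - r ^+ 2.
  by rewrite /power /dist sqr_sqrtr // addr_ge0 ?sqr_ge0.
have es : expR (u i) = s * expR (u j) by rewrite /s expRB divfK // lt0r_neq0.
have et : expR (u i) = t * expR (u k) by rewrite /t expRB divfK // lt0r_neq0.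
rewrite /geometric_center !powE lij apexE /y d_E -/Z /=.
clear ux hx ap0 apexE y lij0 lij bound A; clearbody Z Y Q.
split.
  have -> : expR (u i) ^+ 2 = s ^+ 2 * expR (u j) ^+ 2 by rewrite es exprMn.
  apply/eqP; rewrite -subr_eq0; apply/eqP.
  rewrite [X in X = _](_ : _ = expR (u j) * (2 * expR (u i) * (s + p)
     - expR (u j) * (Z ^+ 2 + s ^+ 2 - 1))); last by field; rewrite !lt0r_neq0.
  by rewrite Z2 es /zz; ring.
apply/eqP; rewrite -subr_eq0; apply/eqP.
have h2 : (Z ^+ 2) * Y ^+ 2 = Q ^+ 2 + NN p q c s t ^+ 2.
  by rewrite Z2 Y2 Q2 /DD; ring.
rewrite [X in X = _](_ : _ = expR (u k) * (2 * expR (u i) * ((s + p) * NN p q c s t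
     + hnum p q c s t) / Z ^+ 2
     - expR (u k) * (Q ^+ 2 + NN p q c s t ^+ 2) / Z ^+ 2) + expR (u k) ^+ 2 - expR (u i) ^+ 2);
  last by field; rewrite !lt0r_neq0.
rewrite -h2 et hnumE Z2 Y2 /zz; move: z1; rewrite /zz => z1'.
by field; rewrite lt0r_neq0.
Qed.

End FaceGeometry.

Section Theta.
Variables (R : realType) (I : vertex -> vertex -> R) (u : vertex -> R).

Lemma sin_atan (x : R) : sin (atan x) = x / Num.sqrt (1 + x ^+ 2).
Proof.
have c0 : cos (atan x) != 0.
  by rewrite cos_atan invr_neq0 // lt0r_neq0 // sqrtr_gt0 ltr_wpDr ?sqr_ge0.
by rewrite -cos_atan -{2}[x]atanK /tan divfK.
Qed.

Variables i j k : vertex.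
Local Notation l := (cp_length I u).
Let p := I i j.
Let q := I i k.
Let c := I j k.
Let s := expR (u i - u j).
Let t := expR (u i - u k).
Hypothesis hp : 0 <= p.
Hypothesis hq : 0 <= q.
Hypothesis hc : 0 <= c.
Hypothesis G0 : GG p q c < 0.
Hypothesis tij : l i j <= l i k + l j k.
Hypothesis tik : l i k <= l i j + l j k.
Hypothesis tjk : l j k <= l i j + l i k.

(** On non-degenerate faces [d_] is positive, and [DD] cancels from the sine of [atan (h_ / d_)]. On
    degenerate ones the right-hand side is 1 or -1 by the sign of [hnum], in agreement with the
    values [pi / 2] and [- (pi / 2)] of [theta_]. *)
Lemma theta_sin : - (pi / 2) <= theta_ I u i j k <= pi / 2 /\
  sin (theta_ I u i j k) = mm p q c s t / Num.sqrt (zz p s).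
Proof.
have N1 (x : R) : 0 <= x -> -1 < x by move=> h; apply: lt_le_trans h; rewrite ltrN10.
have pi0 : 0 < pi / 2 :> R by rewrite divr_gt0 ?pi_gt0.
have s0 : 0 < s := expR_gt0 _; have t0 : 0 < t := expR_gt0 _.
have z1 : 0 < zz p s := zz_gt0 (N1 _ hp) s0.
have z2 : 0 < zz q t := zz_gt0 (N1 _ hq) t0.
have lpos a b : 0 <= I a b -> 0 < l a b.
  by move=> h; rewrite cp_lengthE mulr_gt0 ?expR_gt0 // sqrtr_gt0 zz_gt0 ?expR_gt0 ?N1.
have [a b d] := And3 (lpos _ _ hp) (lpos _ _ hq) (lpos _ _ hc).
have D0 : 0 <= DD p q c s t := DD_triangle (N1 _ hp) (N1 _ hq) (N1 _ hc) a b d tij tik tjk.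
have Q0 := QQ_gt0 G0 D0.
have key : hnum p q c s t ^+ 2 + (s + p) ^+ 2 * DD p q c s t = zz p s * QQ p q c s t.
  by rewrite /hnum /DD /zz /QQ /NN; ring.
have Z0 : 0 < Num.sqrt (zz p s) by rewrite sqrtr_gt0.
have rQ0 : 0 < Num.sqrt (QQ p q c s t) by rewrite sqrtr_gt0.
have sq a' b' := @cp_length_sqr R I u a' b'.
have deg : DD p q c s t = 0 ->
    mm p q c s t / Num.sqrt (zz p s) = if 0 < hnum p q c s t then 1 else -1.
  move=> e; move: key; rewrite e mulr0 addr0 => key.
  have E : `|hnum p q c s t| = Num.sqrt (zz p s) * Num.sqrt (QQ p q c s t).
    by rewrite -sqrtrM ?ltW // -key sqrtr_sqr.
  case: ltrP => h; rewrite /mm.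
    by rewrite -[X in X / _ / _](gtr0_norm h) E; field; rewrite !lt0r_neq0.
  by rewrite -[X in X / _ / _]opprK -(ler0_norm h) E; field; rewrite !lt0r_neq0.
have her := heron u (N1 _ hp) (N1 _ hq) (N1 _ hc).
have r0 : 4 * (expR (u j) * expR (u k)) ^+ 2 != 0.
  by rewrite mulf_neq0 // expf_neq0 // mulf_neq0 // lt0r_neq0 // expR_gt0.
have sE : s = expR (u i) / expR (u j) by rewrite /s expRB.
have tE : t = expR (u i) / expR (u k) by rewrite /t expRB.
rewrite /theta_; case: eqP => [e1|n1].
  rewrite sinN sin_pihalf deg; last by apply: (mulfI r0); rewrite her e1; ring.
  have : hnum p q c s t < 0.
    rewrite sE tE; apply: (@between_neg R _ _ _ p q c (l i j) (l i k) (l j k));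
      rewrite ?expR_gt0 ?sq ?N1 //.
  move=> h; split; first by apply/andP; split; lra.
  by rewrite [_ < hnum _ _ _ _ _]ltNge (ltW h).
case: orP => [e2|n2].
  rewrite sin_pihalf; split; first by lra.
  rewrite deg; last first.
    by apply: (mulfI r0); rewrite her; case: e2 => /eqP ->; ring.
  suff -> : 0 < hnum p q c s t by [].
  have f0 : 0 < s + p by rewrite ltr_pwDl.
  have f'0 : 0 < t + q by rewrite ltr_pwDl.
  case: e2 => /eqP e2.
    have : NN p q c s t < 0.
      have := @cp_cosine R I u i j k (N1 _ hp) (N1 _ hq) (N1 _ hc); rewrite e2 => h.
      have r1 : 0 < 2 * (expR (u j) * expR (u k)) by rewrite !mulr_gt0 ?expR_gt0.
      rewrite -(pmulr_rlt0 _ r1) -h; have := mulr_gt0 a b.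
      by move: (l i j) (l i k) => x y xy; lra.
    move=> N0; rewrite hnumE; have h1 := mulr_gt0 z1 f'0.
    have h2 : (s + p) * NN p q c s t < 0 by rewrite pmulr_rlt0.
    by lra.
  (* The flat vertex is [j], opposite to the side [i k]. There [hnum] is negative, and the positive
     combination of the two in [e] is [QQ > 0]. *)
  have n : hnum q p c t s < 0.
    rewrite sE tE; apply: (@between_neg R _ _ _ q p c (l i k) (l i j) (l j k));
      rewrite ?expR_gt0 ?sq ?N1 //.
    by rewrite -/c; ring.
  have e : hnum p q c s t * (t + q) + hnum q p c t s * (s + p) = QQ p q c s t.
    by rewrite /hnum /QQ; ring.
  have h2 : hnum q p c t s * (s + p) < 0 by rewrite pmulr_llt0.
  have : 0 < hnum p q c s t * (t + q) by lra.
  by rewrite pmulr_lgt0.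
have D1 : 0 < DD p q c s t.
  apply: (DD_triangle_strict (N1 _ hp) (N1 _ hq) (N1 _ hc)) => //; rewrite lt_neqAle.
  - by rewrite tij andbT; apply/eqP.
  - by rewrite tik andbT; apply/negP => e; apply: n2; right.
  - by rewrite tjk andbT; apply/negP => e; apply: n2; left.
have d0 : 0 < d_ I u i j by rewrite d_E ?N1 // divr_gt0 // mulr_gt0 ?expR_gt0 // ltr_pwDl ?expR_gt0.
rewrite ltNge (ltW d0) /= gt_eqF // sin_atan; split.
  by rewrite (ltW (atan_gtNpi2 _)) (ltW (atan_ltpi2 _)).
have f0 : 0 < s + p by rewrite ltr_pwDl.
rewrite (h_E (N1 _ hp) (N1 _ hq) (N1 _ hc)) // d_E ?N1 //.
rewrite -/p -/q -/c -/s -/t /mm.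
have rD0 : 0 < Num.sqrt (DD p q c s t) by rewrite sqrtr_gt0.
have D2 : Num.sqrt (DD p q c s t) ^+ 2 = DD p q c s t by rewrite sqr_sqrtr // ltW.
have Z2 : Num.sqrt (zz p s) ^+ 2 = zz p s by rewrite sqr_sqrtr // ltW.
have Q2 : Num.sqrt (QQ p q c s t) ^+ 2 = QQ p q c s t by rewrite sqr_sqrtr // ltW.
rewrite -D2 -Z2 -Q2 in key; move: key; clear D2 Z2 Q2.
move: (Num.sqrt (DD _ _ _ _ _)) (Num.sqrt (QQ _ _ _ _ _)) (Num.sqrt (zz _ _)) rD0 rQ0 Z0.
have ri := expR_gt0 (u i); move: (hnum _ _ _ _ _) (expR (u i)) ri => h r ri D Q Z rD rQ rZ key.
have -> : r * h / (D * Z) / (r * (s + p) / Z) = h / ((s + p) * D).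
  by field; rewrite !lt0r_neq0.
have -> : Num.sqrt (1 + (h / ((s + p) * D)) ^+ 2) = Z * Q / ((s + p) * D).
  have -> : 1 + (h / ((s + p) * D)) ^+ 2 = (Z * Q / ((s + p) * D)) ^+ 2.
    rewrite !expr_div_n [in RHS]exprMn -key; field.
    by rewrite !lt0r_neq0.
  by rewrite sqrtr_sqr gtr0_norm // divr_gt0 // mulr_gt0.
by field; rewrite !lt0r_neq0.
Qed.

End Theta.

Lemma sin_add_ge0 (R : realType) (x y : R) : - (pi / 2) <= x <= pi / 2 ->
  - (pi / 2) <= y <= pi / 2 -> 0 <= x + y -> 0 <= sin x + sin y.
Proof.
move=> hx hy h; rewrite -lerBlDl sub0r -sinN.
have hx' : - x \in `[(- (pi / 2)), (pi / 2)] by rewrite in_itv /= lerN2 lerNl andbC.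
have hy' : y \in `[(- (pi / 2)), (pi / 2)] by rewrite in_itv.
case: leP => //; rewrite ltr_sin // => e.
have : x + y < 0 by move: e; rewrite -subr_lt0 opprK addrC.
by rewrite ltNge h.
Qed.

(** * Weights and flat metrics *)

Section HexComplex.

Lemma adjP (a b : vertex) : reflect (exists t, b = a + hex_dir t) (adj a b).
Proof.
apply: (iffP idP) => [|[t ->]]; last first.
  rewrite /adj addrC addKr /hex_dir; apply: mem_nth.
  by rewrite /= ltn_pmod.
rewrite /adj => /(nthP 0)[t t6 e]; exists t.
by rewrite /hex_dir modn_small // e addrC subrK.
Qed.

Lemma hex_dir_neq0 t : hex_dir t != 0.
Proof.
rewrite -hex_dir_mod; have := ltn_pmod t (isT : (0 < 6)%N).
by move: (t %% 6)%N => [|[|[|[|[|[|]]]]]].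
Qed.

Lemma near_or_eq_adj a b : near_or_eq a b -> a != b -> adj a b.
Proof.
by case=> [->|[t ->]]; [rewrite eqxx|move=> _; apply/adjP; exists t].
Qed.

Lemma simplex_hexT a b c : simplex a b c -> hexT [fset a; b; c]%fset.
Proof.
case=> ab bc ac; split=> [|x y].
  by apply/negP => /eqP/fsetP/(_ a); rewrite !inE eqxx.
rewrite !inE -!orbA => hx hy xy; apply: near_or_eq_adj => //.
by case/or3P: hx => /eqP->; case/or3P: hy => /eqP->;
  try (by left); try assumption; apply: near_or_eq_sym.
Qed.

Lemma edge_hex v t : edge hexT v (v + hex_dir t).
Proof.
split.
  apply/eqP => e; have := hex_dir_neq0 t.
  by rewrite -[hex_dir t](addKr v) -e addNr eqxx.
have := simplex_hexT (simplex_edge (or_intror (ex_intro _ t erefl) : near_or_eq v (v + hex_dir t))).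
by rewrite fsetUid.
Qed.

Lemma face_hex v t : face hexT v (v + hex_dir t) (v + hex_dir t.+1).
Proof.
split; [exact: (edge_hex v t).1|exact: (edge_hex v t.+1).1| |].
  by rewrite hex_dirS addrA; apply: (edge_hex _ _).1.
exact/simplex_hexT/simplex_face.
Qed.

Lemma interior_hex v : interior_vertex hexT v.
Proof. by []. Qed.

End HexComplex.

Section Weights.
Variables (R : realType) (I : vertex -> vertex -> R).
Hypothesis hI : weight hexT I.
Hypothesis hreg : regular hexT I.
Hypothesis hrange : (forall i j, edge hexT i j -> - 2^-1 < I i j <= 1) \/
  (forall i j, edge hexT i j -> 0 <= I i j).
Hypothesis hinv : translation_invariant hexT I.
Hypothesis hstruct : structure_condition hexT I.

Definition dir_weight (t : nat) : R := I 0 (hex_dir t).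
Local Notation p := dir_weight.

Lemma weightE v t : I v (v + hex_dir t) = p t.
Proof.
have := hinv v (edge_hex 0 t); by rewrite !add0r [hex_dir t + v]addrC.
Qed.

Lemma weightE_rim v t : I (v + hex_dir t) (v + hex_dir t.+1) = p t.+2.
Proof. by rewrite hex_dirS addrA weightE. Qed.

Lemma weight_sym v t : I (v + hex_dir t) v = p t.
Proof. by have [<- _] := hI (edge_hex v t); apply: weightE. Qed.

Lemma dir_weight3 t : p t.+3 = p t.
Proof.
have e : hex_dir t.+3 + hex_dir t = 0 by rewrite hex_dirN addNr.
by rewrite -[RHS](weight_sym (hex_dir t.+3)) e.
Qed.

Lemma dir_weight_gtN1 t : -1 < p t.
Proof. by rewrite -(weightE 0); case: (hI (edge_hex 0 t)). Qed.

Lemma dir_weight_struct t : 0 <= p t + p t.+1 * p t.+2.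
Proof.
by have := hstruct (face_hex 0 t); rewrite weightE_rim !weightE.
Qed.

Lemma hex_dir5 t : hex_dir (t + 5) + hex_dir t.+1 = hex_dir t.
Proof.
have e : (t + 5).+2 = (t.+1 + 6)%N by rewrite addSn -!addnS.
by have := hex_dirS (t + 5); rewrite e hex_dir6 -addnS hex_dir6 => ->.
Qed.

(** The two faces along an edge carry the same two further weights in exchanged positions, so
    regularity excludes [p t = 1] with [p t.+1 = - p t.+2]. For nonnegative weights, one above 1
    makes [GG] negative, for every [t] by cyclic symmetry. *)
Lemma dir_weights : weights_small p \/ weights_large p.
Proof.
have small : (forall t, p t <= 1) -> weights_small p.
  move=> le1 t; split.
    split; try by rewrite dir_weight_gtN1 le1.
    have h0 := dir_weight_struct t; have h1 := dir_weight_struct t.+1.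
    have h2 := dir_weight_struct t.+2.
    rewrite !dir_weight3 in h1 h2.
    by split=> //; rewrite mulrC.
  move=> [p1 pq]; apply: hreg.
  exists 0, (0 + hex_dir t), (0 + hex_dir t.+1), (0 + hex_dir (t + 5)).
  have f : face hexT 0 (0 + hex_dir t) (0 + hex_dir (t + 5)).
    have := face_hex 0 (t + 5); rewrite -addnS hex_dir6 => -[e1 e2 e3 e4].
    split=> //; first by rewrite eq_sym.
    by rewrite -fsetUA [[fset _; _]%fset]fsetUC fsetUA.
  have q5 : p (t + 5)%N = p t.+2 by rewrite addnC -[(5 + t)%N]/t.+2.+3 dir_weight3.
  split; split.
  - exact: face_hex.
  - exact: f.
  - rewrite !add0r -addn1 hex_dir_modD [hex_dir (t + 5)]hex_dir_modD.
    by have := ltn_pmod t (isT : (0 < 6)%N); move: (t %% 6)%N => [|[|[|[|[|[|]]]]]].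
  - by rewrite weightE.
  - by rewrite weightE weightE_rim.
  rewrite weightE q5.
  have -> : I (0 + hex_dir t) (0 + hex_dir (t + 5)) = p t.+1.
    by rewrite -{1}(hex_dir5 t) addrA weight_sym.
  by rewrite pq opprK.
have [h|h] := hrange.
  by left; apply: small => t; rewrite -(weightE 0); have /andP[] := h _ _ (edge_hex 0 t).
have p0 t : 0 <= p t by rewrite -(weightE 0); apply: h; apply: edge_hex.
have ggS n : GG (p n.+1) (p n.+2) (p n.+3) = GG (p n) (p n.+1) (p n.+2).
  by rewrite dir_weight3 /GG; ring.
have gg a b c : 1 < a -> 0 <= b -> 0 <= c -> GG a b c < 0.
  move=> a1 b0 c0; have a0 : 0 <= a by lra.
  have h1 : 0 <= a * b * c by rewrite !mulr_ge0.
  have h2 : 1 < a ^+ 2 by rewrite exprn_egt1.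
  by rewrite /GG; have := sqr_ge0 b; have := sqr_ge0 c; lra.
have [[a1 b1 c1]|n1] := pselect [/\ p 0 <= 1, p 1%N <= 1 & p 2 <= 1].
  left; apply: small => t; suff [] : [/\ p t <= 1, p t.+1 <= 1 & p t.+2 <= 1] by [].
  by elim: t => [|t [h1 h2 h3]]; split; rewrite ?dir_weight3.
right=> t; split=> //; elim: t => [|t IH]; last by rewrite ggS.
have [a1|a1] := ltP 1 (p 0); first exact: gg.
have [b1|b1] := ltP 1 (p 1%N); first by rewrite -ggS gg.
have [c1|c1] := ltP 1 (p 2); first by rewrite -ggS -ggS gg.
by case: n1.
Qed.

End Weights.

Section FaceTriangles.
Variable R : realType.
Implicit Types (K : set {fset vertex}) (l : vertex -> vertex -> R).

Lemma face_swap K i j k : face K i j k -> face K i k j.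
Proof.
case=> e1 e2 e3 e4; split=> //; first by rewrite eq_sym.
by rewrite -fsetUA [[fset k; j]%fset]fsetUC fsetUA.
Qed.

Lemma face_rot K i j k : face K i j k -> face K j k i.
Proof.
case=> e1 e2 e3 e4; split=> //; rewrite 1?eq_sym //.
by rewrite fsetUC fsetUA.
Qed.

Lemma edge_sub K i j k : subcomplex K -> face K i j k -> edge K i j.
Proof.
case=> _ sub [ij ik jk f]; split=> //; apply: sub f _ _.
  by apply/negP => /eqP/fsetP/(_ i); rewrite !inE eqxx.
exact: fsubsetUl.
Qed.

Lemma subcomplex_hexT : subcomplex hexT.
Proof.
split=> // s t [_ h] t0 st; split=> // a b ha hb.
by apply: h; apply: (fsubsetP st).
Qed.

Lemma face_edges K i j k : subcomplex K -> face K i j k ->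
  [/\ edge K i j, edge K i k & edge K j k].
Proof.
move=> sK f; split; first exact: edge_sub f.
  exact: edge_sub (face_swap f).
exact: edge_sub (face_rot f).
Qed.

Lemma gen_PL_face K l i j k : subcomplex K -> gen_PL_metric K l -> face K i j k ->
  [/\ l i j <= l i k + l j k, l i k <= l i j + l j k & l j k <= l i j + l i k].
Proof.
move=> sK [el tri] f; have [e1 e2 e3] := face_edges sK f.
have := tri _ _ _ f; have := tri _ _ _ (face_swap f); have := tri _ _ _ (face_rot f).
by rewrite -(el _ _ e1).1 -(el _ _ e2).1 -(el _ _ e3).1.
Qed.

Lemma PL_face K l i j k : subcomplex K -> PL_metric K l -> face K i j k ->
  [/\ l i j < l i k + l j k, l i k < l i j + l j k & l j k < l i j + l i k].
Proof.
move=> sK [el tri] f; have [e1 e2 e3] := face_edges sK f.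
have := tri _ _ _ f; have := tri _ _ _ (face_swap f); have := tri _ _ _ (face_rot f).
by rewrite -(el _ _ e1).1 -(el _ _ e2).1 -(el _ _ e3).1.
Qed.

End FaceTriangles.

Section FlatLabels.
Variables (R : realType) (I : vertex -> vertex -> R).
Hypothesis hI : weight hexT I.
Hypothesis hinv : translation_invariant hexT I.
Local Notation p := (dir_weight I).
Let wE := weightE hinv.
Let wrim := weightE_rim hinv.
Let wN1 := dir_weight_gtN1 hI hinv.
Let w3 := dir_weight3 hI hinv.

Lemma weightE5 v t : I v (v + hex_dir (t + 5)) = p t.+2.
Proof. by rewrite wE addnC -[(5 + t)%N]/t.+2.+3 w3. Qed.

Lemma weightE5_rim v t : I (v + hex_dir t) (v + hex_dir (t + 5)) = p t.+1.
Proof. by rewrite -{1}(hex_dir5 t) addrA (weight_sym hI hinv). Qed.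

Lemma face_hex5 v t : face hexT v (v + hex_dir t) (v + hex_dir (t + 5)).
Proof. by apply: face_swap; have := face_hex v (t + 5); rewrite -addnS hex_dir6. Qed.

Lemma apexes_neq v t : v + hex_dir t.+1 != v + hex_dir (t + 5).
Proof.
apply/eqP => /addrI/eqP; rewrite -addn1 hex_dir_modD [hex_dir (t + 5)]hex_dir_modD.
by have := ltn_pmod t (isT : (0 < 6)%N); move: (t %% 6)%N => [|[|[|[|[|[|]]]]]].
Qed.

(** For a constant label the two signed distances at an edge are positive multiples of the same
    number [1 + p t.+1 + p t.+2 - p t], so their sum has its sign. *)
Lemma acute_weights (w0 : vertex -> R) : (forall u v, w0 u = w0 v) ->
  cp_metric hexT I w0 -> weighted_Delaunay hexT I w0 ->
  forall t, p t <= 1 + p t.+1 + p t.+2.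
Proof.
move=> const hl hD t; have := hD 0 _ _ _ (face_hex 0 t) (face_hex5 0 t) (apexes_neq 0 t).
have hE i j k : face hexT i j k -> -1 < I i j -> -1 < I i k -> -1 < I j k ->
    exists2 a : R, 0 < a & h_ I w0 i j k = a * (1 + I i j) * (1 + I i k + I j k - I i j).
  move=> f h1 h2 h3; have [t1 t2 t3] := PL_face subcomplex_hexT hl f.
  have [e1 e2 e3] := face_edges subcomplex_hexT f.
  have D := DD_triangle_strict h1 h2 h3 (hl.1 _ _ e1).2 (hl.1 _ _ e2).2 (hl.1 _ _ e3).2 t1 t2 t3.
  rewrite (h_E h1 h2 h3 D); have s1 v : expR (w0 i - w0 v) = 1.
    by rewrite (const i v) subrr expR0.
  rewrite !s1 in D *.
  exists (expR (w0 i) / (Num.sqrt (DD (I i j) (I i k) (I j k) 1 1) * Num.sqrt (zz (I i j) 1))).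
    by rewrite divr_gt0 ?expR_gt0 // mulr_gt0 // sqrtr_gt0 // zz_gt0.
  by rewrite /hnum; ring.
have [a a0 ->] := hE _ _ _ (face_hex 0 t) (ltac:(by rewrite wE; apply: wN1))
  (ltac:(by rewrite wE; apply: wN1)) (ltac:(by rewrite wrim; apply: wN1)).
have [b b0 ->] := hE _ _ _ (face_hex5 0 t) (ltac:(by rewrite wE; apply: wN1))
  (ltac:(by rewrite weightE5; apply: wN1)) (ltac:(by rewrite weightE5_rim; apply: wN1)).
rewrite weightE5 weightE5_rim wrim !wE.
have -> : a * (1 + p t) * (1 + p t.+1 + p t.+2 - p t) +
   b * (1 + p t) * (1 + p t.+2 + p t.+1 - p t) =
   ((a + b) * (1 + p t)) * (1 + p t.+1 + p t.+2 - p t) by ring.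
have P : 0 < 1 + p t by have := wN1 t; lra.
by rewrite pmulr_rge0 ?subr_ge0 // mulr_gt0 // addr_gt0.
Qed.

Lemma flat_label_cp u : gen_cp_metric hexT I u -> flat hexT (cp_length I u) ->
  gen_weighted_Delaunay hexT I u -> flat_label p u.
Proof.
move=> hl fl hD.
have tri v t := gen_PL_face subcomplex_hexT hl (face_hex v t).
have pos v t : 0 < cp_length I u v (v + hex_dir t) by apply: (hl.1 _ _ (edge_hex v t)).2.
have rim_pos v t : 0 < cp_length I u (v + hex_dir t) (v + hex_dir t.+1).
  by rewrite hex_dirS addrA.
have g v t : -1 < I v (v + hex_dir t) by rewrite wE.
have grim v t : -1 < I (v + hex_dir t) (v + hex_dir t.+1) by rewrite wrim.
split.
- move=> v t; have [h1 h2 h3] := tri v t.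
  have := @DD_triangle R I u v (v + hex_dir t) (v + hex_dir t.+1) (g v t) (g v t.+1) (grim v t) (pos v t) (pos v t.+1) (rim_pos v t) h1 h2 h3.
  by rewrite !wE wrim.
- move=> v; rewrite -(fl v (@interior_hex v)); apply: eq_bigr => t _.
  by rewrite (@inner_angle_ang R I u v (v + hex_dir t) (v + hex_dir t.+1) (g v t) (g v t.+1) (grim v t)) !wE wrim.
move=> wl v t.
have n0 i j : (exists s, I i j = p s) -> 0 <= I i j.
  by case=> s ->; case: (wl s).
have := hD v _ _ _ (face_hex v t) (face_hex5 v t) (apexes_neq v t).
have [h1 h2 h3] := tri v t.
have [h1' h2' h3'] := gen_PL_face subcomplex_hexT hl (face_hex5 v t).
have g1 : GG (I v (v + hex_dir t)) (I v (v + hex_dir t.+1))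
    (I (v + hex_dir t) (v + hex_dir t.+1)) < 0.
  by rewrite !wE wrim; case: (wl t).
have g2 : GG (I v (v + hex_dir t)) (I v (v + hex_dir (t + 5)))
    (I (v + hex_dir t) (v + hex_dir (t + 5))) < 0.
  rewrite weightE5 weightE5_rim wE; move: (wl t).2.
  by congr (_ < _); rewrite /GG; ring.
have [b1 s1] := @theta_sin R I u v (v + hex_dir t) (v + hex_dir t.+1)
  (n0 _ _ (ex_intro _ t (wE v t))) (n0 _ _ (ex_intro _ t.+1 (wE v t.+1)))
  (n0 _ _ (ex_intro _ t.+2 (wrim v t))) g1 h1 h2 h3.
have [b2 s2] := @theta_sin R I u v (v + hex_dir t) (v + hex_dir (t + 5))
  (n0 _ _ (ex_intro _ t (wE v t))) (n0 _ _ (ex_intro _ t.+2 (weightE5 v t)))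
  (n0 _ _ (ex_intro _ t.+1 (weightE5_rim v t))) g2 h1' h2' h3'.
move=> h; have := sin_add_ge0 b1 b2 h; rewrite s1 s2.
rewrite weightE5 weightE5_rim wrim !wE -mulrDl.
by rewrite pmulr_lge0 // invr_gt0 sqrtr_gt0 zz_gt0 // expR_gt0.
Qed.

End FlatLabels.

(** * Approximate embeddings *)

Section LatticeSimplices.

(** Each of the forms [X], [Y], [X + Y] varies by at most 1 on the three points. If none is at least
    1, or at most -1, on all of them, then each has a weakly constant sign, and as no point is the
    origin, the signs combine to a contradiction. *)
Lemma hex_separation (a b c d e f : int) :
  -1 <= c - a <= 1 -> -1 <= d - b <= 1 -> -1 <= (c + d) - (a + b) <= 1 ->
  -1 <= e - a <= 1 -> -1 <= f - b <= 1 -> -1 <= (e + f) - (a + b) <= 1 ->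
  -1 <= e - c <= 1 -> -1 <= f - d <= 1 -> -1 <= (e + f) - (c + d) <= 1 ->
  a != 0 \/ b != 0 -> c != 0 \/ d != 0 -> e != 0 \/ f != 0 ->
  (1 <= a /\ 1 <= c /\ 1 <= e) \/ (1 <= - a /\ 1 <= - c /\ 1 <= - e) \/
  (1 <= b /\ 1 <= d /\ 1 <= f) \/ (1 <= - b /\ 1 <= - d /\ 1 <= - f) \/
  (1 <= a + b /\ 1 <= c + d /\ 1 <= e + f) \/
  (1 <= - (a + b) /\ 1 <= - (c + d) /\ 1 <= - (e + f)).
Proof.
have cases (x y z : int) : -1 <= y - x <= 1 -> -1 <= z - x <= 1 -> -1 <= z - y <= 1 ->
    (1 <= x /\ 1 <= y /\ 1 <= z) \/ (1 <= - x /\ 1 <= - y /\ 1 <= - z) \/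
    (0 <= x /\ 0 <= y /\ 0 <= z) \/ (x <= 0 /\ y <= 0 /\ z <= 0) by lia.
have pp (x y : int) : 0 <= x -> 0 <= y -> x != 0 \/ y != 0 -> 1 <= x + y by lia.
have pn (x y : int) : x != 0 \/ y != 0 -> y <= 0 -> 0 <= x + y -> 1 <= x by lia.
have np (x y : int) : x != 0 \/ y != 0 -> 0 <= x -> x + y <= 0 -> 1 <= - y by lia.
have nn (x y : int) : x <= 0 -> y <= 0 -> x != 0 \/ y != 0 -> 1 <= - (x + y) by lia.
have swap (x y : int) : x != 0 \/ y != 0 -> y != 0 \/ x != 0 by case; [right|left].
move=> a1 b1 s1 a2 b2 s2 a3 b3 s3 h1 h2 h3.
have [|[|A]] := cases _ _ _ a1 a2 a3; [by left|by right; left|].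
have [|[|B]] := cases _ _ _ b1 b2 b3; [by do 2!right; left|by do 3!right; left|].
have [|[|S]] := cases _ _ _ s1 s2 s3; [by do 4!right; left|by do 5!right|].
case: A => -[p1 [p2 p3]]; case: B => -[q1 [q2 q3]].
- by do 4!right; left; rewrite !pp.
- case: S => -[r1 [r2 r3]]; first by left; rewrite (pn a b) ?(pn c d) ?(pn e f).
  by do 3!right; left; rewrite (np a b) ?(np c d) ?(np e f).
- case: S => -[r1 [r2 r3]].
    rewrite ![_ + b]addrC ![_ + d]addrC ![_ + f]addrC in r1 r2 r3.
    by do 2!right; left; rewrite (pn b a) ?(pn d c) ?(pn f e) //; apply: swap.
  rewrite ![_ + b]addrC ![_ + d]addrC ![_ + f]addrC in r1 r2 r3.
  by right; left; rewrite (np b a) ?(np d c) ?(np f e) //; apply: swap.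
by do 5!right; rewrite !nn.
Qed.

Definition hexnear (x y : vertex) : Prop :=
  [/\ -1 <= y.1 - x.1 <= 1, -1 <= y.2 - x.2 <= 1 &
      -1 <= (y.1 + y.2) - (x.1 + x.2) <= 1].

Lemma near_or_eq_hexnear x y : near_or_eq x y -> hexnear x y.
Proof.
case=> [->|[t ->]]; first by split; rewrite subrr.
have [h1 h2 h3] := hex_dir_bound t; rewrite /hexnear /=.
by move: (hex_dir t).1 (hex_dir t).2 h1 h2 h3 => a b h1 h2 h3; split; lia.
Qed.

(* One of the linear forms +-X, +-Y, +-(X + Y), which are bounded by 1 on the
   neighbours of o, separates o from a simplex avoiding it. *)
Lemma separating_form x y z (o : vertex) : simplex x y z ->
  x != o -> y != o -> z != o -> exists m n : int,
  (forall v, near_or_eq o v -> m * (v.1 - o.1) + n * (v.2 - o.2) <= 1) /\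
  (forall v, v \in [:: x; y; z] -> 1 <= m * (v.1 - o.1) + n * (v.2 - o.2)).
Proof.
case=> /near_or_eq_hexnear xy /near_or_eq_hexnear yz /near_or_eq_hexnear xz xo yo zo.
have ne v : v != o -> v.1 - o.1 != 0 \/ v.2 - o.2 != 0.
  move=> vo; case: (eqVneq (v.1 - o.1) 0) => [e1|]; last by left.
  right; apply/eqP => e2; case/negP: vo; apply/eqP.
  by rewrite [LHS]surjective_pairing (subr0_eq e1) (subr0_eq e2) -surjective_pairing.
have [X Y Z] := And3 (ne _ xo) (ne _ yo) (ne _ zo).
suff [m [n [mn h]]] : exists m n : int,
  (m, n) \in [:: (1, 0); (-1, 0); (0, 1); (0, -1); (1, 1); (-1, -1)] /\
  (1 <= m * (x.1 - o.1) + n * (x.2 - o.2) /\ 1 <= m * (y.1 - o.1) + n * (y.2 - o.2) /\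
   1 <= m * (z.1 - o.1) + n * (z.2 - o.2)).
  exists m, n; split.
    move=> v /near_or_eq_hexnear[b1 b2 b3]; clear xo yo zo ne h X Y Z xy yz xz.
    move: mn b1 b2 b3.
    rewrite !inE !xpair_eqE; move: (v.1) (v.2) (o.1) (o.2) => a b c d.
    by case/or4P => [| | |/or3P[]] /andP[/eqP-> /eqP->]; lia.
  by move=> v; rewrite !inE => /or3P[]/eqP->; case: h => ? [].
move: xy yz xz X Y Z; rewrite /hexnear.
move: (x.1) (x.2) (y.1) (y.2) (z.1) (z.2) (o.1) (o.2) => x1 x2 y1 y2 z1 z2 o1 o2.
case=> [a1 a2 a3] [b1 b2 b3] [c1 c2 c3] X Y Z.
have dE (a b c : int) : (a - c) - (b - c) = a - b by ring.
have dE2 (a b c d e f : int) : (a - c + (b - d)) - (e - c + (f - d)) = (a + b) - (e + f).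
  by ring.
have := @hex_separation (x1 - o1) (x2 - o2) (y1 - o1) (y2 - o2) (z1 - o1) (z2 - o2).
rewrite !dE !dE2 => /(_ a1 a2 a3 c1 c2 c3 b1 b2 b3 X Y Z).
have M (m n a b c : int) s : m * a + n * b = c -> s <= c -> s <= m * a + n * b by move=> ->.
case=> [[h1 [h2 h3]]|[[h1 [h2 h3]]|[[h1 [h2 h3]]|[[h1 [h2 h3]]|[[h1 [h2 h3]]|[h1 [h2 h3]]]]]]].
- by exists 1, 0; rewrite !mul1r !mul0r !addr0.
- by exists (-1), 0; rewrite !mulN1r !mul0r !addr0.
- by exists 0, 1; rewrite !mul1r !mul0r !add0r.
- by exists 0, (-1); rewrite !mulN1r !mul0r !add0r.
- by exists 1, 1; rewrite !mul1r.
by exists (-1), (-1); rewrite !mulN1r -!opprD.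
Qed.

Variable R : realType.

(** The form separating [x] from the other simplex averages to at most [b + c < 1] on the first
    simplex and to at least 1 on the second. *)
Lemma disjoint_simplices_pos x y z x' y' z' (a b c a' b' c' : R) :
  simplex x y z -> simplex x' y' z' -> disjoint3 x y z x' y' z' ->
  0 < a -> 0 <= b -> 0 <= c -> a + b + c = 1 ->
  0 <= a' -> 0 <= b' -> 0 <= c' -> a' + b' + c' = 1 ->
  a * x.1%:~R + b * y.1%:~R + c * z.1%:~R =
    a' * x'.1%:~R + b' * y'.1%:~R + c' * z'.1%:~R ->
  a * x.2%:~R + b * y.2%:~R + c * z.2%:~R =
    a' * x'.2%:~R + b' * y'.2%:~R + c' * z'.2%:~R -> False.
Proof.
move=> [xy yz xz] s' dj a0 b0 c0 abc a0' b0' c0' abc' e1 e2.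
have := dj x; rewrite !inE eqxx => /(_ isT); rewrite !negb_or => /and3P[n1 n2 n3].
have [|||m [n [up lo]]] := @separating_form x' y' z' x s'; try by rewrite eq_sym.
pose f (v : vertex) : R := m%:~R * (v.1%:~R - x.1%:~R) + n%:~R * (v.2%:~R - x.2%:~R).
have fE v : f v = (m * (v.1 - x.1) + n * (v.2 - x.2))%:~R.
  by rewrite /f rmorphD !rmorphM /= !rmorphB.
have fx : f x = 0 by rewrite /f !subrr !mulr0 addr0.
have fy : f y <= 1 by rewrite fE -[1]/(1%:~R) ler_int; apply: up.
have fz : f z <= 1 by rewrite fE -[1]/(1%:~R) ler_int; apply: up.
have lo' v : v \in [:: x'; y'; z'] -> 1 <= f v.
  by move=> h; rewrite fE -[1]/(1%:~R) ler_int; apply: lo.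
have fx' : 1 <= f x' by apply: lo'; rewrite !inE eqxx.
have fy' : 1 <= f y' by apply: lo'; rewrite !inE eqxx orbT.
have fz' : 1 <= f z' by apply: lo'; rewrite !inE eqxx !orbT.
have E : a * f x + b * f y + c * f z = a' * f x' + b' * f y' + c' * f z'.
  have lin (r s t : R) (i j k : vertex) : r + s + t = 1 ->
     r * f i + s * f j + t * f k =
     m%:~R * ((r * i.1%:~R + s * j.1%:~R + t * k.1%:~R) - x.1%:~R) +
     n%:~R * ((r * i.2%:~R + s * j.2%:~R + t * k.2%:~R) - x.2%:~R).
    by move=> /(canRL (addrK _)) e; rewrite (canRL (addrK _) e) /f; ring.
  by rewrite !lin // e1 e2.
have hy := ler_wpM2l b0 fy; have hz := ler_wpM2l c0 fz.
have hx' := ler_wpM2l a0' fx'; have hy' := ler_wpM2l b0' fy'.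
have hz' := ler_wpM2l c0' fz'.
rewrite fx mulr0 add0r in E; rewrite !mulr1 in hy hz hx' hy' hz'.
by clear - a0 abc abc' E hy hz hx' hy' hz'; lra.
Qed.

Lemma disjoint_simplices x y z x' y' z' (a b c a' b' c' : R) :
  simplex x y z -> simplex x' y' z' -> disjoint3 x y z x' y' z' ->
  0 <= a -> 0 <= b -> 0 <= c -> a + b + c = 1 ->
  0 <= a' -> 0 <= b' -> 0 <= c' -> a' + b' + c' = 1 ->
  a * x.1%:~R + b * y.1%:~R + c * z.1%:~R =
    a' * x'.1%:~R + b' * y'.1%:~R + c' * z'.1%:~R ->
  a * x.2%:~R + b * y.2%:~R + c * z.2%:~R =
    a' * x'.2%:~R + b' * y'.2%:~R + c' * z'.2%:~R -> False.
Proof.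
move=> s s' dj a0 b0 c0 abc a0' b0' c0' abc' e1 e2.
have [xy yz xz] := s.
have rot : simplex y z x by split=> //; apply: near_or_eq_sym.
have rot2 : simplex z x y by split=> //; apply: near_or_eq_sym.
have djE t : t =i [:: x; y; z] -> forall v, v \in t -> v \notin [:: x'; y'; z'].
  by move=> e v; rewrite e; apply: dj.
have [p|a1] := ltP 0 a; first exact: (disjoint_simplices_pos s s' dj p b0 c0 abc a0' b0' c0' abc' e1 e2).
have [p|b1] := ltP 0 b.
  apply: (@disjoint_simplices_pos y z x x' y' z' b c a a' b' c' rot s') => //.
  - by apply: djE => v; rewrite !inE orbC -orbA orbC -!orbA orbC -orbA.
  - by clear - abc; lra.
  - by rewrite -e1; ring.
  - by rewrite -e2; ring.
have p : 0 < c by clear - abc a1 b1; lra.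
apply: (@disjoint_simplices_pos z x y x' y' z' c a b a' b' c' rot2 s') => //.
- by apply: djE => v; rewrite !inE orbC -orbA.
- by clear - abc; lra.
- by rewrite -e1; ring.
- by rewrite -e2; ring.
Qed.

End LatticeSimplices.

Section ConvexSets.
Variable R : realType.
Local Notation plane := (R * R)%type.

Lemma convex_simply_connected (A : set plane) : A !=set0 ->
  (forall x y t, A x -> A y -> t \in `[0, 1] -> A ((1 - t) *: x + t *: y)) ->
  simply_connected A.
Proof.
move=> A0 conv; split.
  split=> // x y Ax Ay; exists (fun t => (1 - t) *: x + t *: y); split.
  - apply: continuous_subspaceT => t; apply: cvgD; apply: cvgZ.
    + by apply: cvgB; [exact: cvg_cst|exact: cvg_id].
    + exact: cvg_cst.
    + exact: cvg_id.
    + exact: cvg_cst.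
  - by move=> t; apply: conv.
  - by rewrite subr0 scale1r scale0r addr0.
  - by rewrite subrr scale1r scale0r add0r.
move=> gamma cg gA g01.
have z01 : (0 : R) \in `[0, 1] by rewrite in_itv /= lexx ler01.
exists (fun z => (1 - z.1) *: gamma z.2 + z.1 *: gamma 0); split.
- apply/subspace_continuousP => -[s t] [/= hs ht].
  set I := [set` _] in cg hs ht *.
  have {}cg t' : I t' -> gamma z @[z --> within I (nbhs t')] --> gamma t'.
    by move: t'; apply/subspace_continuousP.
  pose F := within (I `*` I) (nbhs (s, t)).
  have c1 : z.1 @[z --> F] --> s by apply: cvg_within_filter; exact: cvg_fst.
  have c2 : z.2 @[z --> F] --> within I (nbhs t).
    move=> U /= hU; have : \forall z \near nbhs (s, t), I z.2 -> U z.2.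
      exact: (@cvg_snd _ _ (nbhs s) (nbhs t) _ _ hU).
    by apply: filterS => z h [_ /h].
  have c3 : gamma z.2 @[z --> F] --> gamma t.
    exact: cvg_comp c2 (cg t ht).
  by apply: cvgD; apply: cvgZ => //; [apply: cvgB => //|]; exact: cvg_cst.
- by move=> s t hs ht; apply: conv => //; apply: gA.
- by move=> t _; rewrite subr0 scale1r scale0r addr0.
- by move=> t _; rewrite subrr scale1r scale0r add0r.
by move=> s _; rewrite /= -g01 -scalerDl subrK scale1r.
Qed.

Lemma uniform_cvg_point (T : choiceType) (A : set T) (f_ : nat -> T -> plane) f x :
  {uniform A, f_ @ \oo --> f} -> A x ->
  (f_ n x).1 @[n --> \oo] --> (f x).1 /\ (f_ n x).2 @[n --> \oo] --> (f x).2.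
Proof.
move=> uf Ax.
have c : f_ n x @[n --> \oo] --> f x.
  apply/cvg_ballP => e e0.
  have : \forall g \near (f : {uniform` A -> plane}), ball (f x) e (g x).
    apply/uniform_nbhs; exists [set xy | ball xy.1 e xy.2]; split.
      exact: (entourage_ball _ (PosNum e0)).
    by move=> g; apply.
  by move/uf.
by split; [apply: cvg_comp c _; exact: cvg_fst|apply: cvg_comp c _; exact: cvg_snd].
Qed.

End ConvexSets.

Section BoxComplex.

Definition box_complex (n : nat) : set {fset vertex} :=
  [set s | hexT s /\ forall v, v \in s -> (nrm v <= n)%N].

Lemma box_subcomplex n : subcomplex (box_complex n).
Proof.
split=> [s []//|s t [sT sn] t0 ts]; split; first exact: subcomplex_hexT.2 sT t0 ts.
by move=> v vt; apply: sn; apply: (fsubsetP ts).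
Qed.

Lemma box_complex_finite n : finite_set (box_complex n).
Proof.
apply: (@sub_finite_set _ _ [set` fpowerset [fset v in box n]%fset]); last exact: finite_fset.
move=> s [_ sn] /=; rewrite fpowersetE; apply/fsubsetP => v /sn vn.
by rewrite in_fset /= mem_box.
Qed.

Lemma simplex_box n x y z : simplex x y z -> (nrm x <= n)%N -> (nrm y <= n)%N ->
  (nrm z <= n)%N -> box_complex n [fset x; y; z]%fset.
Proof.
move=> s hx hy hz; split; first exact: simplex_hexT.
by move=> v; rewrite !inE -orbA => /or3P[]/eqP->.
Qed.

Variable R : realType.
Local Notation plane := (R * R)%type.
Variables v1 v2 : plane.

(** Coefficients of repeated vertices add up, so degenerate triples are covered. *)
Definition bary3 (x y z : vertex) (a b c : R) (v : vertex) : R :=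
  (v == x)%:R * a + (v == y)%:R * b + (v == z)%:R * c.

Lemma bary3_sum (V : lmodType R) (f : vertex -> V) x y z a b c (s : {fset vertex}) :
  x \in s -> y \in s -> z \in s ->
  \sum_(v <- s) bary3 x y z a b c v *: f v = a *: f x + b *: f y + c *: f z.
Proof.
move=> xs ys zs; have one w d : w \in s -> \sum_(v <- s) ((v == w)%:R * d) *: f v = d *: f w.
  move=> ws; rewrite (bigD1_seq w) //= eqxx mul1r big1 ?addr0 // => v /negPf ->.
  by rewrite mul0r scale0r.
under eq_bigr do rewrite !scalerDl.
by rewrite !big_split /= !one.
Qed.

Lemma bary3_barycentric x y z a b c : 0 <= a -> 0 <= b -> 0 <= c -> a + b + c = 1 ->
  barycentric [fset x; y; z]%fset (bary3 x y z a b c).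
Proof.
move=> a0 b0 c0 abc; split.
  by move=> v _; rewrite !addr_ge0 // mulr_ge0 // ler0n.
have := @bary3_sum R^o (fun=> 1) x y z a b c [fset x; y; z]%fset.
rewrite !inE !eqxx !orbT => /(_ isT isT isT).
under eq_bigr do rewrite [_ *: _]mulr1.
by rewrite ![_ *: _]mulr1 abc.
Qed.

Lemma carrier_simplex n x y z a b c : simplex x y z -> (nrm x <= n)%N ->
  (nrm y <= n)%N -> (nrm z <= n)%N -> 0 <= a -> 0 <= b -> 0 <= c -> a + b + c = 1 ->
  carrier v1 v2 (box_complex n) (a *: pos v1 v2 x + b *: pos v1 v2 y + c *: pos v1 v2 z).
Proof.
move=> s hx hy hz a0 b0 c0 abc.
exists [fset x; y; z]%fset, (bary3 x y z a b c); split; first exact: simplex_box.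
  exact: bary3_barycentric.
by rewrite bary3_sum // !inE eqxx ?orbT.
Qed.

Lemma carrier_pos n v : (nrm v <= n)%N -> carrier v1 v2 (box_complex n) (pos v1 v2 v).
Proof.
move=> vn; have -> : pos v1 v2 v = 1 *: pos v1 v2 v + 0 *: pos v1 v2 v + 0 *: pos v1 v2 v.
  by rewrite scale1r !scale0r !addr0.
apply: carrier_simplex => //; last by rewrite !addr0.
by split; left.
Qed.

Lemma unit_interval (n : nat) (a : R) : (0 < n)%N -> - n%:R <= a <= n%:R ->
  exists i : int, [/\ (absz i <= n)%N, (absz (i + 1)%R <= n)%N & i%:~R <= a <= i%:~R + 1].
Proof.
(* At the right end the floor would start a cell outside the box, so the previous cell is taken. *)
move=> n0 /andP[h1 h2]; have [->|ne] := eqVneq a n%:R.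
  exists (n%:Z - 1); split; [lia|lia|].
  by rewrite intrB subrK lexx andbT gerBl ler01.
have /andP[f1 f2] := Num.Theory.real_floor_itv (num_real a).
exists (Num.floor a).
have l1 : - n%:Z <= Num.floor a by rewrite floor_ge_int_tmp mulrNz.
have l2 : Num.floor a < n%:Z.
  rewrite -(ltr_int R); apply: le_lt_trans f1 _; rewrite lt_neqAle ne; exact: h2.
split; [lia|lia|]; rewrite f1 /=.
by move: f2; rewrite intrD => /ltW.
Qed.

(** A unit cell is cut into two faces by its diagonal in direction [(-1, 1)]; whether [al + be <= 1]
    tells in which one the point lies. The carrier is a parallelogram, hence convex. *)
Lemma carrier_box n : (0 < n)%N -> carrier v1 v2 (box_complex n) =
  [set x | exists a b : R, [/\ - n%:R <= a <= n%:R, - n%:R <= b <= n%:R & x = a *: v1 + b *: v2]].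
Proof.
move=> n0; apply/seteqP; split=> x.
  case=> s [w [[sT sn] [w0 w1] ->]].
  have bd (g : vertex -> int) : (forall v, (absz (g v) <= nrm v)%N) ->
      - n%:R <= \sum_(v <- s) w v * (g v)%:~R <= n%:R.
    move=> gn; rewrite -ler_norml; apply: le_trans (ler_norm_sum _ _ _) _.
    rewrite (_ : n%:R = \sum_(v <- s) w v * n%:R); last by rewrite -mulr_suml w1 mul1r.
    rewrite !big_seq; apply: ler_sum => v vs.
    rewrite normrM (ger0_norm (w0 _ vs)) ler_wpM2l ?w0 //.
    by rewrite -intr_norm -natr_absz ler_nat (leq_trans (gn v)) // sn.
  exists (\sum_(v <- s) w v * v.1%:~R), (\sum_(v <- s) w v * v.2%:~R); split.
  - by apply: (bd fst) => v; apply: leq_maxl.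
  - by apply: (bd snd) => v; apply: leq_maxr.
  rewrite !scaler_suml -big_split /=; apply: eq_bigr => v _.
  by rewrite /pos scalerDr !scalerA.
case=> a [b [ha hb ->]].
have [i [i1 i2 /andP[i3 i4]]] := unit_interval n0 ha.
have [j [j1 j2 /andP[j3 j4]]] := unit_interval n0 hb.
have nn (r s : int) : (absz r <= n)%N -> (absz s <= n)%N -> (nrm (r, s) <= n)%N.
  by move=> h1 h2; rewrite /nrm geq_max h1 h2.
have near t r s r' s' : (r', s') = (r, s) + hex_dir t -> near_or_eq (r, s) (r', s').
  by move=> ->; right; exists t.
pose al := a - i%:~R; pose be := b - j%:~R.
have [le|lt] := leP (al + be) 1.
  have -> : a *: v1 + b *: v2 = (1 - al - be) *: pos v1 v2 (i, j) +
      al *: pos v1 v2 (i + 1, j) + be *: pos v1 v2 (i, j + 1).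
    rewrite /pos /= !intrD !scalerDl !scalerDr !scalerA /al /be.
    by congr pair => /=; rewrite /GRing.scale /=; ring.
  apply: carrier_simplex; rewrite ?nn //.
  - split; [apply: (near 0)|apply: (near 2)|apply: (near 1%N)]; congr pair => /=; lia.
  - by rewrite /al /be; move: le; rewrite /al /be; lra.
  - by rewrite /al; lra.
  - by rewrite /be; lra.
  - by ring.
have -> : a *: v1 + b *: v2 = (al + be - 1) *: pos v1 v2 (i + 1, j + 1) +
    (1 - be) *: pos v1 v2 (i + 1, j) + (1 - al) *: pos v1 v2 (i, j + 1).
  rewrite /pos /= !intrD !scalerDl !scalerDr !scalerA /al /be.
  by congr pair => /=; rewrite /GRing.scale /=; ring.
apply: carrier_simplex; rewrite ?nn //.
- split; [apply: (near 4)|apply: (near 2)|apply: (near 3)]; congr pair => /=; lia.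
- by rewrite /al /be; move: lt; rewrite /al /be; lra.
- by rewrite /be; lra.
- by rewrite /al; lra.
- by ring.
Qed.

Lemma carrier_box_simply_connected n : (0 < n)%N ->
  simply_connected (carrier v1 v2 (box_complex n)).
Proof.
move=> n0; apply: convex_simply_connected.
  by exists (pos v1 v2 0); apply: carrier_pos.
rewrite carrier_box // => x y t [a [b [/andP[a1 a2] /andP[b1 b2] ->]]].
case=> [c [d [/andP[c1 c2] /andP[d1 d2] ->]]]; rewrite in_itv /= => /andP[t0 t1].
exists ((1 - t) * a + t * c), ((1 - t) * b + t * d).
have cv (r s : R) : - n%:R <= r -> r <= n%:R -> - n%:R <= s -> s <= n%:R ->
    - n%:R <= (1 - t) * r + t * s <= n%:R.
  by move: (n%:R) => N; clear - t0 t1 => r1 r2 s1 s2; apply/andP; split; nra.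
split; [exact: cv|exact: cv|].
by rewrite !scalerDr !scalerA !scalerDl addrACA.
Qed.

End BoxComplex.

Section EmbeddableLabels.
Variables (R : realType) (v1 v2 : R * R) (I : vertex -> vertex -> R).
Local Notation plane := (R * R)%type.
Hypothesis hbasis : is_basis v1 v2.
Hypothesis hI : weight hexT I.
Hypothesis hinv : translation_invariant hexT I.
Local Notation pos := (pos v1 v2).
Local Notation p := (dir_weight I).

Lemma dist_sqr (x y : plane) : dist x y ^+ 2 = sqd x y.
Proof. by rewrite /dist sqr_sqrtr // addr_ge0 ?sqr_ge0. Qed.

Lemma cp_length_len2 u v t : cp_length I u v (v + hex_dir t) ^+ 2 = len2 p u v t.
Proof.
by rewrite cp_length_sqr (weightE hinv) //; apply: dir_weight_gtN1.
Qed.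

Lemma basis_coords (a b a' b' : R) : a *: v1 + b *: v2 = a' *: v1 + b' *: v2 ->
  a = a' /\ b = b'.
Proof.
move: hbasis; rewrite /is_basis; case: v1 v2 => [x1 y1] [x2 y2] /= D e.
have e1 : a * x1 + b * x2 = a' * x1 + b' * x2 := congr1 fst e.
have e2 : a * y1 + b * y2 = a' * y1 + b' * y2 := congr1 snd e.
have E1 : (a - a') * x1 + (b - b') * x2 = 0.
  by rewrite -[RHS](subrr (a' * x1 + b' * x2)) -{1}e1; ring.
have E2 : (a - a') * y1 + (b - b') * y2 = 0.
  by rewrite -[RHS](subrr (a' * y1 + b' * y2)) -{1}e2; ring.
split; apply/eqP; rewrite -subr_eq0 -(mulIr_eq0 _ (mulIf D)); apply/eqP.
  have -> : (a - a') * (x1 * y2 - y1 * x2) = ((a - a') * x1 + (b - b') * x2) * y2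
    - ((a - a') * y1 + (b - b') * y2) * x2 by ring.
  by rewrite E1 E2 !mul0r subrr.
have -> : (b - b') * (x1 * y2 - y1 * x2) = ((a - a') * y1 + (b - b') * y2) * x1
  - ((a - a') * x1 + (b - b') * x2) * y1 by ring.
by rewrite E1 E2 !mul0r subrr.
Qed.

Section OneMap.
Variables (n : nat) (l : vertex -> vertex -> R) (f : plane -> plane).
Local Notation K := (box_complex n).
Hypothesis lPL : PL_metric K l.
Hypothesis fdev : developing_map v1 v2 K l f.
Hypothesis femb : topological_embedding (carrier v1 v2 K) f.
Variables (F : seq vertex).
Hypothesis Fn : forall v, v \in F -> (nrm v <= n)%N.

Lemma box_face v t : v \in F -> v + hex_dir t \in F -> v + hex_dir t.+1 \in F ->
  face K v (v + hex_dir t) (v + hex_dir t.+1).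
Proof.
move=> h1 h2 h3; have [e1 e2 e3 _] := face_hex v t; split=> //.
by apply: simplex_box; [exact: simplex_face|exact: Fn..].
Qed.

Lemma sin_inner_angle i j k : face K i j k -> 0 < sin (inner_angle l i j k).
Proof.
move=> fc; have sK := box_subcomplex n.
have [t1 t2 t3] := PL_face sK lPL fc; have [e1 e2 e3] := face_edges sK fc.
have [_ a] := lPL.1 _ _ e1; have [_ b] := lPL.1 _ _ e2; have [_ c] := lPL.1 _ _ e3.
rewrite /inner_angle; move: (l i j) (l i k) (l j k) t1 t2 t3 a b c => x y z t1 t2 t3 x0 y0 z0.
have d0 : 0 < 2 * x * y by rewrite !mulr_gt0.
have lo : -1 < (x ^+ 2 + y ^+ 2 - z ^+ 2) / (2 * x * y).
  rewrite ltr_pdivlMr // mulN1r -subr_gt0.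
  have -> : x ^+ 2 + y ^+ 2 - z ^+ 2 - - (2 * x * y) = (x + y - z) * (x + y + z) by ring.
  by rewrite mulr_gt0 ?subr_gt0 // !addr_gt0.
have hi : (x ^+ 2 + y ^+ 2 - z ^+ 2) / (2 * x * y) < 1.
  rewrite ltr_pdivrMr // mul1r -subr_gt0.
  have -> : 2 * x * y - (x ^+ 2 + y ^+ 2 - z ^+ 2) = (z + x - y) * (z + y - x) by ring.
  by rewrite mulr_gt0 ?subr_gt0 //; lra.
rewrite sin_acos; last by rewrite (ltW lo) (ltW hi).
rewrite sqrtr_gt0 subr_gt0; move: lo hi; move: (_ / _) => r lo hi.
by rewrite -subr_gt0 (_ : 1 - r ^+ 2 = (1 - r) * (1 + r)); [rewrite mulr_gt0 //; lra|ring].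
Qed.

Lemma det2_rot (a b : R) (X : plane) : det2 X (a *: Defs.rot b X) = a * sin b * sqn X.
Proof. by rewrite /det2 /Defs.rot /sqn /= /GRing.scale /=; ring. Qed.

Lemma map_simplex x y z a b c : simplex x y z -> x \in F -> y \in F -> z \in F ->
  0 <= a -> 0 <= b -> 0 <= c -> a + b + c = 1 ->
  f (a *: pos x + b *: pos y + c *: pos z) =
  a *: f (pos x) + b *: f (pos y) + c *: f (pos z).
Proof.
move=> s xF yF zF a0 b0 c0 abc; have [_ aff _ _] := fdev.
have := aff [fset x; y; z]%fset (bary3 x y z a b c)
  (simplex_box s (Fn xF) (Fn yF) (Fn zF)) (bary3_barycentric _ _ _ a0 b0 c0 abc).
by rewrite !bary3_sum // !inE eqxx ?orbT.
Qed.

Lemma oriented_layout : exists2 s : R, s ^+ 2 = 1 &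
  oriented F (fun v => ((f (pos v)).1, s * (f (pos v)).2)) /\
  faces_disjoint F (fun v => ((f (pos v)).1, s * (f (pos v)).2)).
Proof.
have [_ _ len [s s1 turn]] := fdev.
have s2 : s ^+ 2 = 1 by case: s1 => ->; rewrite ?sqrrN expr1n.
exists s => //; split.
  move=> v t vF wF zF; have fc := box_face vF wF zF.
  have [e1 e2 _] := face_edges (box_subcomplex n) fc.
  have AE := turn v t fc; set A := f (pos (v + hex_dir t)) - f (pos v) in AE.
  set B := _ - f (pos v) in AE.
  have -> : det2 (((f (pos (v + hex_dir t))).1, s * (f (pos (v + hex_dir t))).2) -
      ((f (pos v)).1, s * (f (pos v)).2))
     (((f (pos (v + hex_dir t.+1))).1, s * (f (pos (v + hex_dir t.+1))).2) -
      ((f (pos v)).1, s * (f (pos v)).2)) = s * det2 A B.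
    by rewrite /det2 /A /B /=; ring.
  have [_ l1] := lPL.1 _ _ e1; have [_ l2] := lPL.1 _ _ e2.
  have A0 : 0 < sqn A by rewrite -sqdE -dist_sqr len // exprn_gt0.
  have sn := sin_inner_angle fc.
  have -> : s * det2 A B = l v (v + hex_dir t.+1) / l v (v + hex_dir t) *
      sin (inner_angle l v (v + hex_dir t) (v + hex_dir t.+1)) * sqn A.
    rewrite AE det2_rot; set th := inner_angle _ _ _ _.
    have -> : sin (s * th) = s * sin th.
      by case: s1 => ->; rewrite ?mul1r // !mulN1r sinN.
    by rewrite -[RHS]mul1r -s2; ring.
  by rewrite !mulr_gt0 // invr_gt0.
move=> x y z x' y' z' sF sx sx' dj q [a [b [c [a0 b0 c0 abc qE]]]].
case=> [a' [b' [c' [a0' b0' c0' abc' qE']]]].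
have [xF yF zF] : [/\ x \in F, y \in F & z \in F] by split; apply: sF; rewrite !inE eqxx ?orbT.
have [xF' yF' zF'] : [/\ x' \in F, y' \in F & z' \in F].
  by split; apply: sF; rewrite !inE eqxx ?orbT.
have cancel (r r' : R) : s * r = s * r' -> r = r'.
  by move=> e; rewrite -[r]mul1r -[r']mul1r -s2 expr2 -!mulrA e.
pose P := a *: pos x + b *: pos y + c *: pos z.
pose P' := a' *: pos x' + b' *: pos y' + c' *: pos z'.
have fPP' : f P = f P'.
  rewrite /P /P' !map_simplex //.
  have e1 := congr1 fst qE; have e2 := congr1 snd qE.
  rewrite qE' /= in e1 e2.
  rewrite [LHS]surjective_pairing [RHS]surjective_pairing /= /GRing.scale /=.
  congr pair; first exact: esym.
  by apply: cancel; apply: esym; move: e2; rewrite !mulrDr !mulrA ![s * _]mulrC.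
have PP' : P = P'.
  have [_ inj _] := femb; apply: inj fPP'; apply/mem_set; apply: carrier_simplex => //; exact: Fn.
have E i j k (r r' r'' : R) : r *: pos i + r' *: pos j + r'' *: pos k =
   (r * i.1%:~R + r' * j.1%:~R + r'' * k.1%:~R) *: v1 +
   (r * i.2%:~R + r' * j.2%:~R + r'' * k.2%:~R) *: v2.
  by rewrite /Defs.pos; congr pair; rewrite /= /GRing.scale /=; ring.
move: PP'; rewrite /P /P' !E => /basis_coords[E1 E2].
exact: (disjoint_simplices sx sx' dj a0 b0 c0 abc a0' b0' c0' abc' E1 E2).
Qed.

End OneMap.

(** A box around [F] is an admissible finite complex, and uniform convergence is evaluated at the
    vertices of [F]. Directions are reduced modulo 6 so that finitely many conditions have to hold
    at once. *)
Lemma embeddable_label_cp u (phi : plane -> plane) :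
  developing_map v1 v2 hexT (cp_length I u) phi -> embeddable v1 v2 phi ->
  embeddable_label p u.
Proof.
move=> [_ _ plen _] emb F e e0.
pose n := (\max_(v <- F) nrm v).+1.
have Fn v : v \in F -> (nrm v <= n)%N.
  by move=> vF; apply: leqW; apply: (leq_bigmax_seq (F := nrm)).
have n0 : (0 < n)%N by [].
have [l_ [phi_ [good uc]]] := emb _ (box_subcomplex n) (box_complex_finite n)
  (carrier_box_simply_connected v1 v2 n0).
have near : \forall m \near \oo, forall v, v \in F -> forall t, t \in iota 0 6 ->
    v \in F -> v + hex_dir t \in F ->
    `|sqd (phi_ m (pos v)) (phi_ m (pos (v + hex_dir t))) - len2 p u v t| < e.
  apply: near_all => v; apply: near_all => t.
  have [vF|vF] := boolP (v \in F); last by apply: filterE.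
  have [wF|wF] := boolP (v + hex_dir t \in F); last by apply: filterE.
  have [a1 a2] := uniform_cvg_point uc (carrier_pos v1 v2 (Fn _ vF)).
  have [b1 b2] := uniform_cvg_point uc (carrier_pos v1 v2 (Fn _ wF)).
  have : sqd (phi_ m (pos v)) (phi_ m (pos (v + hex_dir t))) @[m --> \oo] --> len2 p u v t.
    rewrite -cp_length_len2 -plen ?dist_sqr; last exact: edge_hex.
    have sqr (x y : nat -> R) (a b : R) : x m @[m --> \oo] --> a ->
        y m @[m --> \oo] --> b -> (x m - y m) ^+ 2 @[m --> \oo] --> (a - b) ^+ 2.
      by move=> ha hb; apply: (cvgM (cvgB ha hb) (cvgB ha hb)).
    by apply: cvgD; apply: sqr.
  move/cvgr_distC_lt => /(_ e e0).
  by apply: filterS => m h _ _.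
have [m hm] := filter_ex near.
have [PL _ dev em] := good m.
have [s s2 [or fd]] := oriented_layout PL dev em Fn.
exists (fun v => ((phi_ m (pos v)).1, s * (phi_ m (pos v)).2)); split=> //.
move=> v t vF wF; rewrite -hex_dir_mod in wF *.
have := hm v vF (t %% 6)%N; rewrite mem_iota ltn_pmod // => /(_ isT vF wF).
have -> : len2 p u v (t %% 6) = len2 p u v t by rewrite /len2 /dir_weight hex_dir_mod.
congr (`|_ - _| < _); rewrite /sqd /=.
have -> (a b : R) : (s * a - s * b) ^+ 2 = s ^+ 2 * (a - b) ^+ 2 by ring.
by rewrite s2 mul1r.
Qed.

End EmbeddableLabels.

Theorem theorem4p7 (R : realType) (v1 v2 : R * R) (hbasis : is_basis v1 v2)
    (I : vertex -> vertex -> R)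
    (hI : weight hexT I)
    (hreg : regular hexT I)
    (hrange : (forall i j, edge hexT i j -> - 2^-1 < I i j <= 1) \/
              (forall i j, edge hexT i j -> 0 <= I i j))
    (hinv : translation_invariant hexT I)
    (hstruct : structure_condition hexT I)
    (w0 : vertex -> R)
    (hw0 : forall u v, w0 u = w0 v)
    (hl0 : cp_metric hexT I w0)
    (hl0D : weighted_Delaunay hexT I w0)
    (w : vertex -> R)
    (hl : gen_cp_metric hexT I (fun v => w0 v + w v))
    (hlflat : flat hexT (cp_length I (fun v => w0 v + w v)))
    (hlD : gen_weighted_Delaunay hexT I (fun v => w0 v + w v))
    (phi : R * R -> R * R)
    (hphi : developing_map v1 v2 hexT (cp_length I (fun v => w0 v + w v)) phi)
    (hemb : embeddable v1 v2 phi) :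
  forall u v, w u = w v.
Proof.
set u := fun v => w0 v + w v.
have pN1 := dir_weight_gtN1 hI hinv; have p3 := dir_weight3 hI hinv.
have wp := dir_weights hI hreg hrange hinv hstruct.
have acute := acute_weights hI hinv hw0 hl0 hl0D.
have fu : flat_label (dir_weight I) u := flat_label_cp hI hinv hl hlflat hlD.
have eu : embeddable_label (dir_weight I) u := embeddable_label_cp hbasis hI hinv hphi hemb.
have uc := constant_of_linear p3 wp pN1 acute (linear_label_const p3 pN1 wp) fu eu.
by move=> a b; have := uc a b; rewrite /u (hw0 a b) => /addrI.
Qed.
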